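(* Let $n\ge 1$, let $d>0$, let $[a_{ij}]$ be a positive definite symmetric $n\times n$ matrix, let $(\zeta_1,\dots,\zeta_n)\in\mathbb{C}^n$, and let \[\Omega=\Big\{(z_1,\dots,z_n)\in\mathbb{C}^n:\ \sum_{i,j=1}^n a_{ij}(z_i-\zeta_i)\overline{(z_j-\zeta_j)}<d\Big\}.\] Then there exists a $\mathcal{C}^\infty$ smooth positive weight $\omega$ on $\partial\Omega$ such that, for every integer $N\ge 0$, the weighted Szegő projection $S_\omega$ of $\Omega$ satisfies $S_\omega(P_N)=HP_N$.
   Context: Identify $\mathbb{C}^n$ with $\mathbb{R}^{2n}$, writing $z_j=x_j+iy_j$. $P_N$ denotes the space of complex-valued polynomials in $x_1,y_1,\dots,x_n,y_n$ of total degree at most $N$ (not necessarily holomorphic); $HP_N$ denotes the space of holomorphic polynomials $\sum_{|\alpha|\le N}c_\alpha z^\alpha$ of degree at most $N$. For a bounded smooth domain $\Omega\subseteq\mathbb{C}^n$ and a smooth positive function $\omega$ on $\partial\Omega$, the weighted Hardy space $H^2_\omega(\partial\Omega)$ is the closure in $L^2(\partial\Omega,\omega\,d\sigma)$ (with $d\sigma$ surface measure and inner product $\langle f,g\rangle=\int_{\partial\Omega}f\bar g\,\omega\,d\sigma$) of the boundary values of holomorphic functions on $\Omega$ continuous up to $\partial\Omega$; the weighted Szegő projection $S_\omega$ is the orthogonal projection of $L^2(\partial\Omega,\omega\,d\sigma)$ onto $H^2_\omega(\partial\Omega)$. A polynomial is acted on by $S_\omega$ via its restriction to $\partial\Omega$,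 and $S_\omega(P_N)=HP_N$ means that the set of projections of elements of $P_N$ equals the set of boundary values of elements of $HP_N$. *)

(* Defs.v *)
From HB Require Import structures.
From mathcomp Require Import all_boot all_order all_algebra.
From mathcomp Require Import all_classical all_reals all_analysis.
From mathcomp Require Import complex.
Import Order.TTheory GRing.Theory Num.Theory numFieldNormedType.Exports.

Set Implicit Arguments.
Unset Strict Implicit.
Unset Printing Implicit Defensive.

Local Open Scope classical_set_scope.
Local Open Scope ring_scope.

Notation Cx R := ((R[i])^o).
Notation Cn R n := ('rV[Cx R]_n).

Definition creal (R : realType) (x : R) : Cx R := (x%:C)%C.

Definition rho (R : realType) (n : nat) (A : 'M[R]_n) (zeta : Cn R n)
    (z : Cn R n) : Cx R :=
  \sum_(i < n) \sum_(j < n)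
     creal (A i j) * (z 0 i - zeta 0 i) * conjc (z 0 j - zeta 0 j).

(* Omega = { z : rho(z) < d }  (the comparison is in C, where rho(z) is real) *)
Definition ellipsoid (R : realType) (n : nat) (A : 'M[R]_n) (zeta : Cn R n)
    (d : R) : set (Cn R n) :=
  [set z | rho A zeta z < creal d].

Definition bdry (R : realType) (n : nat) (O : set (Cn R n)) : set (Cn R n) :=
  closure O `\` O°.

Definition edist (R : realType) (n : nat) (z w : Cn R n) : R :=
  Num.sqrt (\sum_(i < n) ((complex.Re (z 0 i - w 0 i)) ^+ 2
                          + (complex.Im (z 0 i - w 0 i)) ^+ 2)).

Definition upd (R : realType) (n : nat) (z : Cn R n) (k : nat) (c : Cx R)
  : Cn R n := \row_(i < n) (if (i : nat) == k then c else z 0 i).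

Fixpoint iint (R : realType) (n : nat) (k : nat) (g : Cn R n -> R)
    (z : Cn R n) : R :=
  match k with
  | 0 => g z
  | k'.+1 =>
      Rintegral lebesgue_measure setT (fun x : R =>
        Rintegral lebesgue_measure setT (fun y : R =>
          iint k' g (upd z k' ((x +i* y)%C))))
  end.

Definition vol_int (R : realType) (n : nat) (g : Cn R n -> Cx R) : Cx R :=
  ((iint n (fun z => complex.Re (g z)) 0) +i* (iint n (fun z => complex.Im (g z)) 0))%C.

Definition tube (R : realType) (n : nat) (O : set (Cn R n)) (eps : R)
  : set (Cn R n) :=
  [set z | O z /\ exists2 w, bdry O w & edist z w < eps].

(* Integral of g (continuous on the closure of O) against the Euclidean surface
   measure dsigma of the smooth boundary of O, defined through the
   (inner) tube / Minkowski-content formula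
     int_{bd O} g dsigma = lim_{eps -> 0+} eps^-1 int_{z in O, dist(z, bd O) < eps} g dV.
   [bdry_integral_is O g L] means that this integral exists and equals L. *)
Definition bdry_integral_is (R : realType) (n : nat) (O : set (Cn R n))
    (g : Cn R n -> Cx R) (L : Cx R) : Prop :=
  (fun eps : R => creal eps^-1 *
      vol_int (fun z => if `[< tube O eps z >] then g z else 0))
    @ 0^'+ --> L.

(* F is holomorphic on the open set O (continuous, and complex differentiable
   in each variable separately) and continuous up to the boundary *)
Definition holo_cont (R : realType) (n : nat) (O : set (Cn R n))
    (F : Cn R n -> Cx R) : Prop :=
  {within closure O, continuous F} /\
  (forall z, O z -> forall j : 'I_n,
     derivable (fun w : Cx R => F (z + w *: delta_mx 0 j)) 0 1).

(* f is orthogonal in L^2(bd O, omega dsigma) to every boundary value of a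
   function holomorphic on O and continuous up to the boundary, hence (these
   being dense by definition) to the whole weighted Hardy space H^2_omega:
     < f, F > = int_{bd O} f conj(F) omega dsigma = 0. *)
Definition orth_hardy (R : realType) (n : nat) (O : set (Cn R n))
    (omega : Cn R n -> R) (f : Cn R n -> Cx R) : Prop :=
  forall F, holo_cont O F ->
    bdry_integral_is O (fun z => f z * conjc (F z) * creal (omega z)) 0.

(* S_omega f = g on bd O, for g holomorphic on O and continuous up to bd O
   (so g lies in H^2_omega): characterised by f - g being orthogonal to H^2_omega *)
Definition szego_proj_is (R : realType) (n : nat) (O : set (Cn R n))
    (omega : Cn R n -> R) (f g : Cn R n -> Cx R) : Prop :=
  holo_cont O g /\ orth_hardy O omega (f - g).

Definition szego_image_eq (R : realType) (n : nat) (O : set (Cn R n))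
    (omega : Cn R n -> R) (P Q : set (Cn R n -> Cx R)) : Prop :=
  (forall p, P p -> exists2 h, Q h & szego_proj_is O omega p h) /\
  (forall h, Q h -> exists2 p, P p & szego_proj_is O omega p h).

Definition polyPN (R : realType) (n N : nat) : set (Cn R n -> Cx R) :=
  [set p | exists c : {ffun 'I_n -> 'I_N.+1} -> {ffun 'I_n -> 'I_N.+1} -> Cx R,
     forall z : Cn R n, p z =
       \sum_(a : {ffun 'I_n -> 'I_N.+1}) \sum_(b : {ffun 'I_n -> 'I_N.+1})
         (if (\sum_(i < n) (a i : nat) + \sum_(i < n) (b i : nat) <= N)%N
          then c a b * \prod_(i < n) (creal (complex.Re (z 0 i)) ^+ a i *
                                       creal (complex.Im (z 0 i)) ^+ b i)
          else 0)].

Definition polyHPN (R : realType) (n N : nat) : set (Cn R n -> Cx R) :=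
  [set h | exists c : {ffun 'I_n -> 'I_N.+1} -> Cx R,
     forall z : Cn R n, h z =
       \sum_(a : {ffun 'I_n -> 'I_N.+1})
         (if (\sum_(i < n) (a i : nat) <= N)%N
          then c a * \prod_(i < n) (z 0 i) ^+ a i
          else 0)].

Definition pder (R : realType) (n : nat) (ds : seq (Cn R n)) (f : Cn R n -> R)
  : Cn R n -> R :=
  foldr (fun v g => fun z => derive1 (fun t : R => g (z + creal t *: v)) 0) f ds.

Definition smooth (R : realType) (n : nat) (f : Cn R n -> R) : Prop :=
  forall ds : seq (Cn R n),
    continuous (pder ds f) /\
    forall (z v : Cn R n), derivable (fun t : R => pder ds f (z + creal t *: v)) 0 1.

(* Main.v *)
(* With omega = 1, only the invariance of Omega under the rotations
   z |-> zeta + c (z - zeta), |c| = 1, is used. Let Lam_eps be the normalised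
   integral over the inner tube of width eps. Averaging over dilations and using
   the convexity of Omega, Lam_eps g is almost monotone in eps for g >= 0, so the
   boundary integral of every continuous function exists.
     A monomial p = (z - zeta)^al conj(z - zeta)^be has weight m = |al| - |be|
   under the rotations. Let h be its orthogonal projection on the span of the
   (z - zeta)^ga with |ga| = m, and q = p - h; then q is orthogonal in the limit
   to every holomorphic monomial (those of another weight by rotation
   invariance). For F holomorphic in Omega and continuous up to the boundary,
   Psi(c) = Lam_eps(conj q * F(zeta + c (z - zeta))) is holomorphic in |c| < 1 and
   Psi(e^(i th) c) = e^(i m th) Psi(c), whence Psi(t) = t^m Psi(1). Replacing F by
   its Taylor polynomial at zeta costs O(t^(M+1)) in Psi(t), with M >= m, hence
   O(t) in Psi(1) = Lam_eps(conj q * F), which therefore tends to 0. *)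
From Pilot Require Import Defs.
From HB Require Import structures.
From mathcomp Require Import all_boot all_order all_algebra.
From mathcomp Require Import all_classical all_reals all_analysis.
From mathcomp Require Import measurable_realfun.
From mathcomp Require Import complex.
From mathcomp Require Import ring lra.
Import Order.TTheory GRing.Theory Num.Theory numFieldNormedType.Exports.
Import complex.ComplexField.Normc.
Set Implicit Arguments.
Unset Strict Implicit.
Unset Printing Implicit Defensive.
Local Open Scope classical_set_scope.
Local Open Scope ring_scope.

(** * Topology of the complex numbers *)

(** The degree bound comes from the weights: [h] is spanned by monomials in z - zeta of degree
    exactly |al| - |be|, which is at most |al| + |be|, and [h] is 0 when |al| < |be|. Conversely, a
    holomorphic polynomial is its own projection. The boundary integral is given only as a limit of
    tube integrals, so even the inner product behind the projection is available only once these
    limits are known to exist for all continuous integrands. The test function is merely continuous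
    up to the boundary, so its Taylor polynomials at the centre need not approximate it there; this
    is why the pairing is studied after a contraction. The contraction factor is fixed before the
    tube width tends to 0: the contracted Taylor polynomial depends on it, while the error bound is
    uniform in the width. Holomorphy is given one variable at a time. Cauchy's theorem is therefore
    proved on discs, the Taylor expansion is iterated over the variables, and differentiability
    along complex lines through the centre is deduced from it. Volume integrals are iterated
    integrals over the line, so Fubini and the Jacobian of a complex dilation are built from
    one-variable facts. *)

Section ComplexTopology.
Variable R : realType.
Implicit Types (z w : Cx R).

Lemma normcE_creal z : `|z| = creal (normc z).
Proof. by case: z. Qed.

Lemma ncD z w : normc (z + w) <= normc z + normc w.
Proof. exact: (@le_normcD R z w). Qed.

Lemma ncN z : normc (- z) = normc z.
Proof. exact: (@normcN R z). Qed.

Lemma nc_ge0 z : 0 <= normc z.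
Proof. by case: z => a b; exact: sqrtr_ge0. Qed.

Lemma normc_creal (x : R) : normc (creal x) = `|x|.
Proof. by rewrite /= expr0n addr0 sqrtr_sqr. Qed.

Lemma ncB z w : normc (z - w) = normc (w - z).
Proof. by rewrite -ncN opprB. Qed.

Lemma ncX z k : normc (z ^+ k) = normc z ^+ k.
Proof.
elim: k => [|k ih]; first by rewrite !expr0 normc1.
by rewrite !exprS normcM ih.
Qed.

Lemma ncJ z : normc (conjc z) = normc z.
Proof. by case: z => a b /=; rewrite sqrrN. Qed.

Lemma Re_le_normc z : `|complex.Re z| <= normc z.
Proof.
case: z => a b /=; rewrite -sqrtr_sqr ler_sqrt ?lerDl ?sqr_ge0//.
by rewrite addr_ge0 ?sqr_ge0.
Qed.

Lemma Im_le_normc z : `|complex.Im z| <= normc z.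
Proof.
case: z => a b /=; rewrite -sqrtr_sqr ler_sqrt ?lerDr ?sqr_ge0//.
by rewrite addr_ge0 ?sqr_ge0.
Qed.

Lemma normc_le_ReIm z : normc z <= `|complex.Re z| + `|complex.Im z|.
Proof.
case: z => a b /=.
rewrite -(ger0_norm (addr_ge0 (normr_ge0 a) (normr_ge0 b))) -sqrtr_sqr.
rewrite ler_sqrt ?sqr_ge0// sqrrD !real_normK ?num_real//.
by rewrite -addrA lerD2l lerDr mulrn_wge0// mulr_ge0.
Qed.

(** In the order of [R[i]] a positive element has imaginary part 0; this turns every epsilon of the
    complex topology into a real one. *)
Lemma creal_gt0 (e : Cx R) : 0 < e -> exists2 r : R, 0 < r & e = creal r.
Proof.
case: e => a b; rewrite ltcE /= => /andP[/eqP -> a0].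
by exists a.
Qed.

Lemma cvgcP (T : Type) (F : set_system T) (FF : Filter F) (f : T -> Cx R) (L : Cx R) :
  f @ F --> L <-> forall e : R, 0 < e -> \forall x \near F, normc (L - f x) < e.
Proof.
split.
  move=> /cvgrPdist_lt fL e e0.
  have := fL (creal e); rewrite ltcR => /(_ e0).
  by apply: filterS => x; rewrite normcE_creal ltcR.
move=> fL; apply/cvgrPdist_lt => e /creal_gt0[r r0 ->].
by apply: filterS (fL _ r0) => x; rewrite normcE_creal ltcR.
Qed.

Lemma continuousRP (X : topologicalType) (f : X -> R) :
  continuous f <-> forall x (e : R), 0 < e -> \forall y \near x, `|f x - f y| < e.
Proof.
split=> [cf x e e0|H x]; last by apply/cvgrPdist_lt => e e0; exact: H.
by move/cvgrPdist_lt : (cf x); exact.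
Qed.

Lemma continuousCP (X : topologicalType) (f : X -> Cx R) :
  continuous f <-> forall x (e : R), 0 < e -> \forall y \near x, normc (f x - f y) < e.
Proof.
split=> [cf x e e0|H x]; last by apply/cvgcP => e e0; exact: H.
by move/cvgcP : (cf x); exact.
Qed.

Lemma near_normc z (e : R) : 0 < e -> \forall w \near z, normc (z - w) < e.
Proof.
move=> e0; have cid : continuous (@id (Cx R)) by move=> ?; exact: cvg_id.
exact: (continuousCP (@id (Cx R))).1 cid z e e0.
Qed.

Lemma continuous_Re : continuous (fun z : Cx R => complex.Re z).
Proof.
apply/continuousRP => z e e0; have := near_normc z e0.
by apply: filterS => w; apply: le_lt_trans; rewrite -raddfB; exact: Re_le_normc.
Qed.

Lemma continuous_Im : continuous (fun z : Cx R => complex.Im z).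
Proof.
apply/continuousRP => z e e0; have := near_normc z e0.
by apply: filterS => w; apply: le_lt_trans; rewrite -raddfB; exact: Im_le_normc.
Qed.

Lemma cvg_Complex (T : Type) (F : set_system T) (FF : Filter F) (f g : T -> R) (a b : R) :
  f @ F --> a -> g @ F --> b ->
  (fun x => Complex (f x) (g x) : Cx R) @ F --> (Complex a b : Cx R).
Proof.
move=> fa gb; apply/cvgcP => e e0.
have e2 : 0 < e / 2 by rewrite divr_gt0.
move/cvgrPdist_lt/(_ _ e2) : fa; move/cvgrPdist_lt/(_ _ e2) : gb.
apply: filterS2 => x gx fx.
apply: le_lt_trans (normc_le_ReIm _) _ => /=.
by rewrite (splitr e) ltrD.
Qed.

Lemma continuous_creal : continuous (@creal R).
Proof. by move=> x; apply: cvg_Complex; [exact: cvg_id|exact: cvg_cst]. Qed.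

Lemma continuous_conjc : continuous (fun z : Cx R => conjc z : Cx R).
Proof.
apply/continuousCP => z e e0; have := near_normc z e0.
by apply: filterS => w; rewrite -rmorphB ncJ.
Qed.

Lemma continuous_rowP (X : topologicalType) n (f : X -> Cn R n) :
  (forall i, continuous (fun x => f x 0 i)) -> continuous f.
Proof.
move=> cf x; apply/cvg_mx_entourageP => A entA.
have H (ij : 'I_1 * 'I_n) : \forall y \near x, (f x ij.1 ij.2, f y ij.1 ij.2) \in A.
  case: ij => i j; rewrite /= (ord1 i).
  have /cvg_entourageP/(_ A entA) H := cf j x.
  by apply: (@filterS _ (nbhs x) _ _ _ _ H) => y; rewrite inE.
have : \forall y \near x, forall ij, (f x ij.1 ij.2, f y ij.1 ij.2) \in A.
  exact: filter_forall.
by apply: filterS => y Hy i j; exact: (Hy (i, j)).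
Qed.

Lemma continuous_coord n (i : 'I_n) : continuous (fun z : Cn R n => z 0 i).
Proof. exact: coord_continuous. Qed.

Lemma continuous_upd (X : topologicalType) n k (f : X -> Cn R n) (g : X -> Cx R) :
  continuous f -> continuous g -> continuous (fun x => upd (f x) k (g x)).
Proof.
move=> cf cg; apply: continuous_rowP => i.
have [ik|ik] := eqVneq (i : nat) k.
  rewrite (_ : (fun _ => _) = g)//; apply/funext => x.
  by rewrite mxE ik eqxx.
rewrite (_ : (fun _ => _) = (fun x => f x 0 i)); last first.
  by apply/funext => x; rewrite mxE (negbTE ik).
move=> x; apply: (@continuous_comp _ _ _ f (fun z : Cn R n => z 0 i)).
  exact: cf.
exact: continuous_coord.
Qed.

End ComplexTopology.

(** * Integrals over segments *)

Section Integral.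
Variable R : realType.
Local Notation mu := (@lebesgue_measure R).

(** Unoriented: the value is 0 when [b < a], which is why order hypotheses or a case split on the
    endpoints accompany many rules. *)
Definition itg (a b : R) (f : R -> R) : R := \int[mu]_(x in `[a, b]) f x.
Definition itgb (a b : R) (f : R -> R) : Prop := mu.-integrable `[a, b] (EFin \o f).

Lemma itgb_meas (f : R -> R) (a b M : R) :
  measurable_fun setT f -> (forall x, `|f x| <= M) -> itgb a b f.
Proof.
move=> mf fM; apply: measurable_bounded_integrable => //.
- have := lebesgue_measure_itv `[a, b]; rewrite /= => ->.
  by case: ifP => // _; rewrite -EFinD ltry.
- exact: measurable_funS mf.
- exists M; split; first exact: num_real.
  by move=> y My x _; apply: le_trans (fM x) (ltW My).
Qed.

Lemma itgb_cont (f : R -> R) (a b : R) : continuous f -> itgb a b f.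
Proof.
move=> cf; apply: continuous_compact_integrable; first exact: segment_compact.
exact: continuous_subspaceT.
Qed.

Lemma itgD a b f g : itgb a b f -> itgb a b g ->
  itg a b (fun x => f x + g x) = itg a b f + itg a b g.
Proof. by move=> fi gi; rewrite /itg RintegralD. Qed.

Lemma itgB a b f g : itgb a b f -> itgb a b g ->
  itg a b (fun x => f x - g x) = itg a b f - itg a b g.
Proof. by move=> fi gi; rewrite /itg RintegralB. Qed.

Lemma itgZ a b c f : itgb a b f ->
  itg a b (fun x => c * f x) = c * itg a b f.
Proof. by move=> fi; rewrite /itg RintegralZl. Qed.

Lemma itg_eq a b f g : (forall x, a <= x <= b -> f x = g x) -> itg a b f = itg a b g.
Proof.
move=> fg; apply: eq_Rintegral => x; rewrite inE /= in_itv /= => xab.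
exact: fg.
Qed.

Lemma itg_le a b f g : itgb a b f -> itgb a b g ->
  (forall x, a <= x <= b -> f x <= g x) -> itg a b f <= itg a b g.
Proof.
move=> fi gi fg; apply: le_Rintegral => // x; rewrite /= in_itv /=; exact: fg.
Qed.

Lemma itg_cst a b c : a <= b -> itg a b (fun=> c) = c * (b - a).
Proof.
move=> ab; rewrite /itg Rintegral_cst//.
have := lebesgue_measure_itv `[a, b]; rewrite /= => ->.
rewrite lte_fin; case: ltP => // ba.
by rewrite (_ : b = a) ?subrr//; apply/eqP; rewrite eq_le ba ab.
Qed.

Lemma itg_norm a b f M : a <= b -> itgb a b f ->
  (forall x, a <= x <= b -> `|f x| <= M) -> `|itg a b f| <= M * (b - a).
Proof.
move=> ab fi fM; rewrite ler_norml; apply/andP; split.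
  rewrite -mulNr -itg_cst//; apply: itg_le => //.
    by apply: itgb_cont; exact: cst_continuous.
  by move=> x /fM; rewrite ler_norml => /andP[].
rewrite -itg_cst//; apply: itg_le => //.
  by apply: itgb_cont; exact: cst_continuous.
by move=> x /fM; rewrite ler_norml => /andP[].
Qed.

Lemma itg_lt0 a b f : b < a -> itg a b f = 0.
Proof.
move=> ba; rewrite /itg set_itv_ge ?Rintegral_set0//.
by rewrite bnd_simp -ltNge.
Qed.

Lemma itg_FTC (a b : R) (f F : R -> R) : a <= b -> continuous f ->
  (forall x, is_derive x (1 : R) F (f x)) -> itg a b f = F b - F a.
Proof.
rewrite le_eqVlt => /predU1P[->|ab] cf dF.
  by rewrite /itg set_itv1 Rintegral_set1 subrr.
rewrite /itg /Rintegral (@continuous_FTC2 _ f F)//.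
- exact: continuous_subspaceT.
- have cF : continuous F.
    move=> x; apply: differentiable_continuous; apply/derivable1_diffP.
    by have [] := dF x.
  split => [x _||]; first by have [] := dF x.
  - by apply: cvg_at_right_filter; exact: cF.
  - by apply: cvg_at_left_filter; exact: cF.
- by move=> x _; rewrite derive1E; have [_ ->] := dF x.
Qed.

Lemma itg_cat a b c f : a <= b -> b <= c -> itgb a c f ->
  itg a c f = itg a b f + itg b c f.
Proof.
move=> ab bc fi.
have := @Rintegral_itvB _ f (BLeft a) (BRight c) b fi.
rewrite !bnd_simp => /(_ ab bc) h.
have fi' : mu.-integrable `]b, c] (EFin \o f).
  by apply: integrableS fi => //; apply: subset_itvr; rewrite bnd_simp.
rewrite /itg -(Rintegral_itv_obnd_cbnd fi') -h addrC.
by symmetry; exact: subrK.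
Qed.

(** Dominated convergence with a constant bound. It carries identities from continuous integrands
    over to their bounded pointwise limits. *)
Lemma itg_cvg (a b : R) (h : nat -> R -> R) (f : R -> R) (M : R) :
  (forall m, measurable_fun setT (h m)) -> (forall m x, `|h m x| <= M) ->
  (forall x, h m x @[m --> \oo] --> f x) ->
  itg a b (h m) @[m --> \oo] --> itg a b f.
Proof.
move=> mh hM hf.
have mf : measurable_fun setT f.
  by apply: (@measurable_fun_cvg _ _ _ setT h) => // x _; exact: hf.
have mI : measurable `[a, b]%classic by [].
have h1 m : measurable_fun `[a, b] (EFin \o h m).
  by apply/measurable_EFinP; exact: measurable_funS (mh m).
have h2 : measurable_fun `[a, b] (EFin \o f).
  by apply/measurable_EFinP; exact: measurable_funS mf.
have h3 : \forall x \ae mu, `[a, b]%classic x -> (EFin \o h m) x @[m --> \oo] --> (EFin \o f) x.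
  by apply: aeW => x _; apply: cvg_EFin; [exact: nearW|exact: hf].
have h4 : mu.-integrable `[a, b] (EFin \o cst M).
  by apply: (@itgb_meas _ _ _ `|M|).
have h5 : \forall x \ae mu, forall m, `[a, b]%classic x -> (`|(EFin \o h m) x| <= (EFin \o cst M) x)%E.
  by apply: aeW => x m _; rewrite /= lee_fin.
have [fi _ hc] := dominated_convergence (mu := mu) mI h1 h2 h3 h4 h5.
rewrite /itg /Rintegral; apply: fine_cvg; rewrite fineK//.
exact: (integrable_fin_num _ fi).
Qed.

Lemma pair_continuousr (X Y : topologicalType) (x : X) : continuous (fun y : Y => (x, y)).
Proof. by move=> y; apply: (@cvg_pair _ _ _ _ (nbhs x) (nbhs y)); [exact: cvg_cst|exact: cvg_id]. Qed.

Lemma pair_continuousl (X Y : topologicalType) (y : Y) : continuous (fun x : X => (x, y)).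
Proof. by move=> x; apply: (@cvg_pair _ _ _ _ (nbhs x) (nbhs y)); [exact: cvg_id|exact: cvg_cst]. Qed.

(** Tube lemma: for y' near a point y of the compact set and x' near [x], both [g (x, y')] and
    [g (x', y')] are within [e / 2] of [g (x, y)]; compactness makes the neighbourhood of [x] common
    to all points of [K]. *)
Lemma near_compact_continuous (X Y : topologicalType) (g : X * Y -> R) (K : set Y) x (e : R) :
  continuous g -> compact K -> 0 < e ->
  \forall x' \near x, forall y, K y -> `|g (x, y) - g (x', y)| < e.
Proof.
move=> cg cK e0.
have cgx : continuous (fun y => g (x, y)).
  move=> y; apply: (@continuous_comp _ _ _ (fun y => (x, y)) g); last exact: cg.
  exact: pair_continuousr.
move: cK; rewrite compact_near_coveringP => /near_covering_withinP.
move=> /(_ X (nbhs x) (fun x' y => `|g (x, y) - g (x', y)| < e) _) H.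
apply: H => y _.
have e2 : 0 < e / 2 by rewrite divr_gt0.
have /continuousRP/(_ (x, y) _ e2) H := cg.
have /continuousRP/(_ y _ e2) H2 := cgx.
have H3 : \forall y' \near y & x' \near x, `|g (x, y) - g (x', y')| < e / 2.
  case: H => -[A B] /= [xA yB] AB; exists (B, A) => // -[y' x'] /= [By' Ax'].
  exact: (AB (x', y')).
have H4 : \forall y' \near y & x' \near x, `|g (x, y) - g (x, y')| < e / 2.
  by exists ([set y' | `|g (x, y) - g (x, y')| < e / 2], setT) => [|[y' x'] []]//;
    split => //; exact: filterT.
apply: filterS2 H3 H4 => -[y' x'] /= h3 h4 _.
rewrite (splitr e) -(subrKA (g (x, y))) (le_lt_trans (ler_normD _ _))//.
by rewrite (distrC (g (x, y'))) ltrD.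
Qed.

Lemma near_itv_continuous (X : topologicalType) (g : X * R -> R) (a b : R) x (e : R) :
  continuous g -> 0 < e ->
  \forall x' \near x, forall y, a <= y <= b -> `|g (x, y) - g (x', y)| < e.
Proof.
move=> cg e0; have := near_compact_continuous x cg (@segment_compact R a b) e0.
by apply: filterS => x' hx y yab; apply: hx; rewrite /= in_itv.
Qed.

Lemma itg_cont_param (X : topologicalType) (g : X * R -> R) a b :
  continuous g -> continuous (fun x => itg a b (fun y => g (x, y))).
Proof.
move=> cg; have [ba|ab] := ltP b a.
  rewrite (_ : (fun _ => _) = cst 0); first exact: cst_continuous.
  by apply/funext => x; rewrite itg_lt0.
have cgx x : continuous (fun y => g (x, y)).
  move=> y; apply: (@continuous_comp _ _ _ (fun y => (x, y)) g); last exact: cg.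
  exact: pair_continuousr.
apply/continuousRP => x e e0.
have ba1 : 0 < b - a + 1 by rewrite ltr_wpDl// subr_ge0.
pose e' := e / (b - a + 1).
have e'0 : 0 < e' by rewrite divr_gt0.
have := near_itv_continuous a b x cg e'0.
apply: filterS => x' hx.
rewrite -itgB; [|exact: itgb_cont..].
apply: (@le_lt_trans _ _ (e' * (b - a))).
  apply: itg_norm => //; first by apply: itgb_cont => y; apply: continuousB; exact: cgx.
  by move=> y yab; apply/ltW/hx.
rewrite /e' mulrAC ltr_pdivrMr// ltr_pM2l//; lra.
Qed.

(* Bounded pointwise limits of sequences of bounded continuous functions: a class
   that contains the indicators of open sets and is stable under integration over
   a parameter (dominated convergence), which avoids product measures. *)
Definition baire1 (X : topologicalType) (g : X -> R) : Prop :=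
  exists h : nat -> X -> R, exists M : R,
    [/\ forall m, continuous (h m), forall m x, `|h m x| <= M
      & forall x, h m x @[m --> \oo] --> g x].

Lemma baire1_bounded (X : topologicalType) (g : X -> R) : baire1 g ->
  exists2 M, 0 <= M & forall x, `|g x| <= M.
Proof.
move=> [h [M [_ hM hg]]]; exists `|M| => // x.
have hn : `|h m x| @[m --> \oo] --> `|g x| by exact: cvg_norm (hg x).
apply: (@closed_cvg _ _ \oo _ _ (fun y : R => y <= `|M|) _ _ _ hn) => //.
by apply: nearW => m; apply: le_trans (hM m x) (ler_norm _).
Qed.

Lemma baire1_comp (X Y : topologicalType) (g : X -> R) (u : Y -> X) :
  continuous u -> baire1 g -> baire1 (g \o u).
Proof.
move=> cu [h [M [ch hM hg]]]; exists (fun m => h m \o u), M; split => //.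
- by move=> m x; apply: continuous_comp; [exact: cu|exact: ch].
- by move=> m x /=.
- by move=> x; exact: hg.
Qed.

Lemma baire1_cont (X : topologicalType) (g : X -> R) M :
  continuous g -> (forall x, `|g x| <= M) -> baire1 g.
Proof.
move=> cg gM; exists (fun=> g), M; split => // x; exact: cvg_cst.
Qed.

Lemma baire1_cst (X : topologicalType) c : baire1 (fun _ : X => c).
Proof. by apply: (@baire1_cont _ _ `|c|) => // x; exact: cvg_cst. Qed.

Lemma baire1D (X : topologicalType) (f g : X -> R) : baire1 f -> baire1 g -> baire1 (fun x => f x + g x).
Proof.
move=> [h [M [ch hM hg]]] [h' [M' [ch' hM' hg']]].
exists (fun m x => h m x + h' m x), (M + M'); split.
- by move=> m x; apply: continuousD; [exact: ch|exact: ch'].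
- by move=> m x; rewrite (le_trans (ler_normD _ _))// lerD.
- by move=> x; apply: cvgD; [exact: hg|exact: hg'].
Qed.

Lemma baire1M (X : topologicalType) (f g : X -> R) : baire1 f -> baire1 g -> baire1 (fun x => f x * g x).
Proof.
move=> [h [M [ch hM hg]]] [h' [M' [ch' hM' hg']]].
exists (fun m x => h m x * h' m x), (M * M'); split.
- by move=> m x; apply: continuousM; [exact: ch|exact: ch'].
- by move=> m x; rewrite normrM ler_pM.
- by move=> x; apply: cvgM; [exact: hg|exact: hg'].
Qed.

Lemma baire1Z (X : topologicalType) (f : X -> R) c : baire1 f -> baire1 (fun x => c * f x).
Proof. by move=> bf; apply: baire1M => //; exact: baire1_cst. Qed.

Lemma continuous_maxr (X : topologicalType) (f g : X -> R) : continuous f -> continuous g ->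
  continuous (fun x => Num.max (f x) (g x)).
Proof.
move=> cf cg; rewrite (_ : (fun _ => _) = fun x => (f x + g x + `|f x - g x|) / 2).
  move=> x; apply: cvgM; last exact: cvg_cst.
  apply: cvgD; first by apply: cvgD; [exact: cf|exact: cg].
  by apply: cvg_norm; apply: cvgB; [exact: cf|exact: cg].
by apply/funext => x; rewrite maxr_absE.
Qed.

Lemma continuous_minr (X : topologicalType) (f g : X -> R) : continuous f -> continuous g ->
  continuous (fun x => Num.min (f x) (g x)).
Proof.
move=> cf cg; rewrite (_ : (fun _ => _) = fun x => (f x + g x - `|f x - g x|) / 2).
  move=> x; apply: cvgM; last exact: cvg_cst.
  apply: cvgB; first by apply: cvgD; [exact: cf|exact: cg].
  by apply: cvg_norm; apply: cvgB; [exact: cf|exact: cg].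
by apply/funext => x; rewrite minr_absE.
Qed.

(* The indicator of {f > 0} is the limit of min(1, m f^+). *)
Lemma baire1_pos (X : topologicalType) (f : X -> R) : continuous f ->
  baire1 (fun x => if 0 < f x then 1 else 0).
Proof.
move=> cf; exists (fun m x => Num.min 1 (m%:R * Num.max 0 (f x))), 1; split.
- move=> m; apply: continuous_minr; first by move=> ?; exact: cvg_cst.
  move=> x; apply: cvgM; first exact: cvg_cst.
  apply: (@continuous_maxr _ (cst 0) f) => // ?; exact: cvg_cst.
- move=> m x; rewrite ger0_norm ?ge_min ?lexx// le_min ler01/= mulr_ge0//.
  by rewrite le_max lexx.
- move=> x; case: ifPn => [fx|fx]; last first.
    rewrite (_ : (fun m : nat => _) = cst 0); first exact: cvg_cst.
    apply/funext => m; rewrite -leNgt in fx.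
    by rewrite (max_l fx) mulr0 min_r.
  apply: cvg_near_cst; exists (Num.truncn (f x)^-1).+1 => // m /= hm.
  rewrite max_r ?(ltW fx)// min_l// -ler_pdivrMr// div1r.
  have := truncnS_gt (f x)^-1; move/ltW/le_trans; apply.
  by rewrite ler_nat.
Qed.

Lemma baire1_meas (g : R -> R) : baire1 g -> measurable_fun setT g.
Proof.
move=> [h [M [ch hM hg]]].
apply: (@measurable_fun_cvg _ _ _ setT h) => [m|x _]; last exact: hg.
exact: continuous_measurable_fun.
Qed.

Lemma baire1_itgb (g : R -> R) a b : baire1 g -> itgb a b g.
Proof.
move=> bg; have [M _ gM] := baire1_bounded bg.
exact: itgb_meas (baire1_meas bg) gM.
Qed.

Lemma baire1_sec (X Y : topologicalType) (g : X * Y -> R) x : baire1 g -> baire1 (fun y => g (x, y)).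
Proof. by apply: baire1_comp; exact: pair_continuousr. Qed.

(** The parameter integrals of the continuous approximants are continuous and bounded by
    [M * (b - a)], so they serve as approximants of the integral. *)
Lemma itg_baire1 (X : topologicalType) (g : X * R -> R) a b : baire1 g ->
  baire1 (fun x => itg a b (fun y => g (x, y))).
Proof.
move=> [h [M [ch hM hg]]]; have [ba|ab] := ltP b a.
  rewrite (_ : (fun _ => _) = cst 0); first exact: baire1_cst.
  by apply/funext => x; rewrite itg_lt0.
have chx m x : continuous (fun y => h m (x, y)).
  move=> y; apply: (@continuous_comp _ _ _ (fun y => (x, y)) (h m)); last exact: ch.
  exact: pair_continuousr.
exists (fun m x => itg a b (fun y => h m (x, y))), (M * (b - a)); split.
- by move=> m; exact: itg_cont_param.
- by move=> m x; apply: itg_norm => //; exact: itgb_cont.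
- move=> x; apply: (@itg_cvg _ _ _ _ M) => //.
  by move=> m; apply: continuous_measurable_fun.
Qed.

End Integral.

(** * Fubini and changes of variables *)

Section Fubini.
Variable R : realType.
Local Notation mu := (@lebesgue_measure R).

Lemma itg0 (a b : R) : itg a b (fun=> 0) = 0.
Proof. by rewrite /itg Rintegral_cst// mul0r. Qed.

Lemma itg_dist (a b : R) (f g : R -> R) (M : R) : a <= b -> itgb a b f -> itgb a b g ->
  (forall x, a <= x <= b -> `|f x - g x| <= M) -> `|itg a b f - itg a b g| <= M * (b - a).
Proof.
move=> ab fi gi fg; rewrite -itgB//; apply: itg_norm => //.
exact: (integrableB _ fi gi).
Qed.

Lemma itgb_cst (a b c : R) : itgb a b (fun=> c).
Proof. by apply: itgb_cont => x; exact: cvg_cst. Qed.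

Lemma is_derive_small (F : R -> R) (x l : R) :
  (forall e : R, 0 < e -> exists2 dl : R, 0 < dl & forall h : R, `|h| < dl ->
     `|F (x + h) - F x - l * h| <= e * `|h|) -> is_derive x (1 : R) F l.
Proof.
move=> H.
have cF : (fun h => h^-1 *: ((F \o shift x) (h *: (1 : R)) - F x)) @ 0^' --> l.
  apply/cvgrPdist_le => e e0; have [dl dl0 Hdl] := H e e0.
  near=> h; have h0 : h != 0 by near: h; exact: nbhs_dnbhs_neq.
  have hdl : `|h| < dl.
    by near: h; apply: dnbhs0_lt.
  have -> : l - h^-1 *: ((F \o shift x) (h *: (1 : R)) - F x) =
      - (h^-1 * (F (x + h) - F x - l * h)).
    rewrite /= /GRing.scale /= mulr1 (addrC h x) [in RHS]mulrBr opprB mulrCA mulVf//.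
    by rewrite mulr1.
  rewrite normrN normrM normfV -ler_pdivlMl ?invr_gt0 ?normr_gt0// invrK mulrC.
  by rewrite (mulrC h) (mulrC `|h|); exact: Hdl.
apply: DeriveDef; first by apply/cvg_ex; exists l.
exact: cvg_lim cF.
Unshelve. all: by end_near. Qed.

(* A function that is o(|s - t|) at each point has zero derivative once composed
   with the clamping of the line onto [a, b]. *)
Lemma cst_of_small_diff (F : R -> R) (a b : R) : a <= b ->
  (forall t (e : R), a <= t <= b -> 0 < e -> exists2 dl : R, 0 < dl &
     forall s, a <= s <= b -> `|s - t| < dl -> `|F s - F t| <= e * `|s - t|) ->
  F a = F b.
Proof.
move=> ab HF; pose cl t := Num.max a (Num.min t b).
have clab t : a <= cl t <= b.
  by rewrite /cl le_max lexx/= ge_max ab/= ge_min lexx orbT.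
have cllip s t : `|cl s - cl t| <= `|s - t|.
  have := ler_norm (s - t); have := ler_norm (t - s); rewrite (distrC t).
  move: (`|s - t|) => N; rewrite /cl /Order.max /Order.min.
  move=> h1 h2; rewrite ler_norml.
  case: (ltP s b) => ?; case: (ltP t b) => ?; do 2![case: ltP => ?]; apply/andP; split; lra.
have clE t : a <= t <= b -> cl t = t.
  by move=> /andP[at_ tb]; rewrite /cl min_l// max_r.
have dF x : is_derive x (1 : R) (F \o cl) 0.
  apply: is_derive_small => e e0; have [dl dl0 H] := HF _ _ (clab x) e0.
  exists dl => // h hdl; rewrite mul0r subr0 /=.
  have hh : `|cl (x + h) - cl x| <= `|h|.
    by apply: le_trans (cllip _ _) _; rewrite addrC addKr.
  apply: le_trans (H _ (clab _) (le_lt_trans hh hdl)) _.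
  by rewrite ler_pM2l.
have := is_derive_0_is_cst a b dF.
by rewrite /= !clE ?lexx ?ab.
Qed.

Let algD (A B C D : R) : A + B - (C + D) - (A - C) = B - D.
Proof. by ring. Qed.

(** Let [F t] be the difference of the two sides with upper limit [t]. Then [F t - F s] is [D s t],
    the same difference over a thin strip, where [g (x, y)] is uniformly close to [g (u, y)] for a
    fixed [u]. Both iterated integrals are then close to one product [m], so [F] is o(|t - s|) at
    every point and constant, and it vanishes at [a]. *)
Lemma itg_swap_cont (g : R * R -> R) (a b c d : R) : continuous g ->
  itg a b (fun x => itg c d (fun y => g (x, y))) =
  itg c d (fun y => itg a b (fun x => g (x, y))).
Proof.
move=> cg; have [ba|ab] := ltP b a.
  rewrite itg_lt0// [RHS](_ : _ = itg c d (fun=> 0)).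
    by rewrite itg0.
  by apply: itg_eq => y _; rewrite itg_lt0.
have [dc|cd] := ltP d c.
  rewrite [RHS]itg_lt0// [LHS](_ : _ = itg a b (fun=> 0)).
    by rewrite itg0.
  by apply: itg_eq => y _; rewrite itg_lt0.
have cgs : continuous (fun p : R * R => g (p.2, p.1)).
  move=> p; apply: (@continuous_comp _ _ _ (fun p : R * R => (p.2, p.1)) g); last exact: cg.
  by apply: (@cvg_pair _ _ _ _ (nbhs p.2) (nbhs p.1)); [exact: cvg_snd|exact: cvg_fst].
have cg1 x : continuous (fun y => g (x, y)).
  move=> y; apply: (@continuous_comp _ _ _ (fun y => (x, y)) g); last exact: cg.
  exact: pair_continuousr.
have cg2 y : continuous (fun x => g (x, y)).
  move=> x; apply: (@continuous_comp _ _ _ (fun x => (x, y)) g); last exact: cg.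
  exact: pair_continuousl.
have cI : continuous (fun x => itg c d (fun y => g (x, y))) by exact: itg_cont_param.
have cI' u v : continuous (fun y => itg u v (fun x => g (x, y))).
  exact: (itg_cont_param (g := fun p : R * R => g (p.2, p.1))).
pose F t := itg a t (fun x => itg c d (fun y => g (x, y))) -
            itg c d (fun y => itg a t (fun x => g (x, y))).
pose D s t := itg s t (fun x => itg c d (fun y => g (x, y))) -
            itg c d (fun y => itg s t (fun x => g (x, y))).
have FD s t : a <= s -> s <= t -> F t - F s = D s t.
  move=> as_ st; rewrite /F /D (itg_cat as_ st); last exact: itgb_cont.
  rewrite (_ : itg c d (fun y => itg a t (fun x => g (x, y))) =
    itg c d (fun y => itg a s (fun x => g (x, y))) + itg c d (fun y => itg s t (fun x => g (x, y)))).
    exact: algD.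
  rewrite -itgD; [|exact: itgb_cont..].
  by apply: itg_eq => y _; apply: itg_cat => //; exact: itgb_cont.
have Dsmall s t u (e : R) : s <= t -> 0 <= e ->
    (forall x, s <= x <= t -> forall y, c <= y <= d -> `|g (u, y) - g (x, y)| <= e) ->
    `|D s t| <= 2 * (e * (d - c) * (t - s)).
  move=> st e0 H; pose m := itg c d (fun y => g (u, y)) * (t - s).
  have h1 : `|itg s t (fun x => itg c d (fun y => g (x, y))) - m| <= e * (d - c) * (t - s).
    rewrite /m -itg_cst//; apply: itg_dist => //; [exact: itgb_cont|exact: itgb_cst|].
    move=> x xst; apply: itg_dist => //; [exact: itgb_cont..|].
    by move=> y ycd; rewrite distrC; exact: H.
  have h2 : `|itg c d (fun y => itg s t (fun x => g (x, y))) - m| <= e * (d - c) * (t - s).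
    have cm : continuous (fun y => (t - s) * g (u, y)).
      by move=> y; apply: cvgM; [exact: cvg_cst|exact: cg1].
    have -> : m = itg c d (fun y => (t - s) * g (u, y)).
      by rewrite itgZ /m; [rewrite mulrC|exact: itgb_cont].
    rewrite mulrAC; apply: itg_dist => //; [exact: itgb_cont..|].
    move=> y ycd; rewrite (mulrC (t - s)) -itg_cst//.
    apply: itg_dist => //; [exact: itgb_cont|exact: itgb_cst|].
    by move=> x xst; rewrite distrC; exact: H.
  rewrite /D -(subrKA m) (le_trans (ler_normD _ _))// (distrC m).
  by rewrite mulr_natl mulr2n; exact: lerD h1 h2.
have F0 : F a = F b.
  apply: cst_of_small_diff => // t e tab e0.
  have dc1 : 0 < 2 * (d - c + 1) by rewrite mulr_gt0// ltr_wpDl// subr_ge0.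
  pose e' := e / (2 * (d - c + 1)).
  have e'0 : 0 < e' by rewrite divr_gt0.
  have [dl /= dl0 Hdl] := near_itv_continuous c d t cg e'0.
  have He (A : R) : 0 <= A -> 2 * (e' * (d - c) * A) <= e * A.
    move=> A0; rewrite mulrA ler_wpM2r// /e'.
    have K0 : 0 < d - c + 1 by rewrite ltr_wpDl// subr_ge0.
    rewrite (_ : 2 * _ = e * ((d - c) / (d - c + 1))); last by field; exact: lt0r_neq0.
    apply: ler_piMr; first exact: ltW.
    by rewrite ler_pdivrMr// mul1r lerDl.
  exists dl => // s /andP[as_ sb] sdl.
  have close x : `|x - t| <= `|s - t| -> forall y, c <= y <= d -> `|g (t, y) - g (x, y)| <= e'.
    by move=> xt y ycd; apply/ltW/Hdl => //; rewrite /= distrC (le_lt_trans xt).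
  have [st|ts] := leP s t.
    rewrite distrC FD//.
    rewrite (distrC s) (ger0_norm (_ : 0 <= t - s)) ?subr_ge0//.
    apply: le_trans (Dsmall s t t e' st (ltW e'0) _) _; last by apply: He; rewrite subr_ge0.
    move=> x /andP[sx xt]; apply: close.
    by rewrite distrC (distrC s) !ger0_norm ?subr_ge0// lerB.
  have ts' := ltW ts; rewrite FD//; last by case/andP: tab.
  rewrite (ger0_norm (_ : 0 <= s - t)) ?subr_ge0//.
  apply: le_trans (Dsmall t s t e' (ltW ts) (ltW e'0) _) _; last by apply: He; rewrite subr_ge0 ltW.
  move=> x /andP[sx xt]; apply: close.
  by rewrite !ger0_norm ?subr_ge0// lerB.
have Faa : F a = 0.
  have E0 (f : R -> R) : itg a a f = 0 by rewrite /itg set_itv1 Rintegral_set1.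
  rewrite /F E0 sub0r (_ : itg c d _ = itg c d (fun=> 0)).
    by rewrite itg0 oppr0.
  by apply: itg_eq => y _; rewrite E0.
by apply/eqP; rewrite -subr_eq0 -/(F b) -F0 Faa.
Qed.

(** The exchange for the continuous approximants, followed by dominated convergence in the inner and
    then in the outer integral of each side. *)
Lemma itg_swap (g : R * R -> R) (a b c d : R) : baire1 g ->
  itg a b (fun x => itg c d (fun y => g (x, y))) =
  itg c d (fun y => itg a b (fun x => g (x, y))).
Proof.
move=> [h [M [ch hM hg]]].
have [dc|cd] := ltP d c.
  rewrite [RHS]itg_lt0// [LHS](_ : _ = itg a b (fun=> 0)).
    by rewrite itg0.
  by apply: itg_eq => y _; rewrite itg_lt0.
have [ba|ab] := ltP b a.
  rewrite itg_lt0// [RHS](_ : _ = itg c d (fun=> 0)).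
    by rewrite itg0.
  by apply: itg_eq => y _; rewrite itg_lt0.
have cg1 m x : continuous (fun y => h m (x, y)).
  move=> y; apply: (@continuous_comp _ _ _ (fun y => (x, y)) (h m)); last exact: ch.
  exact: pair_continuousr.
have cg2 m y : continuous (fun x => h m (x, y)).
  move=> x; apply: (@continuous_comp _ _ _ (fun x => (x, y)) (h m)); last exact: ch.
  exact: pair_continuousl.
have cgs m : continuous (fun p : R * R => h m (p.2, p.1)).
  move=> p; apply: (@continuous_comp _ _ _ (fun p : R * R => (p.2, p.1)) (h m)); last exact: ch.
  by apply: (@cvg_pair _ _ _ _ (nbhs p.2) (nbhs p.1)); [exact: cvg_snd|exact: cvg_fst].
have L : itg a b (fun x => itg c d (fun y => h m (x, y))) @[m --> \oo] -->
    itg a b (fun x => itg c d (fun y => g (x, y))).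
  apply: (@itg_cvg _ _ _ (fun m x => itg c d (fun y => h m (x, y))) _ (M * (d - c))).
  - by move=> m; apply: continuous_measurable_fun; exact: itg_cont_param.
  - by move=> m x; apply: itg_norm => //; exact: itgb_cont.
  - move=> x; apply: (@itg_cvg _ _ _ _ _ M) => //.
    by move=> m; apply: continuous_measurable_fun.
have L' : itg c d (fun y => itg a b (fun x => h m (x, y))) @[m --> \oo] -->
    itg c d (fun y => itg a b (fun x => g (x, y))).
  apply: (@itg_cvg _ _ _ (fun m y => itg a b (fun x => h m (x, y))) _ (M * (b - a))).
  - move=> m; apply: continuous_measurable_fun.
    exact: (itg_cont_param (g := fun p : R * R => h m (p.2, p.1))).
  - by move=> m x; apply: itg_norm => //; exact: itgb_cont.
  - move=> y; apply: (@itg_cvg _ _ _ _ _ M) => //.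
    by move=> m; apply: continuous_measurable_fun.
have E m : itg a b (fun x => itg c d (fun y => h m (x, y))) =
  itg c d (fun y => itg a b (fun x => h m (x, y))) by exact: itg_swap_cont.
move: L; under eq_cvg do rewrite E; move=> L.
exact: cvg_unique L L'.
Qed.

(** Same scheme as for the exchange of integrals: by continuity of [f], the difference of the two
    sides is o(|t - s|) in the upper limit. *)
Lemma itg_affine_cont (f : R -> R) (a b k l : R) : 0 < k -> a <= b -> continuous f ->
  itg a b (fun x => f (k * x + l)) = k^-1 * itg (k * a + l) (k * b + l) f.
Proof.
move=> k0 ab cf.
have cfa : continuous (fun x => f (k * x + l)).
  move=> x; apply: (@continuous_comp _ _ _ (fun x => k * x + l) f); last exact: cf.
  by apply: cvgD; [apply: cvgM; [exact: cvg_cst|exact: cvg_id]|exact: cvg_cst].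
have km (x y : R) : x <= y -> k * x + l <= k * y + l by move=> xy; rewrite lerD2r ler_pM2l.
pose F t := itg a t (fun x => f (k * x + l)) - k^-1 * itg (k * a + l) (k * t + l) f.
pose D s t := itg s t (fun x => f (k * x + l)) - k^-1 * itg (k * s + l) (k * t + l) f.
have FD s t : a <= s -> s <= t -> F t - F s = D s t.
  move=> as_ st; rewrite /F /D (itg_cat as_ st); last exact: itgb_cont.
  rewrite (@itg_cat _ (k * a + l) (k * s + l)) ?km//; last exact: itgb_cont.
  by rewrite mulrDr; exact: algD.
have Dsmall s t u (e : R) : s <= t -> 0 <= e ->
    (forall x, s <= x <= t -> `|f (k * x + l) - f (k * u + l)| <= e) ->
    `|D s t| <= 2 * (e * (t - s)).
  move=> st e0 H; pose m := f (k * u + l) * (t - s).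
  have h1 : `|itg s t (fun x => f (k * x + l)) - m| <= e * (t - s).
    by rewrite /m -itg_cst//; apply: itg_dist => //; [exact: itgb_cont|exact: itgb_cst].
  have h2 : `|k^-1 * itg (k * s + l) (k * t + l) f - m| <= e * (t - s).
    have -> : m = k^-1 * itg (k * s + l) (k * t + l) (fun=> f (k * u + l)).
      by rewrite itg_cst ?km// /m; field; exact: lt0r_neq0.
    rewrite -mulrBr normrM gtr0_norm ?invr_gt0// ler_pdivrMl// (_ : k * (e * (t - s)) = e * (k * t + l - (k * s + l))); last by ring.
    apply: itg_dist; rewrite ?km//; [exact: itgb_cont|exact: itgb_cst|].
    move=> y /andP[sy yt]; have := H ((y - l) / k).
    rewrite (mulrC k) divfK ?subrK; last exact: lt0r_neq0.
    by apply; rewrite ler_pdivlMr// ler_pdivrMr//; apply/andP; split; lra.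
  rewrite /D -(subrKA m) (le_trans (ler_normD _ _))// (distrC m).
  by rewrite mulr_natl mulr2n; exact: lerD h1 h2.
have F0 : F a = F b.
  apply: cst_of_small_diff => // t e tab e0.
  have e2 : 0 < e / 2 by rewrite divr_gt0.
  have [dl /= dl0 Hdl] : \forall x \near t, `|f (k * t + l) - f (k * x + l)| < e / 2.
    exact: ((continuousRP _).1 cfa).
  have close (s x : R) : `|s - t| < dl -> `|x - t| <= `|s - t| -> `|f (k * x + l) - f (k * t + l)| <= e / 2.
    by move=> sdl xt; rewrite distrC; apply/ltW/Hdl; rewrite /= distrC (le_lt_trans xt).
  exists dl => // s /andP[as_ sb] sdl.
  have [st|ts] := leP s t.
    rewrite distrC FD//.
    rewrite (distrC s) (ger0_norm (_ : 0 <= t - s)) ?subr_ge0//.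
    apply: le_trans (Dsmall s t t _ st (ltW e2) _) _; last by rewrite mulrA mulrCA divff ?pnatr_eq0 ?mulr1.
    move=> x /andP[sx xt]; apply: (close s) => //.
    by rewrite distrC (distrC s) !ger0_norm ?subr_ge0// lerB.
  have ts' := ltW ts; rewrite FD//; last by case/andP: tab.
  rewrite (ger0_norm (_ : 0 <= s - t)) ?subr_ge0//.
  apply: le_trans (Dsmall t s t _ (ltW ts) (ltW e2) _) _; last by rewrite mulrA mulrCA divff ?pnatr_eq0 ?mulr1.
  move=> x /andP[sx xt]; apply: (close s) => //.
  by rewrite !ger0_norm ?subr_ge0// lerB.
have Faa : F a = 0.
  have E0 (c : R) (h : R -> R) : itg c c h = 0 by rewrite /itg set_itv1 Rintegral_set1.
  by rewrite /F !E0 mulr0 subrr.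
by apply/eqP; rewrite -subr_eq0 -/(F b) -F0 Faa.
Qed.

Lemma itg_opp_cont (f : R -> R) (a b : R) : continuous f ->
  itg a b (fun x => f (- x)) = itg (- b) (- a) f.
Proof.
move=> cf; have [ba|ab] := ltP b a; first by rewrite !itg_lt0// ltrN2.
rewrite /itg /Rintegral integration_by_substitution_oppr//.
exact: continuous_subspaceT.
Qed.

Definition rint (f : R -> R) : R := \int[mu]_x f x.

Lemma rint_itg (f : R -> R) (a b : R) : (forall x, ~~ (a <= x <= b) -> f x = 0) ->
  rint f = itg a b f.
Proof.
move=> f0; rewrite /itg Rintegral_mkcond; congr (Rintegral _ _ _); apply/funext => x.
by rewrite patchE; case: ifPn => //; rewrite notin_setE /= in_itv /= => /negP/f0.
Qed.

Lemma baire1_affine (f : R -> R) (k l : R) : baire1 f -> baire1 (fun x => f (k * x + l)).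
Proof.
apply: baire1_comp => x.
by apply: cvgD; [apply: cvgM; [exact: cvg_cst|exact: cvg_id]|exact: cvg_cst].
Qed.

Lemma itg_affine (f : R -> R) (a b k l : R) : 0 < k -> a <= b -> baire1 f ->
  itg a b (fun x => f (k * x + l)) = k^-1 * itg (k * a + l) (k * b + l) f.
Proof.
move=> k0 ab [h [M [ch hM hf]]].
have L1 : itg a b (fun x => h m (k * x + l)) @[m --> \oo] --> itg a b (fun x => f (k * x + l)).
  apply: (@itg_cvg _ _ _ (fun m x => h m (k * x + l)) _ M) => //.
  by move=> m; apply: baire1_meas; apply: baire1_affine; exact: baire1_cont (ch m) (hM m).
have L2 : k^-1 * itg (k * a + l) (k * b + l) (h m) @[m --> \oo] --> k^-1 * itg (k * a + l) (k * b + l) f.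
  apply: cvgM; first exact: cvg_cst.
  by apply: (@itg_cvg _ _ _ h _ M) => // m; exact: continuous_measurable_fun.
have E m : itg a b (fun x => h m (k * x + l)) = k^-1 * itg (k * a + l) (k * b + l) (h m).
  exact: itg_affine_cont.
by move: L1; under eq_cvg do rewrite E; move=> L1; exact: cvg_unique L1 L2.
Qed.

Lemma itg_opp (f : R -> R) (a b : R) : baire1 f ->
  itg a b (fun x => f (- x)) = itg (- b) (- a) f.
Proof.
move=> [h [M [ch hM hf]]].
have L1 : itg a b (fun x => h m (- x)) @[m --> \oo] --> itg a b (fun x => f (- x)).
  apply: (@itg_cvg _ _ _ (fun m x => h m (- x)) _ M) => //.
  move=> m; apply: continuous_measurable_fun => x.
  apply: (@continuous_comp _ _ _ (fun x => - x) (h m)); last exact: ch.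
  by apply: cvgN; exact: cvg_id.
have L2 : itg (- b) (- a) (h m) @[m --> \oo] --> itg (- b) (- a) f.
  by apply: (@itg_cvg _ _ _ h _ M) => // m; exact: continuous_measurable_fun.
have E m : itg a b (fun x => h m (- x)) = itg (- b) (- a) (h m) by exact: itg_opp_cont.
by move: L1; under eq_cvg do rewrite E; move=> L1; exact: cvg_unique L1 L2.
Qed.

Lemma rint_affine (f : R -> R) (k l L : R) : k != 0 -> baire1 f ->
  (forall x, L < `|x| -> f x = 0) -> rint (fun x => f (k * x + l)) = `|k|^-1 * rint f.
Proof.
have H (g : R -> R) (p q : R) : 0 < p -> baire1 g -> (forall x, L < `|x| -> g x = 0) ->
    rint (fun x => g (p * x + q)) = p^-1 * rint g.
  move=> p0 bg g0; have p0' := lt0r_neq0 p0.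
  have g0' x : ~~ (- `|L| <= x <= `|L|) -> g x = 0.
    rewrite -ler_norml -ltNge => Kx; apply: g0.
    by apply: le_lt_trans Kx; exact: ler_norm.
  rewrite (rint_itg g0') (@rint_itg _ ((- `|L| - q) / p) ((`|L| - q) / p)).
    rewrite itg_affine//; last first.
      by rewrite ler_pM2r ?invr_gt0// lerD2r; rewrite -subr_ge0 opprK addr_ge0.
    by rewrite !(mulrC p) !divfK// !subrK.
  move=> x; rewrite ler_pdivrMr// ler_pdivlMr// => Hx; apply: g0'.
  by apply: contra Hx => /andP[h1 h2]; apply/andP; split; lra.
move=> k0 bf f0; have [kn|] := ltP k 0; last first.
  rewrite le_eqVlt eq_sym (negbTE k0)/= => kp; rewrite gtr0_norm//; exact: H.
(* A negative slope acts as a positive slope on the reflected function. *)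
have bf' : baire1 (fun x => f (- x)).
  by have := baire1_affine (-1) 0 bf; congr baire1; apply/funext => x; rewrite addr0 mulN1r.
have := H (fun x => f (- x)) (- k) (- l); rewrite oppr_gt0 => /(_ kn bf') H1.
rewrite ltr0_norm// -[rint f](_ : rint (fun x => f (- x)) = _).
  rewrite -H1; last by move=> x Lx; apply: f0; rewrite normrN.
  by congr rint; apply/funext => x; rewrite opprD !opprK mulNr opprK.
have f0' x : ~~ (- `|L| <= x <= `|L|) -> f x = 0.
  rewrite -ler_norml -ltNge => Kx; apply: f0.
  by apply: le_lt_trans Kx; exact: ler_norm.
rewrite (rint_itg f0') (@rint_itg _ (- `|L|) (`|L|)) ?itg_opp ?opprK//.
move=> x Hx; apply: f0'; apply: contra Hx => /andP[h1 h2].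
by apply/andP; split; lra.
Qed.

End Fubini.

(** * Complex-valued integrals and the unit circle *)

Section CIntegral.
Variable R : realType.

Definition citg (a b : R) (f : R -> Cx R) : Cx R :=
  Complex (itg a b (fun x => complex.Re (f x))) (itg a b (fun x => complex.Im (f x))).

Lemma continuous_Re_comp (X : topologicalType) (f : X -> Cx R) :
  continuous f -> continuous (fun x => complex.Re (f x)).
Proof. by move=> cf x; apply: (@continuous_comp _ _ _ f (fun z : Cx R => complex.Re z)); [exact: cf|exact: continuous_Re]. Qed.

Lemma continuous_Im_comp (X : topologicalType) (f : X -> Cx R) :
  continuous f -> continuous (fun x => complex.Im (f x)).
Proof. by move=> cf x; apply: (@continuous_comp _ _ _ f (fun z : Cx R => complex.Im z)); [exact: cf|exact: continuous_Im]. Qed.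

Lemma continuous_Complex (X : topologicalType) (f g : X -> R) :
  continuous f -> continuous g -> continuous (fun x => Complex (f x) (g x) : Cx R).
Proof. by move=> cf cg x; apply: cvg_Complex; [exact: cf|exact: cg]. Qed.

Lemma continuousCD (X : topologicalType) (f g : X -> Cx R) :
  continuous f -> continuous g -> continuous (fun x => f x + g x).
Proof. by move=> cf cg x; apply: cvgD; [exact: cf|exact: cg]. Qed.

Lemma continuousCB (X : topologicalType) (f g : X -> Cx R) :
  continuous f -> continuous g -> continuous (fun x => f x - g x).
Proof. by move=> cf cg x; apply: cvgB; [exact: cf|exact: cg]. Qed.

Lemma continuousCM (X : topologicalType) (f g : X -> Cx R) :
  continuous f -> continuous g -> continuous (fun x => f x * g x : Cx R).
Proof.
move=> cf cg; rewrite (_ : (fun x => _) = fun x => Complex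
  (complex.Re (f x) * complex.Re (g x) - complex.Im (f x) * complex.Im (g x))
  (complex.Re (f x) * complex.Im (g x) + complex.Im (f x) * complex.Re (g x)) : Cx R).
  by apply: continuous_Complex => x; [apply: cvgB|apply: cvgD]; apply: cvgM;
    do [exact: continuous_Re_comp|exact: continuous_Im_comp].
by apply/funext => x; case: (f x) => a b; case: (g x) => c d.
Qed.

Lemma continuousCcst (X : topologicalType) (c : Cx R) : continuous (fun _ : X => c).
Proof. by move=> x; exact: cvg_cst. Qed.

Lemma continuousCX (X : topologicalType) (f : X -> Cx R) k :
  continuous f -> continuous (fun x => f x ^+ k : Cx R).
Proof.
move=> cf; elim: k => [|k ih]; first exact: continuousCcst.
rewrite (_ : (fun x => _) = fun x => f x * f x ^+ k : Cx R); first exact: continuousCM.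
by apply/funext => x; rewrite exprS.
Qed.

Lemma itgb_Re (a b : R) (f : R -> Cx R) : continuous f -> itgb a b (fun x => complex.Re (f x)).
Proof. by move=> cf; apply: itgb_cont; exact: continuous_Re_comp. Qed.

Lemma itgb_Im (a b : R) (f : R -> Cx R) : continuous f -> itgb a b (fun x => complex.Im (f x)).
Proof. by move=> cf; apply: itgb_cont; exact: continuous_Im_comp. Qed.

Lemma citg_eq a b (f g : R -> Cx R) : (forall x, a <= x <= b -> f x = g x) ->
  citg a b f = citg a b g.
Proof. by move=> fg; congr Complex; apply: itg_eq => x xab; rewrite fg. Qed.

Lemma citgD a b (f g : R -> Cx R) : continuous f -> continuous g ->
  citg a b (fun x => f x + g x) = citg a b f + citg a b g.
Proof.
move=> cf cg; rewrite /citg -[RHS]/(Complex (_ + _) (_ + _)).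
rewrite -!itgD; [|exact: itgb_Im|exact: itgb_Im|exact: itgb_Re|exact: itgb_Re].
by congr Complex; apply: itg_eq => x _; case: (f x); case: (g x).
Qed.

Lemma citgZ a b (c : Cx R) (f : R -> Cx R) : continuous f ->
  citg a b (fun x => c * f x) = c * citg a b f.
Proof.
move=> cf; case: c => u v; rewrite /citg -[RHS]/(Complex (_ - _) (_ + _)).
rewrite -!itgZ; [|exact: itgb_Re|exact: itgb_Im|exact: itgb_Im|exact: itgb_Re].
have cRe := continuous_Re_comp cf; have cIm := continuous_Im_comp cf.
have cZ (h : R -> R) k : continuous h -> itgb a b (fun x => k * h x).
  by move=> ch; apply: itgb_cont => x; apply: cvgM; [exact: cvg_cst|exact: ch].
rewrite -itgB -?itgD; [|exact: cZ..].
by congr Complex; apply: itg_eq => x _; case: (f x).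
Qed.

Lemma citgB a b (f g : R -> Cx R) : continuous f -> continuous g ->
  citg a b (fun x => f x - g x) = citg a b f - citg a b g.
Proof.
move=> cf cg; rewrite /citg -[RHS]/(Complex (_ - _) (_ - _)).
rewrite -!itgB; [|exact: itgb_Im|exact: itgb_Im|exact: itgb_Re|exact: itgb_Re].
by congr Complex; apply: itg_eq => x _; case: (f x); case: (g x).
Qed.

(** The factor 2 comes from estimating real and imaginary parts separately; later constants inherit
    it. *)
Lemma citg_norm a b (f : R -> Cx R) M : a <= b -> continuous f ->
  (forall x, a <= x <= b -> normc (f x) <= M) -> normc (citg a b f) <= 2 * (M * (b - a)).
Proof.
move=> ab cf fM; apply: le_trans (normc_le_ReIm _) _; rewrite mulr_natl mulr2n.
apply: lerD; apply: itg_norm => //; [exact: itgb_Re| |exact: itgb_Im|] => x xab.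
  exact: le_trans (Re_le_normc _) (fM x xab).
exact: le_trans (Im_le_normc _) (fM x xab).
Qed.

Lemma citg_cat a b c (f : R -> Cx R) : a <= b -> b <= c -> continuous f ->
  citg a c f = citg a b f + citg b c f.
Proof.
move=> ab bc cf; rewrite /citg -[RHS]/(Complex (_ + _) (_ + _)).
by rewrite -!itg_cat//; [exact: itgb_Im|exact: itgb_Re].
Qed.

Lemma citg_cst a b c : a <= b -> citg a b (fun=> c) = creal (b - a) * c.
Proof.
move=> ab; rewrite /citg !itg_cst//; case: c => u v.
by rewrite /creal /GRing.mul /= !mul0r subr0 addr0 !(mulrC (b - a)).
Qed.

Lemma citg_cont_param (X : topologicalType) (g : X * R -> Cx R) a b :
  continuous g -> continuous (fun x => citg a b (fun y => g (x, y))).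
Proof.
move=> cg; apply: continuous_Complex.
  apply: (itg_cont_param (g := fun p => complex.Re (g p))); exact: continuous_Re_comp.
apply: (itg_cont_param (g := fun p => complex.Im (g p))); exact: continuous_Im_comp.
Qed.

Definition ei (t : R) : Cx R := Complex (cos t) (sin t).

Lemma continuous_ei : continuous ei.
Proof. by apply: continuous_Complex; [exact: continuous_cos|exact: continuous_sin]. Qed.

Lemma normc_ei t : normc (ei t) = 1.
Proof. by rewrite /= cos2Dsin2 sqrtr1. Qed.

Lemma eiD s t : ei (s + t) = ei s * ei t.
Proof. by rewrite /ei cosD sinD /GRing.mul /=; congr Complex; rewrite addrC. Qed.

Lemma ei0 : ei 0 = 1.
Proof. by rewrite /ei cos0 sin0. Qed.

Lemma ei2pi : ei (2 * pi) = 1.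
Proof. by rewrite /ei mulr_natl cos2pi sin2pi. Qed.

Lemma ei_neq0 t : ei t != 0.
Proof.
by apply/eqP => e0; have := normc_ei t; rewrite e0 normc0 => /eqP; rewrite eq_sym oner_eq0.
Qed.

Lemma eiN t : ei (- t) = (ei t)^-1.
Proof.
by apply: (mulfI (ei_neq0 t)); rewrite -eiD subrr ei0 divff// ei_neq0.
Qed.

Lemma eiX t k : ei (k%:R * t) = ei t ^+ k.
Proof.
elim: k => [|k ih]; first by rewrite mul0r ei0 expr0.
by rewrite exprS -ih -eiD; congr ei; rewrite -natr1 mulrDl mul1r addrC.
Qed.

Lemma cos_lip (s t : R) : `|cos s - cos t| <= `|s - t|.
Proof.
wlog st : s t / t <= s.
  move=> W; have [|/ltW] := leP t s; first exact: W.
  by rewrite distrC (distrC s); exact: W.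
rewrite -(@itg_FTC _ t s (fun x => - sin x))//; last first.
  by move=> x; apply: cvgN; exact: continuous_sin.
rewrite (ger0_norm (_ : 0 <= s - t)) ?subr_ge0// -[leRHS]mul1r; apply: itg_norm => //.
  by apply: itgb_cont => x; apply: cvgN; exact: continuous_sin.
by move=> x _; rewrite normrN ler_norml sin_geN1 sin_le1.
Qed.

Lemma sin_lip (s t : R) : `|sin s - sin t| <= `|s - t|.
Proof.
wlog st : s t / t <= s.
  move=> W; have [|/ltW] := leP t s; first exact: W.
  by rewrite distrC (distrC s); exact: W.
rewrite -(@itg_FTC _ t s cos)//; last exact: continuous_cos.
rewrite (ger0_norm (_ : 0 <= s - t)) ?subr_ge0// -[leRHS]mul1r; apply: itg_norm => //.
  by apply: itgb_cont; exact: continuous_cos.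
by move=> x _; rewrite ler_norml cos_geN1 cos_le1.
Qed.

Lemma ei_lip s t : normc (ei s - ei t) <= 2 * `|s - t|.
Proof.
apply: le_trans (normc_le_ReIm _) _; rewrite mulr_natl mulr2n.
by apply: lerD; [exact: cos_lip|exact: sin_lip].
Qed.

Lemma expRN_lip (s t : R) : 0 <= s -> 0 <= t -> `|expR (- s) - expR (- t)| <= `|s - t|.
Proof.
wlog st : s t / t <= s.
  move=> W; have [|/ltW] := leP t s; first exact: W.
  by move=> *; rewrite distrC (distrC s); exact: W.
move=> s0 t0; have ce : continuous (fun x : R => - expR (- x)).
  move=> x; apply: cvgN; apply: (@continuous_comp _ _ _ (fun x : R => - x) expR).
    by apply: cvgN; exact: cvg_id.
  exact: continuous_expR.
have dF (x : R) : is_derive x (1 : R) (fun x => expR (- x)) (- expR (- x)).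
  apply: is_derive_eq; by rewrite /GRing.scale /= mulrN1.
have <- := itg_FTC st ce dF.
rewrite (ger0_norm (_ : 0 <= s - t)) ?subr_ge0// -[leRHS]mul1r; apply: itg_norm => //.
  exact: itgb_cont.
move=> x /andP[tx _]; rewrite normrN ger0_norm ?expR_ge0// -expR0 ler_expR.
by rewrite oppr_le0 (le_trans t0).
Qed.

(** Explicit primitives over a full period. Through this, only the constant term survives when the
    geometric series of the Cauchy kernel is integrated. *)
Lemma citg_eiX k : (0 < k)%N -> citg 0 (2 * pi) (fun t => ei t ^- k) = 0.
Proof.
move=> k0; have k0' : k%:R != 0 :> R by rewrite pnatr_eq0 -lt0n.
have E t : ei t ^- k = Complex (cos (k%:R * t)) (- sin (k%:R * t)).
  by rewrite -exprVn -eiN -eiX mulrN /ei cosN sinN.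
rewrite /citg.
have pi0 : 0 <= 2 * pi :> R by rewrite mulr_ge0// pi_ge0.
have ck (g : R -> R) : continuous g -> continuous (fun t : R => g (k%:R * t)).
  move=> cg t; apply: (@continuous_comp _ _ _ (fun t : R => k%:R * t) g); last exact: cg.
  by apply: cvgM; [exact: cvg_cst|exact: cvg_id].
have s2 : sin (k%:R * (2 * pi)) = 0 :> R.
  have := eiX (2 * pi) k; rewrite ei2pi expr1n; by case.
have c2 : cos (k%:R * (2 * pi)) = 1 :> R.
  have := eiX (2 * pi) k; rewrite ei2pi expr1n; by case.
rewrite (@itg_eq _ _ _ _ (fun t => cos (k%:R * t))); last by move=> t _; rewrite E.
rewrite (@itg_eq _ _ _ (fun t => complex.Im _) (fun t => - sin (k%:R * t))); last by move=> t _; rewrite E.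
have dS (x : R) : is_derive x (1 : R) (fun t : R => k%:R^-1 * sin (k%:R * t)) (cos (k%:R * x)).
  apply: is_derive_eq; rewrite /GRing.scale /=; field; exact: k0'.
have dC (x : R) : is_derive x (1 : R) (fun t : R => k%:R^-1 * cos (k%:R * t)) (- sin (k%:R * x)).
  apply: is_derive_eq; rewrite /GRing.scale /=; field; exact: k0'.
have cS : continuous (fun t : R => - sin (k%:R * t)).
  by move=> x; apply: cvgN; apply: ck; exact: continuous_sin.
rewrite (itg_FTC pi0 (ck _ (@continuous_cos R)) dS) (itg_FTC pi0 cS dC).
by rewrite s2 c2 !mulr0 sin0 cos0 mulr0 !subrr.
Qed.

End CIntegral.

(** * Cauchy's theorem and Taylor expansion in a disc *)

Section Bisection.
Variable R : realType.
Variable I : R -> R -> R -> R -> Cx R.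
Variables a0 b0 p0 q0 : R.
Hypothesis ab0 : a0 <= b0.
Hypothesis pq0 : p0 <= q0.
Hypothesis addx : forall a b c p q, a0 <= a -> a <= b -> b <= c -> c <= b0 ->
  p0 <= p -> p <= q -> q <= q0 -> I a c p q = I a b p q + I b c p q.
Hypothesis addy : forall a b p q r, a0 <= a -> a <= b -> b <= b0 ->
  p0 <= p -> p <= q -> q <= r -> r <= q0 -> I a b p r = I a b p q + I a b q r.
Hypothesis loc : forall x y e : R, a0 <= x <= b0 -> p0 <= y <= q0 -> 0 < e ->
  exists2 dl : R, 0 < dl & forall a b p q, a0 <= a -> a <= x -> x <= b -> b <= b0 ->
    p0 <= p -> p <= y -> y <= q -> q <= q0 -> (b - a) + (q - p) < dl ->
    normc (I a b p q) <= e * ((b - a) + (q - p)) ^+ 2.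

Local Notation rect := (R * R * R * R)%type.
Let J (r : rect) := normc (I r.1.1.1 r.1.1.2 r.1.2 r.2).
Let ok (r : rect) := [/\ a0 <= r.1.1.1, r.1.1.1 <= r.1.1.2, r.1.1.2 <= b0 &
  [/\ p0 <= r.1.2, r.1.2 <= r.2 & r.2 <= q0]].
(** Chooses the first quarter carrying at least a fourth of [J r]; the last quarter is the
    default. *)
Let nxt (r : rect) : rect :=
  let: (a, b, p, q) := r in
  let m := (a + b) / 2 in let l := (p + q) / 2 in
  if J r <= 4 * J (a, m, p, l) then (a, m, p, l) else
  if J r <= 4 * J (m, b, p, l) then (m, b, p, l) else
  if J r <= 4 * J (a, m, l, q) then (a, m, l, q) else (m, b, l, q).

Let nxtP (r : rect) : ok r ->
  [/\ ok (nxt r), J r <= 4 * J (nxt r),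
      [/\ r.1.1.1 <= (nxt r).1.1.1, (nxt r).1.1.2 <= r.1.1.2,
          r.1.2 <= (nxt r).1.2 & (nxt r).2 <= r.2],
      (nxt r).1.1.2 - (nxt r).1.1.1 = (r.1.1.2 - r.1.1.1) / 2 &
      (nxt r).2 - (nxt r).1.2 = (r.2 - r.1.2) / 2].
Proof.
case: r => [[[a b] p] q] [/= a0a ab bb0 [p0p pq qq0]].
set m := (a + b) / 2; set l := (p + q) / 2.
have am : a <= m by rewrite /m; lra.
have mb : m <= b by rewrite /m; lra.
have pl : p <= l by rewrite /l; lra.
have lq : l <= q by rewrite /l; lra.
(* If the other three quarters all fall short of a fourth, additivity and the triangle inequality
   leave at least a fourth for the last one. *)
have big : ~~ (J (a, b, p, q) <= 4 * J (a, m, p, l)) -> ~~ (J (a, b, p, q) <= 4 * J (m, b, p, l)) ->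
   ~~ (J (a, b, p, q) <= 4 * J (a, m, l, q)) -> J (a, b, p, q) <= 4 * J (m, b, l, q).
  rewrite -!ltNge => h1 h2 h3; rewrite leNgt; apply/negP => h4.
  have E : I a b p q = (I a m p l + I a m l q) + (I m b p l + I m b l q).
    by rewrite (@addx a m b)// (@addy a m p l q) ?(le_trans mb)// (@addy m b p l q)// (le_trans a0a).
  have : J (a, b, p, q) <= (J (a, m, p, l) + J (a, m, l, q)) + (J (m, b, p, l) + J (m, b, l, q)).
    rewrite /J /= E; apply: le_trans (ncD _ _) _.
    by apply: lerD; exact: ncD.
  by move=> h5; lra.
have dm : m - a = (b - a) / 2 by rewrite /m; lra.
have dm' : b - m = (b - a) / 2 by rewrite /m; lra.
have dl : l - p = (q - p) / 2 by rewrite /l; lra.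
have dl' : q - l = (q - p) / 2 by rewrite /l; lra.
have mb0 := le_trans mb bb0; have lq0 := le_trans lq qq0.
have a0m := le_trans a0a am; have p0l := le_trans p0p pl.
rewrite /nxt -/m -/l; case: ifPn => [h1|h1] /=; first by split => //=; split.
case: ifPn => [h2|h2] /=; first by split => //=; split.
case: ifPn => [h3|h3] /=; first by split => //=; split.
by split => //=; exact: big.
Qed.

(* Goursat's argument: an additive function of rectangles that is o(diameter^2)
   around every point vanishes. *)
Lemma bisection : I a0 b0 p0 q0 = 0.
Proof.
apply: eq0_normc; apply/eqP; rewrite eq_le nc_ge0 andbT leNgt; apply/negP => J0.
pose r k := iter k nxt (a0, b0, p0, q0).
have okr k : ok (r k).
  elim: k => [|k ih]; first by split => //=.
  by have [] := nxtP ih.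
pose Ak k := (r k).1.1.1; pose Bk k := (r k).1.1.2; pose Pk k := (r k).1.2; pose Qk k := (r k).2.
have mono k j : [/\ Ak k <= Ak (k + j)%N, Bk (k + j)%N <= Bk k, Pk k <= Pk (k + j)%N & Qk (k + j)%N <= Qk k].
  elim: j => [|j [h1 h2 h3 h4]]; first by rewrite addn0.
  rewrite addnS; have [_ _ [k1 k2 k3 k4] _ _] := nxtP (okr (k + j)%N).
  by split; [apply: le_trans h1 k1|apply: le_trans k2 h2|apply: le_trans h3 k3|apply: le_trans k4 h4].
have AB k j : Ak k <= Bk j.
  have [h1 _ _ _] := mono k j; have [_ h2 _ _] := mono j k.
  have [_ h3 _ _] := okr (k + j)%N.
  by rewrite (addnC j k) in h2; apply: le_trans h1 (le_trans h3 h2).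
have PQ k j : Pk k <= Qk j.
  have [_ _ h1 _] := mono k j; have [_ _ _ h2] := mono j k.
  have [_ _ _ [_ h3 _]] := okr (k + j)%N.
  by rewrite (addnC j k) in h2; apply: le_trans h1 (le_trans h3 h2).
(* Every left end is below every right end, so the supremum of the left ends lies in all the nested
   intervals. *)
have supP (U V : nat -> R) : (forall k j, U k <= V j) -> forall k, U k <= sup (range U) <= V k.
  move=> UV k; have ne : range U !=set0 by exists (U 0%N); exists 0%N.
  have ub j : ubound (range U) (V j) by move=> _ [i _ <-]; exact: UV.
  apply/andP; split; last exact: ge_sup.
  by apply: ub_le_sup; [exists (V 0%N)|exists k].
pose x := sup (range Ak); pose y := sup (range Pk).
have xP := supP _ _ AB; have yP := supP _ _ PQ.
have W2 k : (Bk k - Ak k) + (Qk k - Pk k) = ((b0 - a0) + (q0 - p0)) / 2 ^+ k.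
  elim: k => [|k ih]; first by rewrite expr0 divr1.
  have [_ _ _ h1 h2] := nxtP (okr k); rewrite /Bk /Ak /Qk /Pk /= h1 h2 -mulrDl.
  by rewrite -[X in X / 2]/((Bk k - Ak k) + (Qk k - Pk k)) ih exprS invfM mulrA mulrAC.
have Jk k : J (r 0%N) <= 4 ^+ k * J (r k).
  elim: k => [|k ih]; first by rewrite expr0 mul1r.
  have [_ h _ _ _] := nxtP (okr k); apply: le_trans ih _.
  by rewrite exprSr -mulrA ler_pM2l// exprn_gt0.
set W := (b0 - a0) + (q0 - p0) in W2.
have Wge : 0 <= W by rewrite /W addr_ge0// subr_ge0.
set eta := normc (I a0 b0 p0 q0) in J0.
(* With this value [e * W ^+ 2 < eta], whereas after [k] halvings
   [eta <= 4 ^+ k * (e * (W / 2 ^+ k) ^+ 2)], which equals [e * W ^+ 2]. *)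
pose e := eta / (2 * (W ^+ 2 + 1)).
have W1 : 0 < W ^+ 2 + 1 by rewrite ltr_wpDl// sqr_ge0.
have e0 : 0 < e by rewrite divr_gt0// mulr_gt0.
have xab : a0 <= x <= b0 by have := xP 0%N.
have yab : p0 <= y <= q0 by have := yP 0%N.
have [dl dl0 Hdl] := loc xab yab e0.
have [k Hk] : exists k, W / 2 ^+ k < dl.
  exists (Num.truncn (W / dl)).+1.
  rewrite ltr_pdivrMr ?exprn_gt0// mulrC -ltr_pdivrMr//.
  apply: lt_trans (truncnS_gt _) _; rewrite -natrX ltr_nat.
  exact: ltn_expl.
have [ok1 ok2 ok3 [ok4 ok5 ok6]] := okr k.
have /andP[Ax xB] := xP k; have /andP[Py yQ] := yP k.
have := Hdl (Ak k) (Bk k) (Pk k) (Qk k) ok1 Ax xB ok3 ok4 Py yQ ok6.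
rewrite W2 => /(_ Hk) H.
have := Jk k; rewrite -[J (r 0%N)]/eta => H2.
have H3 : eta <= e * W ^+ 2.
  apply: le_trans H2 _; rewrite -ler_pdivlMl ?exprn_gt0//.
  apply: le_trans H _.
  have E4 : (2 ^+ k) ^+ 2 = 4 ^+ k :> R.
    by rewrite -exprM mulnC exprM; congr (_ ^+ k); ring.
  by rewrite expr_div_n E4 mulrA [leRHS]mulrC.
move: H3; rewrite leNgt => /negP; apply.
rewrite /e mulrAC ltr_pdivrMr ?mulr_gt0// ltr_pM2l//; lra.
Qed.

End Bisection.

Section Cauchy.
Variable R : realType.

(* The epsilon-delta form of differentiability: Cx R carries the ring-valued norm,
   while all estimates are made with the real-valued normc. *)
Definition cderiv (f : Cx R -> Cx R) (w : Cx R) : Prop :=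
  exists B : Cx R, forall e : R, 0 < e -> exists2 dl : R, 0 < dl &
    forall w', normc (w' - w) < dl -> normc (f w' - f w - B * (w' - w)) <= e * normc (w' - w).

Lemma continuousCV (X : topologicalType) (f : X -> Cx R) :
  continuous f -> (forall x, f x != 0) -> continuous (fun x => (f x)^-1 : Cx R).
Proof. by move=> cf f0 x; apply: (@cvgV (R[i]) X); [exact: f0|exact: cf]. Qed.

Lemma continuousC_comp (X : topologicalType) (f : X -> Cx R) (g : Cx R -> Cx R) :
  continuous f -> continuous g -> continuous (fun x => g (f x)).
Proof. by move=> cf cg x; apply: (@continuous_comp _ _ _ f g); [exact: cf|exact: cg]. Qed.

Lemma continuous_creal_comp (X : topologicalType) (f : X -> R) :
  continuous f -> continuous (fun x => creal (f x)).
Proof.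
by move=> cf x; apply: (@continuous_comp _ _ _ f (@creal R)); [exact: cf|exact: continuous_creal].
Qed.

Lemma crealM (x y : R) : creal (x * y) = creal x * creal y.
Proof. by rewrite /creal rmorphM. Qed.
Lemma crealD (x y : R) : creal (x + y) = creal x + creal y.
Proof. by rewrite /creal rmorphD. Qed.
Lemma crealB (x y : R) : creal (x - y) = creal x - creal y.
Proof. by rewrite /creal rmorphB. Qed.

Definition ci : Cx R := Complex 0 1.

Lemma normc_ci : normc ci = 1.
Proof. by rewrite /= expr0n expr1n add0r sqrtr1. Qed.

Lemma ci_neq0 : ci != 0.
Proof. by apply/eqP => e0; have := normc_ci; rewrite e0 normc0 => /eqP; rewrite eq_sym oner_eq0. Qed.

Lemma citg_ei (s t : R) : s <= t -> citg s t (fun u => ci * ei u) = ei t - ei s.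
Proof.
move=> st; rewrite /citg -[RHS]/(Complex (cos t - cos s) (sin t - sin s)).
have dC (x : R) : is_derive x (1 : R) cos (- sin x) by exact: is_derive_cos.
have dS (x : R) : is_derive x (1 : R) sin (cos x) by exact: is_derive_sin.
rewrite -(itg_FTC st (@continuous_cos R) dS) -(itg_FTC st _ dC); last first.
  by move=> x; apply: cvgN; exact: continuous_sin.
by congr Complex; apply: itg_eq => x _; rewrite /= ?mul0r ?mul1r ?sub0r ?add0r.
Qed.

Lemma citg_expRN (s t : R) : s <= t ->
  citg s t (fun u => creal (expR (- u))) = creal (expR (- s)) - creal (expR (- t)).
Proof.
move=> st; rewrite -crealB /citg /creal /real_complex_def.
have dF (x : R) : is_derive x (1 : R) (fun x => - expR (- x)) (expR (- x)).
  by apply: is_derive_eq; rewrite /GRing.scale /= mulrN1 opprK.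
have ce : continuous (fun x : R => expR (- x)).
  move=> x; apply: (@continuous_comp _ _ _ (fun x : R => - x) expR).
    by apply: cvgN; exact: cvg_id.
  exact: continuous_expR.
congr Complex; last by rewrite itg0.
by rewrite (itg_FTC st ce dF) opprK addrC.
Qed.

Variables (f : Cx R -> Cx R) (r : R) (a : Cx R).
Hypothesis r0 : 0 < r.
Hypothesis cf : continuous f.
Hypothesis df : forall w, normc w <= r -> cderiv f w.
Hypothesis ar : normc a < r.

Let c (t : R) : Cx R := creal r * ei t - a.
(** Logarithmic coordinates about [a]: the form dw / (w - a) becomes [ci * kap t] dt where s is
    constant and - ds where t is constant, so its coefficients do not depend on [s]. *)
Let Gam (s t : R) : Cx R := a + creal (expR (- s)) * c t.
Let kap (t : R) : Cx R := creal r * ei t / c t.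
Let K := r / (r - normc a).

Let nrei t : normc (creal r * ei t) = r.
Proof. by rewrite normcM normc_ei mulr1 normc_creal gtr0_norm. Qed.

Let nc_lower t : r - normc a <= normc (c t).
Proof.
have := ncD (c t) a; rewrite /c subrK nrei; lra.
Qed.

Let nc_upper t : normc (c t) <= 2 * r.
Proof. by have := ncD (creal r * ei t) (- a); rewrite ncN nrei -/(c t); move: ar; lra. Qed.

Let c_neq0 t : c t != 0.
Proof.
apply/eqP => c0; have := nc_lower t; rewrite c0 normc0; move: ar; lra.
Qed.

Let cc : continuous c.
Proof.
apply: continuousCB; last exact: continuousCcst.
by apply: continuousCM; [exact: continuousCcst|exact: continuous_ei].
Qed.

Let ckap : continuous kap.
Proof.
apply: continuousCM; last by apply: continuousCV.
by apply: continuousCM; [exact: continuousCcst|exact: continuous_ei].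
Qed.

Let K0 : 0 < K.
Proof. by rewrite divr_gt0// subr_gt0. Qed.

Let nkap t : normc (kap t) <= K.
Proof.
rewrite /kap normcM normcV nrei /K ler_pM2l// lef_pV2 ?posrE ?subr_gt0//.
by apply: lt_le_trans (nc_lower t); rewrite subr_gt0.
Qed.

Let ce : continuous (fun s : R => creal (expR (- s))).
Proof.
apply: continuous_creal_comp => x; apply: (@continuous_comp _ _ _ (fun x : R => - x) expR).
  by apply: cvgN; exact: cvg_id.
exact: continuous_expR.
Qed.

Let cGt s : continuous (Gam s).
Proof. exact: (continuousCD (@continuousCcst R _ a) (continuousCM (@continuousCcst R _ _) cc)). Qed.

Let cGs t : continuous (Gam^~ t).
Proof. exact: (continuousCD (@continuousCcst R _ a) (continuousCM ce (@continuousCcst R _ _))). Qed.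

Let eN1 s : 0 <= s -> expR (- s) <= 1 :> R.
Proof. by move=> s0; rewrite -expR0 ler_expR oppr_le0. Qed.

Let nGam s t : 0 <= s -> normc (Gam s t) <= r.
Proof.
move=> s0; have E1 := eN1 s0; have E0 := expR_ge0 (- s).
have -> : Gam s t = creal (1 - expR (- s)) * a + creal (expR (- s)) * (creal r * ei t).
  by rewrite /Gam /c crealB; ring.
apply: le_trans (ncD _ _) _; rewrite (normcM _ a) (normcM (creal (expR _))) nrei !normc_creal.
rewrite (ger0_norm (_ : 0 <= 1 - _)) ?subr_ge0// (ger0_norm E0).
have : (1 - expR (- s)) * normc a <= (1 - expR (- s)) * r by rewrite ler_wpM2l ?subr_ge0// ltW.
by move=> h; lra.
Qed.

Let Gam_lip s t s' t' : 0 <= s -> 0 <= s' ->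
  normc (Gam s t - Gam s' t') <= 2 * r * (`|s - s'| + `|t - t'|).
Proof.
move=> s0 s'0.
have -> : Gam s t - Gam s' t' = creal (expR (- s) - expR (- s')) * c t + creal (expR (- s')) * (creal r * (ei t - ei t')).
  by rewrite /Gam /c crealB; ring.
apply: le_trans (ncD _ _) _; rewrite (normcM _ (c t)) (normcM (creal (expR (- s')))) normcM !normc_creal.
rewrite mulrDr (ger0_norm (expR_ge0 _)) (gtr0_norm r0); apply: lerD.
  rewrite mulrC; apply: ler_pM => //; [exact: nc_ge0|exact: expRN_lip].
apply: (@le_trans _ _ (1 * (r * (2 * `|t - t'|)))); last by rewrite mul1r mulrA (mulrC r).
apply: ler_pM; [exact: expR_ge0| |exact: eN1|].
  by rewrite mulr_ge0 ?nc_ge0// ltW.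
by rewrite ler_pM2l//; exact: ei_lip.
Qed.

Let ft (g : Cx R -> Cx R) s1 s2 t : Cx R := (g (Gam s2 t) - g (Gam s1 t)) * (ci * kap t).
Let fs (g : Cx R -> Cx R) t1 t2 s : Cx R := g (Gam s t2) - g (Gam s t1).
(** Up to sign, the integral of g(w) dw / (w - a) around the image under [Gam] of the boundary of a
    rectangle. *)
Let Ig (g : Cx R -> Cx R) s1 s2 t1 t2 : Cx R := citg t1 t2 (ft g s1 s2) + citg s1 s2 (fs g t1 t2).

Let cIt (g : Cx R -> Cx R) s1 s2 : continuous g -> continuous (ft g s1 s2).
Proof.
move=> cg.
exact: (continuousCM (continuousCB (continuousC_comp (@cGt s2) cg) (continuousC_comp (@cGt s1) cg))
  (continuousCM (@continuousCcst R _ ci) ckap)).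
Qed.

Let cIs (g : Cx R -> Cx R) t1 t2 : continuous g -> continuous (fs g t1 t2).
Proof.
move=> cg.
exact: (continuousCB (continuousC_comp (@cGs t2) cg) (continuousC_comp (@cGs t1) cg)).
Qed.

Let IgD (g h : Cx R -> Cx R) s1 s2 t1 t2 : continuous g -> continuous h ->
  Ig (fun w => g w + h w) s1 s2 t1 t2 = Ig g s1 s2 t1 t2 + Ig h s1 s2 t1 t2.
Proof.
move=> cg ch; rewrite /Ig addrACA.
rewrite -(citgD t1 t2 (@cIt g s1 s2 cg) (@cIt h s1 s2 ch)).
rewrite -(citgD s1 s2 (@cIs g t1 t2 cg) (@cIs h t1 t2 ch)).
by congr (_ + _); apply: citg_eq => x _; rewrite /ft /fs; ring.
Qed.

(** The constant term cancels between opposite sides, which carry the same weight; the linear term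
    is integrated by explicit primitives. *)
Let Ig_affine (A B : Cx R) s1 s2 t1 t2 : s1 <= s2 -> t1 <= t2 ->
  Ig (fun w => A + B * w) s1 s2 t1 t2 = 0.
Proof.
move=> s12 t12; rewrite /Ig.
rewrite (@citg_eq _ _ _ _ (fun t => (B * (creal (expR (- s2)) - creal (expR (- s1))) * creal r) * (ci * ei t))).
  rewrite (citgZ _ _ _ (continuousCM (@continuousCcst R _ ci) (@continuous_ei R))) citg_ei//.
  rewrite (@citg_eq _ s1 s2 _ (fun s => (B * (c t2 - c t1)) * creal (expR (- s)))).
    by rewrite (citgZ _ _ _ ce) citg_expRN// /c; ring.
  by move=> s _; rewrite /fs /Gam; ring.
move=> t _; rewrite /ft /Gam /kap; field; exact: c_neq0.
Qed.

(** Goursat's argument: near [w = Gam x y] the affine part of [f] contributes nothing, and the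
    remainder [rho] is small compared with the size [h] of the rectangle, so its integral over sides
    of length at most [h] is small compared with [h ^+ 2]. *)
Let Ig_zero S : 0 <= S -> Ig f 0 S 0 (2 * pi) = 0.
Proof.
move=> S0; have pi0 : 0 <= 2 * pi :> R by rewrite mulr_ge0// pi_ge0.
apply: (bisection (I := Ig f)) => //.
- move=> s1 s2 s3 t1 t2 _ h1 h2 _ _ h3 _; rewrite /Ig (citg_cat h1 h2 (@cIs f t1 t2 cf)).
  rewrite [RHS]addrACA; congr (_ + _).
  rewrite -(citgD t1 t2 (@cIt f s1 s2 cf) (@cIt f s2 s3 cf)).
  by apply: citg_eq => t _; rewrite /ft; ring.
- move=> s1 s2 t1 t2 t3 _ h3 _ _ h1 h2 _; rewrite /Ig (citg_cat h1 h2 (@cIt f s1 s2 cf)).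
  rewrite addrACA; congr (_ + _).
  rewrite -(citgD s1 s2 (@cIs f t1 t2 cf) (@cIs f t2 t3 cf)).
  by apply: citg_eq => t _; rewrite /fs; ring.
move=> x y e /andP[x0 xS] /andP[y0 ypi] e0.
have [B HB] := df (nGam y x0); set w := Gam x y in HB.
(* Since [Gam] is [2 * r]-Lipschitz, a tolerance e' in the differential estimate bounds the
   remainder by m = e' * (2 * r * h), and the four sides add up to at most 4 * m * (K + 1) * h.
   Dividing [e] by this constant makes the total [e * h ^+ 2]. *)
have D0 : 0 < 8 * r * (K + 1) by rewrite mulr_gt0// ?mulr_gt0// addr_gt0.
have e'0 : 0 < e / (8 * r * (K + 1)) by rewrite divr_gt0.
have [dl dl0 Hdl] := HB _ e'0.
have rr0 : 0 < 2 * r by rewrite mulr_gt0.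
exists (dl / (2 * r)); first by rewrite divr_gt0.
move=> s1 s2 t1 t2 s10 s1x xs2 _ _ t1y yt2 _; set h := (_ + _) => hdl.
pose rho w' := f w' - (f w - B * w + B * w').
have cid : continuous (@id (Cx R)) by move=> ?; exact: cvg_id.
have caff := continuousCD (@continuousCcst R (Cx R) (f w - B * w)) (continuousCM (@continuousCcst R _ B) cid).
have crho : continuous rho := continuousCB cf caff.
have s12 : s1 <= s2 by apply: le_trans xs2.
have t12 : t1 <= t2 by apply: le_trans yt2.
have h0 : 0 <= h by rewrite /h addr_ge0// subr_ge0.
have -> : Ig f s1 s2 t1 t2 = Ig rho s1 s2 t1 t2.
  transitivity (Ig (fun w' => (f w - B * w + B * w') + rho w') s1 s2 t1 t2).
    rewrite /Ig; by congr (_ + _); apply: citg_eq => ? _; rewrite /ft /fs /rho; ring.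
  by rewrite (IgD _ _ _ _ caff crho) (Ig_affine _ _ s12 t12) add0r.
have x0' := s10.
set e' := e / _ in e'0 Hdl *.
have rhoP s t : s1 <= s <= s2 -> t1 <= t <= t2 -> normc (rho (Gam s t)) <= e' * (2 * r * h).
  move=> /andP[ss1 ss2] /andP[tt1 tt2].
  have dist : normc (Gam s t - w) <= 2 * r * h.
    apply: le_trans (Gam_lip t y (le_trans s10 ss1) x0) _; rewrite ler_pM2l// /h.
    by apply: lerD; rewrite ler_norml; apply/andP; split; lra.
  have -> : rho (Gam s t) = f (Gam s t) - f w - B * (Gam s t - w) by rewrite /rho; ring.
  apply: le_trans (Hdl _ _) _; last by rewrite ler_pM2l.
  by apply: le_lt_trans dist _; rewrite mulrC -ltr_pdivlMr.
set m := e' * (2 * r * h) in rhoP.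
have rho2 s t s' t' : s1 <= s <= s2 -> t1 <= t <= t2 -> s1 <= s' <= s2 -> t1 <= t' <= t2 ->
    normc (rho (Gam s t) - rho (Gam s' t')) <= 2 * m.
  move=> h1 h2 h3 h4; apply: le_trans (ncD _ _) _; rewrite ncN mulr_natl mulr2n.
  by apply: lerD; exact: rhoP.
have m0 : 0 <= m by apply: mulr_ge0; [exact: ltW|apply: mulr_ge0 => //; exact: ltW].
have i1 : s1 <= s1 <= s2 by rewrite lexx.
have i2 : s1 <= s2 <= s2 by rewrite lexx andbT.
have j1 : t1 <= t1 <= t2 by rewrite lexx.
have j2 : t1 <= t2 <= t2 by rewrite lexx andbT.
have b1 : normc (citg t1 t2 (ft rho s1 s2)) <= 2 * (2 * m * K * (t2 - t1)).
  apply: (citg_norm t12 (@cIt rho s1 s2 crho)).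
  move=> t tt; rewrite /ft normcM (normcM ci) normc_ci mul1r.
  by apply: ler_pM; [exact: nc_ge0|exact: nc_ge0|exact: rho2|exact: nkap].
have b2 : normc (citg s1 s2 (fs rho t1 t2)) <= 2 * (2 * m * (s2 - s1)).
  by apply: (citg_norm s12 (@cIs rho t1 t2 crho)) => s ss; exact: rho2.
have b3 := le_trans (ncD _ _) (lerD b1 b2).
apply: le_trans b3 _.
have -> : e * h ^+ 2 = 4 * m * (K + 1) * h.
  by rewrite /m /e'; field; rewrite ?lt0r_neq0// addr_gt0.
have hs : s2 - s1 <= h by rewrite /h lerDl subr_ge0.
have ht : t2 - t1 <= h by rewrite /h lerDr subr_ge0.
have := ler_wpM2l (mulr_ge0 m0 (ltW K0)) ht; have := ler_wpM2l m0 hs.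
by move=> u v; lra.
Qed.

Let ei_per s : Gam s (2 * pi) = Gam s 0.
Proof. by rewrite /Gam /c ei2pi ei0. Qed.

Let pi20 : 0 <= 2 * pi :> R.
Proof. by rewrite mulr_ge0// pi_ge0. Qed.

(* The path Gam s, s >= 0, contracts the circle of radius r to the point a. *)
Lemma cauchy_kernel : citg 0 (2 * pi) (fun t => f (creal r * ei t) * kap t) = f a * citg 0 (2 * pi) kap.
Proof.
apply/eqP; rewrite -subr_eq0; apply/eqP; apply: eq0_normc.
apply/eqP; rewrite eq_le nc_ge0 andbT; apply/ler_addgt0Pr => e e0; rewrite add0r.
have crei : continuous (fun t => creal r * ei t : Cx R).
  exact: continuousCM (@continuousCcst R _ _) (@continuous_ei R).
have cfe : continuous (fun t => f (creal r * ei t)) by exact: continuousC_comp crei cf.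
have cfk := continuousCM cfe ckap.
have cak := continuousCM (@continuousCcst R _ (f a)) ckap.
rewrite -(citgZ _ _ (f a) ckap) -(citgB _ _ cfk cak).
pose e' := e / (2 * (K * (2 * pi) + 1)).
have D0 : 0 < 2 * (K * (2 * pi) + 1) by rewrite mulr_gt0// ltr_wpDl// mulr_ge0// ltW.
have e'0 : 0 < e' by rewrite divr_gt0.
have [dl dl0 Hdl] : exists2 dl : R, 0 < dl & forall w, normc (a - w) < dl -> normc (f a - f w) < e'.
  have [[dr di] /= ] := (continuousCP f).1 cf a e' e'0.
  rewrite ltcE /= => /andP[/eqP di0 dr0] H; exists dr => // w aw; apply: H.
  by rewrite /= normcE_creal di0 ltcR.
(* At this [S] the contracted circle is within [dl] of [a], because exp S exceeds S and
   [normc (c t) <= 2 * r]. *)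
pose S := 2 * r / dl.
have S0 : 0 <= S by rewrite /S divr_ge0 ?mulr_ge0 ?ltW.
have H t : normc (f (Gam S t) - f a) <= e'.
  rewrite ncB; apply/ltW/Hdl; rewrite ncB /Gam addrAC subrr add0r normcM normc_creal.
  rewrite (ger0_norm (expR_ge0 _)) expRN -ltr_pdivlMl ?invr_gt0 ?expR_gt0// invrK.
  apply: le_lt_trans (nc_upper t) _; rewrite -ltr_pdivrMr// -/S.
  by apply: lt_le_trans (expR_ge1Dx S); rewrite ltrDr.
have HI := Ig_zero S0; rewrite /Ig in HI.
(* The rays at t = 0 and t = 2 pi coincide, so the sides along [s] cancel and only the two circles
   remain. *)
have E0 : citg 0 S (fs f 0 (2 * pi)) = 0.
  rewrite (@citg_eq _ 0 S _ (fun=> 0)); first by rewrite citg_cst// mulr0.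
  by move=> s _; rewrite /fs ei_per subrr.
rewrite E0 addr0 in HI.
have G0 t : Gam 0 t = creal r * ei t.
  by rewrite /Gam oppr0 expR0 /creal rmorph1 mul1r addrC subrK.
have cS := continuousCM (continuousCB (continuousC_comp (@cGt S) cf) (@continuousCcst R _ (f a))) ckap.
have E : citg 0 (2 * pi) (fun t => f (creal r * ei t) * kap t - f a * kap t) =
    citg 0 (2 * pi) (fun t => (f (Gam S t) - f a) * kap t).
  apply: (mulfI ci_neq0).
  rewrite -(citgZ _ _ ci (continuousCB cfk cak)) -(citgZ _ _ ci cS).
  apply/eqP; rewrite eq_sym -subr_eq0; apply/eqP.
  have c1 := continuousCM (@continuousCcst R _ ci) cS.
  have c2 := continuousCM (@continuousCcst R _ ci) (continuousCB cfk cak).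
  rewrite -(citgB _ _ c1 c2) -[RHS]HI; apply: citg_eq => t _.
  by rewrite /ft G0; ring.
rewrite E.
have := citg_norm pi20 cS (M := e' * K).
move=> /(_ _)/le_trans; apply.
  by move=> t _; rewrite normcM; apply: ler_pM; rewrite ?nc_ge0.
have K1 : 0 < K * (2 * pi) + 1 by rewrite ltr_wpDl// mulr_ge0// ltW.
have alg (k p x : R) : k * p + 1 != 0 -> 2 * (x / (2 * (k * p + 1)) * k * p) = x * (k * p / (k * p + 1)).
  by move=> h; field.
rewrite /e' subr0 alg ?lt0r_neq0//.
by rewrite ler_piMr ?ltW// ltr_pdivrMr// mul1r ltrDl.
Qed.

Let q (t : R) : Cx R := a / (creal r * ei t).

Let rei_neq0 t : creal r * ei t != 0.
Proof. by apply/eqP => e0; have := nrei t; rewrite e0 normc0 => r0'; move: r0; rewrite -r0' ltxx. Qed.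

Let cq : continuous q.
Proof.
apply: (continuousCM (@continuousCcst R _ a)); apply: continuousCV; last exact: rei_neq0.
exact: (continuousCM (@continuousCcst R _ (creal r)) (@continuous_ei R)).
Qed.

(** [kap] is 1 / (1 - q); this is its geometric series stopped at order [M]. *)
Let kap_geom M t : kap t = \sum_(l < M) q t ^+ l + q t ^+ M * kap t.
Proof.
elim: M => [|M ih]; first by rewrite big_ord0 add0r expr0 mul1r.
rewrite {1}ih big_ord_recr /= -addrA; congr (_ + _).
have k1 : kap t = 1 + q t * kap t.
  transitivity ((c t + a) / c t); first by rewrite /kap /c subrK.
  by rewrite mulrDl divff ?c_neq0// /q /kap mulrA divfK// rei_neq0.
by rewrite {1}k1 mulrDr mulr1 mulrA -exprSr.
Qed.

Let citg_sum (M : nat) (g : nat -> R -> Cx R) u v : (forall l, continuous (g l)) ->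
  continuous (fun t => \sum_(l < M) g l t) /\
  citg u v (fun t => \sum_(l < M) g l t) = \sum_(l < M) citg u v (g l).
Proof.
move=> cg; elim: M => [|M [ih1 ih2]].
  rewrite big_ord0 (_ : (fun t => _) = fun=> 0); last by apply/funext => t; rewrite big_ord0.
  split; first exact: continuousCcst.
  by rewrite /citg !itg0.
rewrite (_ : (fun t => _) = fun t => \sum_(l < M) g l t + g M t); last first.
  by apply/funext => t; rewrite big_ord_recr.
split; first exact: (continuousCD ih1 (cg M)).
by rewrite (citgD u v ih1 (cg M)) ih2 big_ord_recr.
Qed.

Let qX l t : q t ^+ l = (a / creal r) ^+ l * ei t ^- l.
Proof. by rewrite /q invfM mulrA exprMn exprVn. Qed.

Let nq t : normc (q t) = normc a / r.
Proof. by rewrite /q normcM normcV nrei. Qed.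

(** For holomorphic [f] this is [r ^+ l] times the l-th Taylor coefficient at 0, which explains the
    powers of [a / creal r] that accompany it. *)
Definition mom l : Cx R :=
  (creal (2 * pi))^-1 * citg 0 (2 * pi) (fun t => f (creal r * ei t) * ei t ^- l).

Let twopi0 : creal (2 * pi) != 0 :> Cx R.
Proof.
apply/eqP => /(congr1 (@complex.Re R)) /= h.
by have : 0 < 2 * pi :> R; [rewrite mulr_gt0// pi_gt0|rewrite h ltxx].
Qed.

Let cqXk M : continuous (fun t => q t ^+ M * kap t : Cx R).
Proof. exact: (continuousCM (@continuousCX R _ q M cq) ckap). Qed.

(** In the geometric expansion every term with positive exponent integrates to 0, and the remainder
    is of order (|a| / r)^M for arbitrary [M], with |a| < r. *)
Let citg_kap : citg 0 (2 * pi) kap = creal (2 * pi).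
Proof.
have E M : citg 0 (2 * pi) kap = creal (2 * pi) + citg 0 (2 * pi) (fun t => q t ^+ M.+1 * kap t).
  have [c1 e1] := @citg_sum M.+1 (fun l t => q t ^+ l) 0 (2 * pi) (fun l => @continuousCX R _ q l cq).
  rewrite (@citg_eq _ _ _ kap (fun t => \sum_(l < M.+1) q t ^+ l + q t ^+ M.+1 * kap t)); last first.
    by move=> t _; exact: kap_geom.
  rewrite (citgD _ _ c1 (@cqXk M.+1)) e1; congr (_ + _).
  rewrite big_ord_recl big1 ?addr0.
    rewrite (@citg_eq _ _ _ _ (fun=> 1)); last by move=> t _; rewrite expr0.
    by rewrite citg_cst// subr0 mulr1.
  move=> l _; rewrite (@citg_eq _ _ _ _ (fun t => (a / creal r) ^+ l.+1 * ei t ^- l.+1)); last first.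
    by move=> t _; exact: qX.
  rewrite citgZ; first by rewrite citg_eiX// mulr0.
  by apply: continuousCV => [|t]; [exact: (@continuousCX R _ (@ei R) l.+1 (@continuous_ei R))|rewrite expf_neq0// ei_neq0].
apply/eqP; rewrite -subr_eq0; apply/eqP; apply: eq0_normc.
apply/eqP; rewrite eq_le nc_ge0 andbT leNgt; apply/negP => eta0.
set eta := normc _ in eta0.
pose th := normc a / r.
have th0 : 0 <= th by rewrite divr_ge0 ?nc_ge0 ?ltW.
have th1 : th < 1 by rewrite ltr_pdivrMr// mul1r.
have [M HM] : exists M, th ^+ M * (2 * (K * (2 * pi))) < eta.
  have K2 : 0 < 2 * (K * (2 * pi)) by do 3!rewrite ?pi_gt0// mulr_gt0//; rewrite ?pi_gt0.
  have := cvg_expr (z := th); rewrite ger0_norm// => /(_ th1)/cvgrPdist_lt.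
  move=> /(_ (eta / (2 * (K * (2 * pi))))); rewrite divr_gt0// => /(_ isT)[M _ HM].
  exists M; have := HM M (leqnn M); rewrite sub0r normrN ger0_norm ?exprn_ge0//.
  by rewrite ltr_pdivlMr.
have := HM; rewrite ltNge => /negP; apply.
have -> : eta = normc (citg 0 (2 * pi) (fun t => q t ^+ M.+1 * kap t)).
  by rewrite /eta (E M) addrC addKr.
apply: le_trans (citg_norm pi20 (@cqXk M.+1) (M := th ^+ M.+1 * K) _) _.
  by move=> t _; rewrite normcM ncX nq ler_wpM2l ?exprn_ge0.
rewrite subr0 -!mulrA [leLHS]mulrCA; apply: ler_wpM2r; last first.
  by rewrite exprS ler_piMl ?exprn_ge0// ltW.
apply: mulr_ge0 => //; apply: mulr_ge0; first exact: ltW.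
by apply: mulr_ge0 => //; rewrite invr_ge0 subr_ge0 ltW.
Qed.

(** Cauchy's formula with the kernel expanded to order [M]. The constant 4 is the 2 of [citg_norm]
    times the bound 2 of the kernel, valid for [normc a <= r / 2]. *)
Lemma taylor1 (B : R) M : normc a <= r / 2 -> (forall t, normc (f (creal r * ei t)) <= B) ->
  normc (f a - \sum_(l < M) (a / creal r) ^+ l * mom l) <= 4 * B * (normc a / r) ^+ M.
Proof.
move=> ar2 fB.
have crei : continuous (fun t => creal r * ei t : Cx R).
  exact: continuousCM (@continuousCcst R _ _) (@continuous_ei R).
have cfe : continuous (fun t => f (creal r * ei t)) by exact: continuousC_comp crei cf.
have ceiV l : continuous (fun t => ei t ^- l : Cx R).
  apply: continuousCV => [|t]; first exact: (@continuousCX R _ (@ei R) l (@continuous_ei R)).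
  by rewrite expf_neq0// ei_neq0.
have := cauchy_kernel; rewrite citg_kap => CK.
have fa : f a = (creal (2 * pi))^-1 * citg 0 (2 * pi) (fun t => f (creal r * ei t) * kap t).
  by rewrite CK mulrCA mulVf// mulr1.
have cg l : continuous (fun t => (a / creal r) ^+ l * (f (creal r * ei t) * ei t ^- l) : Cx R).
  exact: (continuousCM (@continuousCcst R _ _) (continuousCM cfe (@ceiV l))).
have [c1 e1] := @citg_sum M (fun l t => (a / creal r) ^+ l * (f (creal r * ei t) * ei t ^- l)) 0 (2 * pi) cg.
have c2 := continuousCM cfe (@cqXk M).
have E : citg 0 (2 * pi) (fun t => f (creal r * ei t) * kap t) =
    \sum_(l < M) (a / creal r) ^+ l * citg 0 (2 * pi) (fun t => f (creal r * ei t) * ei t ^- l) +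
    citg 0 (2 * pi) (fun t => f (creal r * ei t) * (q t ^+ M * kap t)).
  rewrite (eq_bigr (fun l : 'I_M => citg 0 (2 * pi) (fun t => (a / creal r) ^+ l * (f (creal r * ei t) * ei t ^- l)))); last first.
    by move=> l _; rewrite (citgZ _ _ _ (continuousCM cfe (@ceiV l))).
  rewrite -e1 -(citgD _ _ c1 c2); apply: citg_eq => t _.
  rewrite {1}(kap_geom M t) mulrDr; congr (_ + _); rewrite mulr_sumr; apply: eq_bigr => l _.
  by rewrite qX mulrCA.
rewrite {1}fa E mulrDr mulr_sumr.
rewrite (eq_bigr (fun l : 'I_M => (a / creal r) ^+ l * mom l)); last by move=> l _; rewrite /mom mulrCA.
rewrite addrAC subrr add0r normcM normcV normc_creal (ger0_norm pi20).
have B0 : 0 <= B by apply: le_trans (fB 0); exact: nc_ge0.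
have K2 : K <= 2.
  have : 0 < r - normc a by rewrite subr_gt0.
  by move=> h; rewrite /K ler_pdivrMr//; move: ar2; rewrite ler_pdivlMr//; lra.
have := citg_norm pi20 c2 (M := B * ((normc a / r) ^+ M * 2)).
have pp : 0 < 2 * pi :> R by rewrite mulr_gt0// pi_gt0.
have thM : 0 <= (normc a / r) ^+ M by rewrite exprn_ge0// divr_ge0 ?nc_ge0 ?ltW.
move=> H; rewrite ler_pdivrMl//; apply: le_trans (H _) _.
  move=> t _; rewrite normcM; apply: ler_pM; rewrite ?nc_ge0//.
  rewrite normcM ncX nq; apply: ler_wpM2l => //; exact: le_trans (nkap t) K2.
by rewrite le_eqVlt; apply/orP; left; apply/eqP; ring.
Qed.

End Cauchy.

(** * Iterated integrals *)

Section Iint.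
Variable R : realType.
Variable n : nat.

(** Support in a closed polydisc; through it the integrals over the whole line in [iint] become
    integrals over [[- L, L]]. *)
Definition boxed (L : R) (g : Cn R n -> R) : Prop :=
  forall (z : Cn R n) i, L < normc (z 0 i) -> g z = 0.

Lemma rint0 : rint (fun _ : R => 0) = 0.
Proof. by rewrite /rint Rintegral_cst ?mul0r. Qed.

Lemma rint_itg_norm (f : R -> R) (L : R) : (forall x, L < `|x| -> f x = 0) ->
  rint f = itg (- L) L f.
Proof. by move=> f0; apply: rint_itg => x; rewrite -ler_norml -ltNge; exact: f0. Qed.

Lemma iint_boxed k L g (z : Cn R n) (i : 'I_n) : boxed L g -> (k <= i)%N -> L < normc (z 0 i) ->
  iint k g z = 0.
Proof.
move=> bg; elim: k z => [|k ih] z ki Lz /=; first exact: bg Lz.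
rewrite -[LHS]/(rint (fun x => rint (fun y => iint k g (upd z k (Complex x y))))).
rewrite (_ : (fun x => _) = fun=> 0) ?rint0//; apply/funext => x.
rewrite (_ : (fun y => _) = fun=> 0) ?rint0//; apply/funext => y.
apply: ih; first exact: ltnW.
by rewrite mxE (gtn_eqF ki).
Qed.

Lemma iintS k L g z : (k < n)%N -> boxed L g ->
  iint k.+1 g z = itg (- L) L (fun x => itg (- L) L (fun y => iint k g (upd z k (Complex x y)))).
Proof.
move=> kn bg.
rewrite -[LHS]/(rint (fun x => rint (fun y => iint k g (upd z k (Complex x y))))).
have H x y : L < normc (Complex x y) -> iint k g (upd z k (Complex x y)) = 0.
  move=> Lxy; apply: (@iint_boxed _ L _ _ (Ordinal kn)) => //.
  by rewrite mxE eqxx.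
rewrite (@rint_itg_norm _ L).
  apply: itg_eq => x _; apply: rint_itg_norm => y Ly; apply: H.
  by apply: lt_le_trans Ly _; exact: (@Im_le_normc R (Complex x y)).
move=> x Lx; rewrite (_ : (fun y => _) = fun=> 0) ?rint0//; apply/funext => y; apply: H.
by apply: lt_le_trans Lx _; exact: (@Re_le_normc R (Complex x y)).
Qed.

Lemma continuous_upd_Complex (X : topologicalType) k (u : X -> Cn R n) (x y : X -> R) :
  continuous u -> continuous x -> continuous y ->
  continuous (fun p => upd (u p) k (Complex (x p) (y p))).
Proof.
move=> cu cx cy; apply: continuous_upd => // p.
by apply: cvg_Complex; [exact: cx|exact: cy].
Qed.

Lemma continuous_fst (X Y : topologicalType) : continuous (@fst X Y).
Proof. by move=> p; exact: cvg_fst. Qed.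

Lemma continuous_snd (X Y : topologicalType) : continuous (@snd X Y).
Proof. by move=> p; exact: cvg_snd. Qed.

Lemma continuous_fst_comp (X Y Z : topologicalType) (f : X -> Y * Z) :
  continuous f -> continuous (fun x => (f x).1).
Proof. by move=> cf x; apply: (@continuous_comp _ _ _ f fst); [exact: cf|exact: cvg_fst]. Qed.

Lemma continuous_snd_comp (X Y Z : topologicalType) (f : X -> Y * Z) :
  continuous f -> continuous (fun x => (f x).2).
Proof. by move=> cf x; apply: (@continuous_comp _ _ _ f snd); [exact: cf|exact: cvg_snd]. Qed.

Lemma continuous_pair (X Y Z : topologicalType) (f : X -> Y) (g : X -> Z) :
  continuous f -> continuous g -> continuous (fun x => (f x, g x)).
Proof.
move=> cf cg x; apply: (@cvg_pair _ _ _ _ (nbhs (f x)) (nbhs (g x))); [exact: cf|exact: cg].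
Qed.

Lemma baire1_upd (X : topologicalType) k (H : X * Cn R n -> R) : baire1 H ->
  baire1 (fun q : X * Cn R n * R * R => H (q.1.1.1, upd q.1.1.2 k (Complex q.1.2 q.2))).
Proof.
apply: baire1_comp; apply: continuous_pair.
  by do 2!apply: continuous_fst_comp; exact: continuous_fst.
apply: continuous_upd_Complex.
- by apply: continuous_snd_comp; apply: continuous_fst_comp; exact: continuous_fst.
- by apply: continuous_snd_comp; exact: continuous_fst.
- exact: continuous_snd.
Qed.

(** The statement is joint in the parameter and in the base point, because [iint k] still depends on
    the coordinates of index at least [k]; the induction integrates out one of them at a time. *)
Lemma iint_baire1 (X : topologicalType) (G : X -> Cn R n -> R) L k : (k <= n)%N ->
  baire1 (fun p : X * Cn R n => G p.1 p.2) -> (forall x, boxed L (G x)) ->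
  baire1 (fun p : X * Cn R n => iint k (G p.1) p.2).
Proof.
move=> kn bG boxG; elim: k kn => [//|k ih] kn.
have {}ih := ih (ltnW kn).
have := itg_baire1 (- L) L (itg_baire1 (- L) L (baire1_upd k ih)).
congr baire1; apply/funext => p; case: p => x z.
by symmetry; exact: (iintS z kn (boxG x)).
Qed.

Lemma iint_baire1_slice (g : Cn R n -> R) L k z : (k < n)%N -> baire1 g -> boxed L g ->
  baire1 (fun q : R * R => iint k g (upd z k (Complex q.1 q.2))).
Proof.
move=> kn bg boxg.
have b' : baire1 (fun p : R * Cn R n => (fun=> g) p.1 p.2) by exact: baire1_comp (@continuous_snd _ _) bg.
have := iint_baire1 (ltnW kn) b' (fun=> boxg).
apply: (@baire1_comp _ _ _ _ (fun q : R * R => (q.1, upd z k (Complex q.1 q.2)))).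
apply: continuous_pair; first exact: continuous_fst.
by apply: continuous_upd_Complex; [move=> ?; exact: cvg_cst|exact: continuous_fst|exact: continuous_snd].
Qed.

Lemma iint_itgb (g : Cn R n -> R) L k z a b : (k < n)%N -> baire1 g -> boxed L g ->
  (forall x, itgb a b (fun y => iint k g (upd z k (Complex x y)))) *
  itgb a b (fun x => itg a b (fun y => iint k g (upd z k (Complex x y)))).
Proof.
move=> kn bg boxg; have H := iint_baire1_slice z kn bg boxg; split.
  by move=> x; apply: baire1_itgb; exact: (baire1_sec x H).
by apply: baire1_itgb; exact: (itg_baire1 a b H).
Qed.

Lemma boxedD L f g : boxed L f -> boxed L g -> boxed L (fun z => f z + g z).
Proof. by move=> bf bg z i Lz; rewrite (bf z i)// (bg z i)// addr0. Qed.

Lemma boxedZ L f c : boxed L f -> boxed L (fun z => c * f z).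
Proof. by move=> bf z i Lz; rewrite (bf z i)// mulr0. Qed.

Lemma boxed_le L L' f : L <= L' -> boxed L f -> boxed L' f.
Proof. by move=> LL bf z i Lz; apply: (bf z i); exact: le_lt_trans Lz. Qed.

Lemma iintD L f g k z : (k <= n)%N -> baire1 f -> baire1 g -> boxed L f -> boxed L g ->
  iint k (fun z => f z + g z) z = iint k f z + iint k g z.
Proof.
move=> kn b1f b1g bf bg; elim: k kn z => [//|k ih] kn z.
have [f1 f2] := iint_itgb z (- L) L kn b1f bf.
have [g1 g2] := iint_itgb z (- L) L kn b1g bg.
rewrite (iintS z kn (boxedD bf bg)) (iintS z kn bf) (iintS z kn bg).
rewrite -itgD//; apply: itg_eq => x _; rewrite -itgD//; apply: itg_eq => y _.
by rewrite ih// ltnW.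
Qed.

Lemma iintZ L f c k z : (k <= n)%N -> baire1 f -> boxed L f ->
  iint k (fun z => c * f z) z = c * iint k f z.
Proof.
move=> kn b1f bf; elim: k kn z => [//|k ih] kn z.
have [f1 f2] := iint_itgb z (- L) L kn b1f bf.
rewrite (iintS z kn (boxedZ c bf)) (iintS z kn bf).
rewrite -itgZ//; apply: itg_eq => x _; rewrite -itgZ//; apply: itg_eq => y _.
by rewrite ih// ltnW.
Qed.

Lemma iint_le L f g k z : (k <= n)%N -> baire1 f -> baire1 g -> boxed L f -> boxed L g ->
  (forall z, f z <= g z) -> iint k f z <= iint k g z.
Proof.
move=> kn b1f b1g bf bg fg; elim: k kn z => [//|k ih] kn z.
have [f1 f2] := iint_itgb z (- L) L kn b1f bf.
have [g1 g2] := iint_itgb z (- L) L kn b1g bg.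
rewrite (iintS z kn bf) (iintS z kn bg); apply: itg_le => // x _; apply: itg_le => // y _.
exact/ih/ltnW.
Qed.

Lemma iint_indep k g (z z' : Cn R n) : (forall i : 'I_n, (k <= i)%N -> z 0 i = z' 0 i) ->
  iint k g z = iint k g z'.
Proof.
elim: k z z' => [|k ih] z z' zz' /=; first by congr g; apply/rowP => i; rewrite zz'.
congr (Rintegral _ _ _); apply/funext => x; congr (Rintegral _ _ _); apply/funext => y.
apply: ih => i ki; rewrite !mxE; case: eqP => // /eqP ik; apply: zz'.
by rewrite ltn_neqAle eq_sym ik.
Qed.

Lemma boxed_itg L a b (G : R -> Cn R n -> R) : (forall x, boxed L (G x)) ->
  boxed L (fun z => itg a b (fun s => G s z)).
Proof.
move=> bG z i Lz; rewrite (_ : (fun s => _) = fun=> 0); last first.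
  by apply/funext => s; exact: bG Lz.
by rewrite itg0.
Qed.

Lemma baire1_swap (X Y : topologicalType) (g : X * Y -> R) : baire1 g -> baire1 (fun p : Y * X => g (p.2, p.1)).
Proof. by apply: baire1_comp; apply: continuous_pair; [exact: continuous_snd|exact: continuous_fst]. Qed.

Lemma iint_itg L a b (G : R -> Cn R n -> R) k z : (k <= n)%N ->
  baire1 (fun p : R * Cn R n => G p.1 p.2) -> (forall x, boxed L (G x)) ->
  iint k (fun z => itg a b (fun s => G s z)) z = itg a b (fun s => iint k (G s) z).
Proof.
move=> kn bG boxG; elim: k kn z => [//|k ih] kn z.
have bS : baire1 (fun q : R * R * R => iint k (G q.1.1) (upd z k (Complex q.1.2 q.2))).
  have := baire1_upd k (iint_baire1 (ltnW kn) bG boxG).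
  apply: (@baire1_comp _ _ _ _ (fun q : R * R * R => (((q.1.1, z), q.1.2), q.2))).
  apply: continuous_pair; last exact: continuous_snd.
  apply: continuous_pair; last by apply: continuous_snd_comp; exact: continuous_fst.
  apply: continuous_pair; first by apply: continuous_fst_comp; exact: continuous_fst.
  by move=> ?; exact: cvg_cst.
rewrite (iintS z kn (boxed_itg a b boxG)).
have -> : itg a b (fun s => iint k.+1 (G s) z) =
  itg a b (fun s => itg (- L) L (fun x => itg (- L) L (fun y => iint k (G s) (upd z k (Complex x y))))).
  by apply: itg_eq => s _; exact: (iintS z kn (boxG s)).
rewrite (itg_swap a b (- L) L (itg_baire1 (- L) L bS)) /=.
apply: itg_eq => x _.
have bx : baire1 (fun q : R * R => iint k (G q.1) (upd z k (Complex x q.2))).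
  move: bS; apply: (@baire1_comp _ _ _ _ (fun q : R * R => ((q.1, x), q.2))).
  apply: continuous_pair; last exact: continuous_snd.
  by apply: continuous_pair; [exact: continuous_fst|move=> ?; exact: cvg_cst].
rewrite (itg_swap a b (- L) L bx) /=.
by apply: itg_eq => y _; rewrite ih// ltnW.
Qed.

Definition supp2 (L : R) (f : R * R -> R) : Prop :=
  forall x y, L < `|x| \/ L < `|y| -> f (x, y) = 0.

Lemma supp2_itg L (f : R * R -> R) : supp2 L f ->
  rint (fun x => rint (fun y => f (x, y))) =
  itg (- L) L (fun x => itg (- L) L (fun y => f (x, y))).
Proof.
move=> f0; rewrite (@rint_itg_norm _ L).
  by apply: itg_eq => x _; apply: rint_itg_norm => y Ly; apply: f0; right.
move=> x Lx; rewrite (_ : (fun y => _) = fun=> 0) ?rint0//.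
by apply/funext => y; apply: f0; left.
Qed.

Lemma rint_swap L (f : R * R -> R) : baire1 f -> supp2 L f ->
  rint (fun x => rint (fun y => f (x, y))) = rint (fun y => rint (fun x => f (x, y))).
Proof.
move=> bf f0; rewrite (supp2_itg f0) (@supp2_itg L (fun p => f (p.2, p.1))).
  exact: itg_swap.
by move=> x y xy; apply: f0; case: xy; [right|left].
Qed.

Lemma rint_baire1 L (f : R * R -> R) : baire1 f -> supp2 L f -> baire1 (fun x => rint (fun y => f (x, y))).
Proof.
move=> bf f0; have := itg_baire1 (- L) L bf; congr baire1; apply/funext => x.
by symmetry; apply: rint_itg_norm => y Ly; apply: f0; right.
Qed.

Lemma continuous_affine2 (X : topologicalType) (f g : X -> R) (a b c : R) :
  continuous f -> continuous g -> continuous (fun x => a * f x + b * g x + c).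
Proof.
move=> cf cg x; apply: cvgD; last exact: cvg_cst.
by apply: cvgD; apply: cvgM; [exact: cvg_cst|exact: cf|exact: cvg_cst|exact: cg].
Qed.

(** Multiplication by a + ib on the plane has Jacobian a^2 + b^2. For [a != 0] it splits into
    one-variable changes: u = b x + a y + q at fixed x gives 1 / |a|; after an exchange of
    integrals, the first argument is affine in x at fixed u, with slope [k] = (a^2 + b^2) / a. For
    [a = 0] each argument depends on one variable only, and an exchange suffices. *)
Lemma rint2_affine L (f : R * R -> R) (a b p q : R) : a ^+ 2 + b ^+ 2 != 0 ->
  baire1 f -> supp2 L f ->
  rint (fun x => rint (fun y => f (a * x - b * y + p, b * x + a * y + q))) =
  (a ^+ 2 + b ^+ 2)^-1 * rint (fun x => rint (fun y => f (x, y))).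
Proof.
move=> ab0 bf f0.
have idc : continuous (@id R) by move=> ?; exact: cvg_id.
have rZ (h : R -> R) (c : R) M : baire1 h -> (forall x, M < `|x| -> h x = 0) ->
    rint (fun x => c * h x) = c * rint h.
  move=> bh h0; rewrite (rint_itg_norm h0) (@rint_itg_norm _ M).
    by rewrite itgZ//; exact: baire1_itgb.
  by move=> x Mx; rewrite h0// mulr0.
have [a0|a0] := eqVneq a 0.
  have b0 : b != 0 by move: ab0; rewrite a0 expr0n add0r expf_eq0.
  pose psi u := rint (fun x => f (x, u)).
  have bs : baire1 (fun p : R * R => f (p.2, p.1)) by exact: baire1_swap.
  have fs0 : supp2 L (fun p : R * R => f (p.2, p.1)).
    by move=> x y xy; apply: f0; case: xy; [right|left].
  have bpsi : baire1 psi by exact: (rint_baire1 bs fs0).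
  have psi0 x : L < `|x| -> psi x = 0.
    move=> Lx; rewrite /psi (_ : (fun y => _) = fun=> 0) ?rint0//.
    by apply/funext => y; apply: f0; right.
  have E x : rint (fun y => f (a * x - b * y + p, b * x + a * y + q)) = `|b|^-1 * psi (b * x + q).
    have := @rint_affine _ (fun u => f (u, b * x + q)) (- b) p L.
    rewrite oppr_eq0 normrN => <- //.
    - by congr rint; apply/funext => y; rewrite a0 !mul0r addr0 sub0r mulNr.
    - exact: (baire1_sec (b * x + q) bs).
    - by move=> y Ly; apply: f0; left.
  rewrite (_ : (fun x => _) = fun x => `|b|^-1 * psi (b * x + q)); last by apply/funext => x; exact: E.
  have bpa : baire1 (fun x => psi (b * x + q)) by exact: baire1_affine.
  have bb0 : 0 < `|b| by rewrite normr_gt0.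
  rewrite (rZ _ _ ((`|L| + `|q|) / `|b|) bpa).
    rewrite (rint_affine q b0 bpsi psi0) /psi -(rint_swap bf f0) a0 expr0n add0r mulrA.
    by rewrite -invfM -expr2 real_normK ?num_real.
  move=> x; rewrite ltr_pdivrMr// -normrM mulrC => H; apply: psi0.
  apply: le_lt_trans (ler_norm L) _; rewrite -(ltrD2r `|q|).
  apply: lt_le_trans H _; rewrite -[X in `|X|](addrK q).
  by rewrite (le_trans (ler_normD _ _))// normrN.
have aa0 : 0 < `|a| by rewrite normr_gt0.
pose k := (a ^+ 2 + b ^+ 2) / a.
have k0 : k != 0 by rewrite mulf_neq0// invr_eq0.
pose l u := p - b * (u - q) / a.
have bphi : baire1 (fun r : R * R => f (k * r.1 + l r.2, r.2)).
  move: bf; apply: (@baire1_comp _ _ _ _ (fun r : R * R => (k * r.1 + l r.2, r.2))).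
  apply: continuous_pair; last exact: continuous_snd.
  rewrite (_ : (fun r => _) = fun r : R * R => k * r.1 + (- b / a) * r.2 + (p + b / a * q)).
    by apply: continuous_affine2; [exact: continuous_fst|exact: continuous_snd].
  by apply/funext => r; rewrite /l; field.
have E x : rint (fun y => f (a * x - b * y + p, b * x + a * y + q)) =
    `|a|^-1 * rint (fun u => f (k * x + l u, u)).
  rewrite -(@rint_affine _ (fun u => f (k * x + l u, u)) a (b * x + q) L)//.
  - congr rint; apply/funext => y; congr (f (_, _)); last by ring.
    by rewrite /k /l; field.
  - exact: (baire1_sec x bphi).
  - by move=> y Ly; apply: f0; right.
rewrite (_ : (fun x => _) = fun x => `|a|^-1 * rint (fun u => f (k * x + l u, u)));
  last by apply/funext => x; exact: E.
(* A support bound for the sheared function: on the support of [f] the value [l y] is bounded, so a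
   large [k * x] pushes the first argument of [f] beyond [L]. *)
pose M := `|L| + (`|p| + `|b| * (`|L| + `|q|) / `|a|).
have kk0 : 0 < `|k| by rewrite normr_gt0.
pose L2 := Num.max `|L| (M / `|k|).
have phi0 : supp2 L2 (fun r : R * R => f (k * r.1 + l r.2, r.2)).
  move=> x y xy; have [Ly|yL] := ltP L `|y|; first by apply: f0; right.
  have yL' : `|y| <= `|L| by apply: le_trans yL _; exact: ler_norm.
  have {xy} xM : M / `|k| < `|x|.
    case: xy => H; first by apply: le_lt_trans H; rewrite le_max lexx orbT.
    exfalso; have : `|L| < `|y| by apply: le_lt_trans H; rewrite le_max lexx.
    by rewrite ltNge yL'.
  apply: f0; left => /=; apply: le_lt_trans (ler_norm L) _.
  have lM : `|l y| <= `|p| + `|b| * (`|L| + `|q|) / `|a|.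
    rewrite /l (le_trans (ler_normB _ _))// lerD2l !normrM normfV ler_pM2r ?invr_gt0//.
    by rewrite ler_wpM2l// (le_trans (ler_normB _ _))// lerD2r.
  move: xM; rewrite ltr_pdivrMr// mulrC -normrM => xM.
  have h : `|k * x| <= `|k * x + l y| + `|l y|.
    by rewrite -{1}[k * x](addrK (l y)) (le_trans (ler_normB _ _)).
  by rewrite /M in xM; lra.
have bint : baire1 (fun x => rint (fun u => f (k * x + l u, u))) by exact: rint_baire1 bphi phi0.
rewrite (rZ _ _ L2 bint); last first.
  move=> x Lx; rewrite (_ : (fun y => _) = fun=> 0) ?rint0//.
  by apply/funext => y; apply: (phi0 x y); left.
rewrite (rint_swap bphi phi0) /=.
have bs : baire1 (fun p : R * R => f (p.2, p.1)) by exact: baire1_swap.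
have E2 u : rint (fun x => f (k * x + l u, u)) = `|k|^-1 * rint (fun x => f (x, u)).
  rewrite -(@rint_affine _ (fun x => f (x, u)) k (l u) L)//.
    exact: (baire1_sec u bs).
  by move=> y Ly; apply: f0; left.
rewrite (_ : (fun y => rint (fun x => f (k * x + l y, y))) = fun u => `|k|^-1 * rint (fun x => f (x, u)));
  last by apply/funext => x; exact: E2.
have fs0 : supp2 L (fun p : R * R => f (p.2, p.1)).
  by move=> x y xy; apply: f0; case: xy; [right|left].
rewrite (rZ _ _ L (rint_baire1 bs fs0)).
  rewrite -(rint_swap bf f0) mulrA; congr (_ * _).
  rewrite /k normrM normfV invfM invrK mulrCA mulVf ?mulr1 ?normr_eq0//.
  by rewrite ger0_norm// addr_ge0// sqr_ge0.
move=> x Lx /=; rewrite (_ : (fun y => _) = fun=> 0) ?rint0//.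
by apply/funext => y; apply: (f0 y x); right.
Qed.

End Iint.

(** * Complex dilations about the centre and their Jacobian *)

Section Dilation.
Variable R : realType.
Variable n : nat.

Definition dil (zeta : Cn R n) (c : Cx R) (z : Cn R n) : Cn R n :=
  \row_i (zeta 0 i + c * (z 0 i - zeta 0 i)).

Lemma dil_upd zeta c z k w (i : 'I_n) : i = k :> nat ->
  dil zeta c (upd z k w) = upd (dil zeta c z) k (zeta 0 i + c * (w - zeta 0 i)).
Proof.
move=> ik; apply/rowP => j; rewrite !mxE; case: eqP => // jk.
by have -> : j = i by apply: val_inj; exact: etrans jk (esym ik).
Qed.

Lemma rint2Z L (f : R * R -> R) (c : R) : baire1 f -> supp2 L f ->
  rint (fun x => rint (fun y => c * f (x, y))) = c * rint (fun x => rint (fun y => f (x, y))).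
Proof.
move=> bf f0; rewrite (@supp2_itg _ L (fun p => c * f p)); last first.
  by move=> x y xy; rewrite f0// mulr0.
rewrite (supp2_itg f0) -itgZ; last exact: baire1_itgb (itg_baire1 _ _ bf).
by apply: itg_eq => x _; rewrite itgZ//; exact: baire1_itgb (baire1_sec x bf).
Qed.

Lemma normc_sqr (c : Cx R) : normc c ^+ 2 = complex.Re c ^+ 2 + complex.Im c ^+ 2.
Proof. by case: c => a b; rewrite /= sqr_sqrtr// addr_ge0// sqr_ge0. Qed.

(** Each complex coordinate is a plane that [c] rotates and scales, hence one factor [normc c ^+ 2]
    per integrated coordinate. *)
Lemma iint_dil L (g : Cn R n -> R) zeta c k z : (k <= n)%N -> c != 0 -> baire1 g -> boxed L g ->
  iint k (g \o dil zeta c) z = (normc c ^+ 2) ^- k * iint k g (dil zeta c z).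
Proof.
move=> kn c0 bg boxg; elim: k kn z => [|k ih] kn z; first by rewrite expr0 invr1 mul1r.
rewrite -[LHS]/(rint (fun x => rint (fun y => iint k (g \o dil zeta c) (upd z k (Complex x y))))).
rewrite -[iint k.+1 g _]/(rint (fun x => rint (fun y => iint k g (upd (dil zeta c z) k (Complex x y))))).
pose f (p : R * R) := iint k g (upd (dil zeta c z) k (Complex p.1 p.2)).
have bf : baire1 f := iint_baire1_slice (dil zeta c z) kn bg boxg.
have f0 : supp2 L f.
  move=> x y xy; apply: (@iint_boxed _ _ _ L _ _ (Ordinal kn)) => //.
  rewrite mxE eqxx; case: xy => h; apply: lt_le_trans h _.
    exact: (@Re_le_normc R (Complex x y)).
  exact: (@Im_le_normc R (Complex x y)).
pose zk := zeta 0 (Ordinal kn); pose b := zk - c * zk.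
pose C := (normc c ^+ 2) ^- k.
have c20 : complex.Re c ^+ 2 + complex.Im c ^+ 2 != 0.
  rewrite -normc_sqr expf_neq0//; apply: contra_neq c0; exact: eq0_normc.
have E x y : iint k (g \o dil zeta c) (upd z k (Complex x y)) =
    C * f (complex.Re c * x - complex.Im c * y + complex.Re b,
           complex.Im c * x + complex.Re c * y + complex.Im b).
  rewrite ih ?(ltnW kn)// (dil_upd _ _ _ _ (i := Ordinal kn))//; congr (_ * iint k g (upd _ k _)).
  rewrite (_ : _ + _ = c * Complex x y + b); last by rewrite /b /zk; ring.
  case: (b) => baire1 b2; case: (c) => c1 c2; rewrite /GRing.mul /GRing.add /=.
  congr Complex; exact: (congr1 (fun u => u + b2) (addrC (c1 * y) (c2 * x))).
rewrite (_ : (fun x => _) = fun x => rint (fun y => C * f (complex.Re c * x - complex.Im c * y + complex.Re b,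
           complex.Im c * x + complex.Re c * y + complex.Im b))); last first.
  by apply/funext => x; congr rint; apply/funext => y; exact: E.
pose Cf p := C * f p.
have bCf : baire1 Cf by exact: baire1Z.
have Cf0 : supp2 L Cf by move=> x y xy; rewrite /Cf f0// mulr0.
have RA := rint2_affine (complex.Re b) (complex.Im b) c20 bCf Cf0.
apply: etrans RA _; rewrite (rint2Z C bf f0) mulrA -normc_sqr; congr (_ * _).
have key (x : R) : x^-1 * x ^- k = x ^- k.+1 by rewrite exprS invfM.
exact: key (normc c ^+ 2).
Qed.

Lemma iint_dil0 L (g : Cn R n -> R) zeta c : c != 0 -> baire1 g -> boxed L g ->
  iint n (g \o dil zeta c) 0 = (normc c ^+ 2) ^- n * iint n g 0.
Proof.
move=> c0 bg boxg; rewrite (@iint_dil L)//; congr (_ * _).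
by apply: iint_indep => i; rewrite leqNgt ltn_ord.
Qed.

Lemma continuous_dil zeta (X : topologicalType) (c : X -> Cx R) (u : X -> Cn R n) :
  continuous c -> continuous u -> continuous (fun x => dil zeta (c x) (u x)).
Proof.
move=> cc cu; apply: continuous_rowP => i.
have cui : continuous (fun x => u x 0 i).
  move=> x; apply: (@continuous_comp _ _ _ u (fun z : Cn R n => z 0 i)); first exact: cu.
  exact: continuous_coord.
rewrite (_ : (fun x => _) = fun x => zeta 0 i + c x * (u x 0 i - zeta 0 i)); last first.
  by apply/funext => x; rewrite mxE.
exact: (continuousCD (@continuousCcst R _ _) (continuousCM cc (continuousCB cui (@continuousCcst R _ _)))).
Qed.

Lemma dilM zeta c c' z : dil zeta c (dil zeta c' z) = dil zeta (c * c') z.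
Proof. by apply/rowP => i; rewrite !mxE; ring. Qed.

Lemma dil1 zeta z : dil zeta 1 z = z.
Proof. by apply/rowP => i; rewrite !mxE; ring. Qed.

End Dilation.

(** * Volume integrals of admissible functions *)

Section Volume.
Variable R : realType.
Variable n : nat.
Implicit Types (f g u : Cn R n -> R) (F G : Cn R n -> Cx R).

Lemma continuousRcst (X : topologicalType) (a : R) : continuous (fun _ : X => a).
Proof. by move=> x; exact: cvg_cst. Qed.

Lemma box_compact (L : R) :
  compact [set z : Cn R n | forall i, `|complex.Re (z 0 i)| <= L /\ `|complex.Im (z 0 i)| <= L].
Proof.
pose A : set (Cx R) := [set c | `|complex.Re c| <= L /\ `|complex.Im c| <= L].
have -> : [set z : Cn R n | forall i, `|complex.Re (z 0 i)| <= L /\ `|complex.Im (z 0 i)| <= L] =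
    [set v : Cn R n | forall i, A (v ord0 i)] by [].
apply: (@rV_compact _ _ (fun=> A)) => _.
have -> : A = (fun p : R * R => Complex p.1 p.2 : Cx R) @` (`[- L, L] `*` `[- L, L]).
  apply/seteqP; split => [[a b] [/= ha hb]|_ [[a b] [/= ha hb] <-]].
    exists (a, b) => //; split; rewrite /= in_itv /=; by rewrite -ler_norml.
  by move: ha hb; rewrite !in_itv /= -!ler_norml.
apply: continuous_compact; last by apply: compact_setX; exact: segment_compact.
apply: continuous_subspaceT; apply: continuous_Complex; [exact: continuous_fst|exact: continuous_snd].
Qed.

Lemma box_bounded (L : R) f : continuous f ->
  exists M : R, forall z : Cn R n, (forall i, normc (z 0 i) <= L) -> `|f z| <= M.
Proof.
move=> cf; pose B := [set z : Cn R n | forall i, `|complex.Re (z 0 i)| <= L /\ `|complex.Im (z 0 i)| <= L].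
have : compact (f @` B).
  by apply: continuous_compact; [exact: continuous_subspaceT|exact: box_compact].
move/compact_bounded => [M [_ HM]]; exists (M + 1) => z zL.
apply: (HM (M + 1)); first by rewrite ltrDl.
exists z => // i; split; apply: le_trans (zL i); [exact: Re_le_normc|exact: Im_le_normc].
Qed.

Definition adm f : Prop := baire1 f /\ exists L, boxed L f.
Definition V f : R := iint n f 0.

Lemma adm_common f g : adm f -> adm g -> exists L, boxed L f /\ boxed L g.
Proof.
move=> [_ [L1 baire1]] [_ [L2 b2]]; exists (Num.max L1 L2); split.
  by apply: boxed_le baire1; rewrite le_max lexx.
by apply: boxed_le b2; rewrite le_max lexx orbT.
Qed.

Lemma admD f g : adm f -> adm g -> adm (fun z => f z + g z).
Proof.
move=> af ag; have [L [bf bg]] := adm_common af ag.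
by split; [exact: baire1D af.1 ag.1|exists L; exact: boxedD].
Qed.

Lemma admZ f c : adm f -> adm (fun z => c * f z).
Proof. by move=> [bf [L boxf]]; split; [exact: baire1Z|exists L; exact: boxedZ]. Qed.

Lemma adm0 : adm (fun=> 0).
Proof. by split; [exact: baire1_cst|exists 0]. Qed.

Lemma VD f g : adm f -> adm g -> V (fun z => f z + g z) = V f + V g.
Proof.
move=> af ag; have [L [bf bg]] := adm_common af ag.
exact: (iintD 0 (leqnn n) af.1 ag.1 bf bg).
Qed.

Lemma VZ f c : adm f -> V (fun z => c * f z) = c * V f.
Proof. by move=> [bf [L boxf]]; exact: (iintZ c 0 (leqnn n) bf boxf). Qed.

Lemma V_le f g : adm f -> adm g -> (forall z, f z <= g z) -> V f <= V g.
Proof.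
move=> af ag; have [L [bf bg]] := adm_common af ag.
exact: (iint_le 0 (leqnn n) af.1 ag.1 bf bg).
Qed.

Lemma V_dil f zeta c : c != 0 -> adm f -> V (f \o dil zeta c) = (normc c ^+ 2) ^- n * V f.
Proof. by move=> c0 [bf [L boxf]]; exact: (iint_dil0 zeta c0 bf boxf). Qed.

(** Only the values of [g] on the box matter, so [g] is truncated at a bound valid there; the
    truncation is continuous and bounded, hence [baire1]. *)
Lemma adm_mul f g : adm f -> continuous g -> adm (fun z => f z * g z).
Proof.
move=> [bf [L boxf]] cg; have [M HM] := box_bounded L cg.
pose g' z := Num.max (- `|M|) (Num.min `|M| (g z)).
have -> : (fun z => f z * g z) = (fun z => f z * g' z).
  apply/funext => z; have [[i Hi]|H] := pselect (exists i, L < normc (z 0 i)).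
    by rewrite (boxf z i Hi) !mul0r.
  have zL i : normc (z 0 i) <= L by rewrite leNgt; apply/negP => h; apply: H; exists i.
  have := HM z zL; move=> /le_trans/(_ (ler_norm M)); rewrite ler_norml => /andP[h1 h2].
  by rewrite /g' min_r// max_r.
split; last by exists L => z i Hz; rewrite (boxf z i Hz) mul0r.
apply: baire1M => //; apply: (@baire1_cont _ _ _ `|M|).
  exact: (continuous_maxr (@continuousRcst _ _) (continuous_minr (@continuousRcst _ _) cg)).
move=> z; rewrite /g' ler_norml le_max lexx /= ge_max ge_min lexx /= andbT.
by apply: (@le_trans _ _ 0); rewrite ?oppr_le0.
Qed.

Definition cadm F : Prop := adm (fun z => complex.Re (F z)) /\ adm (fun z => complex.Im (F z)).

Lemma cadmD F G : cadm F -> cadm G -> cadm (fun z => F z + G z).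
Proof.
move=> [f1 f2] [g1 g2]; split.
  by have := admD f1 g1; congr adm; apply/funext => z; case: (F z); case: (G z).
by have := admD f2 g2; congr adm; apply/funext => z; case: (F z); case: (G z).
Qed.

Lemma cadmZ F c : cadm F -> cadm (fun z => c * F z).
Proof.
case: c => a b [f1 f2]; split.
  have := admD (admZ a f1) (admZ (- b) f2); congr adm; apply/funext => z.
  by case: (F z) => x y /=; rewrite mulNr.
have := admD (admZ a f2) (admZ b f1); congr adm; apply/funext => z.
by case: (F z) => x y.
Qed.

Lemma vol_intE F : vol_int F = Complex (V (fun z => complex.Re (F z))) (V (fun z => complex.Im (F z))).
Proof. by []. Qed.

Lemma vol_intD F G : cadm F -> cadm G -> vol_int (fun z => F z + G z) = vol_int F + vol_int G.
Proof.
move=> [f1 f2] [g1 g2]; rewrite !vol_intE -[RHS]/(Complex (_ + _) (_ + _)) -!VD//.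
by congr (Complex (V _) (V _)); apply/funext => z; case: (F z); case: (G z).
Qed.

Lemma vol_intZ F c : cadm F -> vol_int (fun z => c * F z) = c * vol_int F.
Proof.
case: c => a b [f1 f2]; rewrite !vol_intE -[RHS]/(Complex (_ - _) (_ + _)).
rewrite -!VZ// -mulN1r -VZ; last exact: admZ.
rewrite -VD; [|exact: admZ|by do 2!apply: admZ].
rewrite -VD; [|exact: admZ|exact: admZ].
congr (Complex (V _) (V _)); apply/funext => z; case: (F z) => x y //=.
by rewrite mulN1r.
Qed.

Lemma cadm0 : cadm (fun=> 0).
Proof. by split; exact: adm0. Qed.

Lemma cadmN F : cadm F -> cadm (fun z => - F z).
Proof. by move=> /(cadmZ (-1)); congr cadm; apply/funext => z; rewrite mulN1r. Qed.

Lemma vol_intN F : cadm F -> vol_int (fun z => - F z) = - vol_int F.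
Proof.
move=> aF; rewrite -[RHS]mulN1r -vol_intZ//; congr vol_int.
by apply/funext => z; rewrite mulN1r.
Qed.

Lemma vol_intB F G : cadm F -> cadm G -> vol_int (fun z => F z - G z) = vol_int F - vol_int G.
Proof. by move=> aF aG; rewrite (vol_intD aF (cadmN aG)) vol_intN. Qed.

Lemma V0 : V (fun=> 0) = 0.
Proof. transitivity (V (fun z => 0 * (fun=> 0) z)).
  by congr V; apply/funext => z; rewrite mul0r.
by rewrite VZ ?mul0r//; exact: adm0. Qed.

Lemma vol_int0 : vol_int (fun _ : Cn R n => 0 : Cx R) = 0 :> Cx R.
Proof. by rewrite vol_intE V0. Qed.

Lemma cadm_sum (I : Type) (s : seq I) (P : pred I) (F : I -> Cn R n -> Cx R) : (forall i, P i -> cadm (F i)) ->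
  cadm (fun z => \sum_(i <- s | P i) F i z) /\
  vol_int (fun z => \sum_(i <- s | P i) F i z) = \sum_(i <- s | P i) vol_int (F i).
Proof.
move=> aF; elim: s => [|i s [ih1 ih2]].
  rewrite big_nil (_ : (fun z => _) = fun=> 0); last by apply/funext => z; rewrite big_nil.
  by split; [exact: cadm0|exact: vol_int0].
rewrite big_cons; case: ifPn => Pi.
  rewrite (_ : (fun z => _) = fun z => F i z + \sum_(i <- s | P i) F i z); last first.
    by apply/funext => z; rewrite big_cons Pi.
  by split; [apply: cadmD => //; exact: aF|rewrite vol_intD ?ih2//; exact: aF].
rewrite (_ : (fun z => _) = fun z => \sum_(i <- s | P i) F i z)//.
by apply/funext => z; rewrite big_cons (negbTE Pi).
Qed.

Lemma vol_int_bound F u : cadm F -> adm u -> (forall z, normc (F z) <= u z) ->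
  normc (vol_int F) <= 2 * V u.
Proof.
move=> [f1 f2] au Fu; apply: le_trans (normc_le_ReIm _) _; rewrite /= mulr_natl mulr2n.
have H f : adm f -> (forall z, `|f z| <= u z) -> `|V f| <= V u.
  move=> af fu; rewrite ler_norml; apply/andP; split.
    rewrite -mulN1r -VZ//; apply: V_le => //; first exact: admZ.
    by move=> z; rewrite mulN1r; have := fu z; rewrite ler_norml => /andP[].
  by apply: V_le => // z; have := fu z; rewrite ler_norml => /andP[].
apply: lerD; apply: H => // z; apply: le_trans (Fu z); [exact: Re_le_normc|exact: Im_le_normc].
Qed.

Lemma vol_int_dil F zeta c : c != 0 -> cadm F ->
  vol_int (F \o dil zeta c) = creal ((normc c ^+ 2) ^- n) * vol_int F.
Proof.
move=> c0 [f1 f2]; rewrite !vol_intE.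
rewrite -[RHS]/(Complex (_ - 0 * _) (_ + 0 * _)) !mul0r subr0 addr0.
by rewrite -!(V_dil zeta c0).
Qed.

Lemma cadm_mul f F : adm f -> continuous F -> cadm (fun z => creal (f z) * F z).
Proof.
move=> af cF; split.
  have := adm_mul af (continuous_Re_comp cF); congr adm; apply/funext => z.
  by case: (F z) => a b /=; rewrite mul0r subr0.
have := adm_mul af (continuous_Im_comp cF); congr adm; apply/funext => z.
by case: (F z) => a b /=; rewrite mul0r addr0.
Qed.

Lemma V_itg a b (G : R -> Cn R n -> R) : baire1 (fun p : R * Cn R n => G p.1 p.2) ->
  (exists L, forall s, boxed L (G s)) ->
  adm (fun z => itg a b (fun s => G s z)) /\
  V (fun z => itg a b (fun s => G s z)) = itg a b (fun s => V (G s)).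
Proof.
move=> bG [L boxG]; split; last exact: (iint_itg a b 0 (leqnn n) bG boxG).
split; last by exists L; exact: boxed_itg.
exact: (itg_baire1 a b (baire1_swap bG)).
Qed.

End Volume.

(** * The Hermitian form *)

Section ContinuousOps.
Variable R : realType.
Variable X : topologicalType.

Lemma continuousRD (f g : X -> R) : continuous f -> continuous g -> continuous (fun x => f x + g x).
Proof. by move=> cf cg x; apply: cvgD; [exact: cf|exact: cg]. Qed.

Lemma continuousRB (f g : X -> R) : continuous f -> continuous g -> continuous (fun x => f x - g x).
Proof. by move=> cf cg x; apply: cvgB; [exact: cf|exact: cg]. Qed.

Lemma continuousRM (f g : X -> R) : continuous f -> continuous g -> continuous (fun x => f x * g x).
Proof. by move=> cf cg x; apply: cvgM; [exact: cf|exact: cg]. Qed.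

Lemma continuous_coord_comp n (f : X -> Cn R n) i : continuous f -> continuous (fun x => f x 0 i).
Proof.
move=> cf x; apply: (@continuous_comp _ _ _ f (fun z : Cn R n => z 0 i)); first exact: cf.
exact: continuous_coord.
Qed.

Lemma continuous_rowB n (f g : X -> Cn R n) : continuous f -> continuous g ->
  continuous (fun x => f x - g x).
Proof.
move=> cf cg; apply: continuous_rowP => i.
rewrite (_ : (fun x => _) = fun x => f x 0 i - g x 0 i); last by apply/funext => x; rewrite !mxE.
exact: (continuousCB (@continuous_coord_comp _ _ i cf) (@continuous_coord_comp _ _ i cg)).
Qed.

Lemma continuous_rowcst n (z : Cn R n) : continuous (fun _ : X => z).
Proof. by apply: continuous_rowP => i; exact: continuousCcst. Qed.

End ContinuousOps.

Lemma continuous_rowid (R : realType) n : continuous (fun z : Cn R n => z).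
Proof. by apply: continuous_rowP => i; exact: continuous_coord. Qed.

Section Form.
Variable R : realType.
Variable n : nat.
Variable A : 'M[R]_n.
Hypothesis A_sym : A^T = A.
Hypothesis A_pd : forall v : 'rV[R]_n, v != 0 -> 0 < (v *m A *m v^T) 0 0.
Implicit Types (v w : Cn R n).

(** Real part of the Hermitian form of [A], a real inner product on R^(2n); the ellipsoids are the
    balls of its norm [nfm]. *)
Definition bfm v w : R := \sum_i \sum_j A i j *
  (complex.Re (v 0 i) * complex.Re (w 0 j) + complex.Im (v 0 i) * complex.Im (w 0 j)).
Definition qfm v : R := bfm v v.
Definition nfm v : R := Num.sqrt (qfm v).

Lemma A_symE i j : A i j = A j i.
Proof. by rewrite -[in LHS]A_sym mxE. Qed.

Lemma bfmC v w : bfm v w = bfm w v.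
Proof.
rewrite /bfm exchange_big; apply: eq_bigr => i _; apply: eq_bigr => j _.
by rewrite A_symE; congr (_ * (_ + _)); rewrite mulrC.
Qed.

Lemma bfmDl v v' w : bfm (v + v') w = bfm v w + bfm v' w.
Proof.
rewrite /bfm -big_split; apply: eq_bigr => i _; rewrite -big_split; apply: eq_bigr => j _.
by rewrite mxE; case: (v 0 i) => a b; case: (v' 0 i) => a' b' /=; ring.
Qed.

Lemma bfmZl (t : R) v w : bfm (creal t *: v) w = t * bfm v w.
Proof.
rewrite /bfm mulr_sumr; apply: eq_bigr => i _; rewrite mulr_sumr; apply: eq_bigr => j _.
by rewrite mxE; case: (v 0 i) => a b /=; ring.
Qed.

Lemma bfmDr v w w' : bfm v (w + w') = bfm v w + bfm v w'.
Proof. by rewrite bfmC bfmDl !(bfmC v). Qed.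

Lemma bfmZr (t : R) v w : bfm v (creal t *: w) = t * bfm v w.
Proof. by rewrite bfmC bfmZl bfmC. Qed.

Lemma qfmE v : qfm v = (map_mx (@complex.Re R) v *m A *m (map_mx (@complex.Re R) v)^T) 0 0 +
  (map_mx (@complex.Im R) v *m A *m (map_mx (@complex.Im R) v)^T) 0 0.
Proof.
rewrite /qfm /bfm !mxE -big_split exchange_big; apply: eq_bigr => j _.
rewrite !mxE !mulr_suml -big_split; apply: eq_bigr => i _; rewrite !mxE /=; ring.
Qed.

Lemma qfm_ge0 v : 0 <= qfm v.
Proof.
have H (x : 'rV[R]_n) : 0 <= (x *m A *m x^T) 0 0.
  have [->|/A_pd/ltW//] := eqVneq x 0; by rewrite !mul0mx mxE.
by rewrite qfmE addr_ge0.
Qed.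

Lemma qfm_eq0 v : qfm v = 0 -> v = 0.
Proof.
have H (x : 'rV[R]_n) : 0 <= (x *m A *m x^T) 0 0.
  have [->|/A_pd/ltW//] := eqVneq x 0; by rewrite !mul0mx mxE.
have H0 (x : 'rV[R]_n) : (x *m A *m x^T) 0 0 = 0 -> x = 0.
  by move=> x0; apply/eqP; apply/negPn/negP => /A_pd; rewrite x0 ltxx.
rewrite qfmE => /eqP; rewrite paddr_eq0// => /andP[/eqP/H0 h1 /eqP/H0 h2].
apply/rowP => i; move/rowP/(_ i) : h1; move/rowP/(_ i) : h2; rewrite !mxE.
by case: (v 0 i) => a b /= -> ->.
Qed.

Lemma qfmD v w : qfm (v + w) = qfm v + 2 * bfm v w + qfm w.
Proof. by rewrite /qfm bfmDl !bfmDr (bfmC w v); ring. Qed.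

Lemma qfmZ (t : R) v : qfm (creal t *: v) = t ^+ 2 * qfm v.
Proof. by rewrite /qfm bfmZl bfmZr mulrA expr2. Qed.

Lemma qfmZc (c : Cx R) v : qfm (c *: v) = normc c ^+ 2 * qfm v.
Proof.
rewrite normc_sqr /qfm /bfm mulr_sumr; apply: eq_bigr => i _; rewrite mulr_sumr; apply: eq_bigr => j _.
rewrite !mxE; case: c => a b; case: (v 0 i) => x y; case: (v 0 j) => x' y' /=; ring.
Qed.

Lemma nfm_ge0 v : 0 <= nfm v.
Proof. exact: sqrtr_ge0. Qed.

Lemma nfm_sqr v : nfm v ^+ 2 = qfm v.
Proof. by rewrite sqr_sqrtr// qfm_ge0. Qed.

Lemma nfmZc (c : Cx R) v : nfm (c *: v) = normc c * nfm v.
Proof.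
rewrite /nfm qfmZc sqrtrM ?sqr_ge0// sqrtr_sqr ger0_norm//; exact: nc_ge0.
Qed.

(** Cauchy-Schwarz: the form is nonnegative at q(w) v - b(v, w) w, where it equals q(w) (q(v) q(w) -
    b(v, w)^2). *)
Lemma bfm_sqr v w : bfm v w ^+ 2 <= qfm v * qfm w.
Proof.
have [w0|w0] := eqVneq (qfm w) 0.
  rewrite w0 mulr0 (qfm_eq0 w0) (_ : (0 : Cn R n) = creal 0 *: (0 : Cn R n)); last first.
    by rewrite scaler0.
  by rewrite bfmZr mul0r expr0n.
have wp : 0 < qfm w by rewrite lt_def w0 qfm_ge0.
have := qfm_ge0 (creal (qfm w) *: v + creal (- bfm v w) *: w).
rewrite qfmD !qfmZ bfmZl bfmZr => H.
have : 0 <= qfm w * (qfm v * qfm w - bfm v w ^+ 2) by apply: le_trans H _; rewrite le_eqVlt; apply/orP; left; apply/eqP; ring.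
by rewrite pmulr_rge0// subr_ge0.
Qed.

Lemma bfm_le v w : `|bfm v w| <= nfm v * nfm w.
Proof.
rewrite /nfm -sqrtrM ?qfm_ge0// -sqrtr_sqr ler_sqrt ?sqr_ge0//; last first.
  by rewrite mulr_ge0// qfm_ge0.
exact: bfm_sqr.
Qed.

Lemma nfmD v w : nfm (v + w) <= nfm v + nfm w.
Proof.
have h : 0 <= nfm v + nfm w by rewrite addr_ge0// nfm_ge0.
rewrite -(ger0_norm h) -sqrtr_sqr /nfm ler_sqrt ?sqr_ge0// qfmD sqrrD !nfm_sqr.
rewrite lerD2r lerD2l mulr_natl ler_pMn2r//.
exact: le_trans (ler_norm _) (bfm_le v w).
Qed.

Lemma nfm0 : nfm 0 = 0.
Proof. by rewrite -(scale0r (0 : Cn R n)) nfmZc normc0 mul0r. Qed.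

Lemma nfmN v : nfm (- v) = nfm v.
Proof. by rewrite -scaleN1r nfmZc ncN normc1 mul1r. Qed.

(** The real part of the k-th coordinate is the inner product with the k-th row of the inverse of
    [A], the imaginary part the inner product with i times that row; Cauchy-Schwarz then gives an
    explicit constant. *)
Lemma nfm_coord : exists2 K : R, 0 < K & forall v i, normc (v 0 i) <= K * nfm v.
Proof.
have Au : A \in unitmx.
  rewrite unitmxE unitfE; apply/det0P => -[v v0 vA].
  by have := A_pd v0; rewrite vA mul0mx mxE ltxx.
pose u k : Cn R n := \row_i creal (invmx A k i).
have H k v : bfm (u k) v = complex.Re (v 0 k).
  rewrite /bfm exchange_big.
  transitivity (\sum_j (1%:M : 'M[R]_n) k j * complex.Re (v 0 j)).
    apply: eq_bigr => j _; rewrite -(mulVmx Au) mxE mulr_suml; apply: eq_bigr => i _.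
    by rewrite mxE /=; ring.
  rewrite (bigD1 k)//= big1 ?addr0; last by move=> j jk; rewrite mxE eq_sym (negbTE jk) mul0r.
  by rewrite mxE eqxx mul1r.
have H2 k v : bfm (ci R *: u k) v = complex.Im (v 0 k).
  rewrite /bfm exchange_big.
  transitivity (\sum_j (1%:M : 'M[R]_n) k j * complex.Im (v 0 j)).
    apply: eq_bigr => j _; rewrite -(mulVmx Au) mxE mulr_suml; apply: eq_bigr => i _.
    by rewrite !mxE /=; ring.
  rewrite (bigD1 k)//= big1 ?addr0; last by move=> j jk; rewrite mxE eq_sym (negbTE jk) mul0r.
  by rewrite mxE eqxx mul1r.
exists (\sum_k 2 * nfm (u k) + 1).
  by rewrite ltr_wpDl// sumr_ge0// => k _; rewrite mulr_ge0// nfm_ge0.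
move=> v i; apply: le_trans (normc_le_ReIm _) _.
rewrite -H -H2; have h1 := bfm_le (u i) v; have h2 := bfm_le (ci R *: u i) v.
rewrite nfmZc normc_ci mul1r in h2; apply: le_trans (lerD h1 h2) _.
rewrite -mulrDl; apply: ler_wpM2r; first exact: nfm_ge0.
have h : nfm (u i) + nfm (u i) = 2 * nfm (u i) by rewrite mulr_natl mulr2n.
rewrite h (bigD1 i)//= -addrA lerDl addr_ge0// sumr_ge0// => k _.
by rewrite mulr_ge0// nfm_ge0.
Qed.

Lemma nfm_sum (I : Type) (s : seq I) (F : I -> Cn R n) :
  nfm (\sum_(i <- s) F i) <= \sum_(i <- s) nfm (F i).
Proof.
elim: s => [|i s ih]; first by rewrite !big_nil nfm0.
by rewrite !big_cons; apply: le_trans (nfmD _ _) _; rewrite lerD2l.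
Qed.

Lemma nfm_le_coord : exists2 K : R, 0 < K & forall v (M : R), 0 <= M -> (forall i, normc (v 0 i) <= M) ->
  nfm v <= K * M.
Proof.
exists (\sum_(i < n) nfm (delta_mx 0 i) + 1).
  by rewrite ltr_wpDl// sumr_ge0// => k _; exact: nfm_ge0.
move=> v M M0 vM; rewrite [v]matrix_sum_delta big_ord1.
apply: le_trans (nfm_sum _ _) _; rewrite mulrDl mul1r mulr_suml.
apply: (@le_trans _ _ (\sum_(i < n) nfm (delta_mx 0 i) * M)); last by rewrite lerDl.
apply: ler_sum => i _; rewrite nfmZc mulrC; apply: ler_wpM2l => //; exact: nfm_ge0.
Qed.

Lemma continuous_qfm (X : topologicalType) (f : X -> Cn R n) : continuous f ->
  continuous (fun x => qfm (f x)).
Proof.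
move=> cf.
have cfi i : continuous (fun x => f x 0 i).
  move=> x; apply: (@continuous_comp _ _ _ f (fun z : Cn R n => z 0 i)); first exact: cf.
  exact: continuous_coord.
have csum (I : Type) (s : seq I) (g : I -> X -> R) : (forall i, continuous (g i)) ->
    continuous (fun x => \sum_(i <- s) g i x).
  move=> cg; elim: s => [|i s ih].
    rewrite (_ : (fun x => _) = fun=> 0); first exact: continuousRcst.
    by apply/funext => x; rewrite big_nil.
  rewrite (_ : (fun x => _) = fun x => g i x + \sum_(i <- s) g i x).
    by move=> x; apply: cvgD; [exact: cg|exact: ih].
  by apply/funext => x; rewrite big_cons.
rewrite /qfm /bfm; apply: (csum _ _ _) => i; apply: (csum _ _ _) => j x.
apply: cvgM; first exact: cvg_cst.
apply: cvgD; apply: cvgM.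
- exact: (continuous_Re_comp (cfi i)).
- exact: (continuous_Re_comp (cfi j)).
- exact: (continuous_Im_comp (cfi i)).
- exact: (continuous_Im_comp (cfi j)).
Qed.

Lemma continuous_nfm (X : topologicalType) (f : X -> Cn R n) : continuous f ->
  continuous (fun x => nfm (f x)).
Proof.
move=> cf x; apply: (@continuous_comp _ _ _ (fun x => qfm (f x)) Num.sqrt).
  exact: continuous_qfm.
exact: sqrt_continuous.
Qed.

Lemma rhoE zeta z : rho A zeta z = creal (qfm (z - zeta)).
Proof.
have -> : rho A zeta z = \sum_i \sum_j creal (A i j) * (((z - zeta) 0 i) * conjc ((z - zeta) 0 j)).
  by rewrite /rho; apply: eq_bigr => i _; apply: eq_bigr => j _; rewrite !mxE mulrA.
move: (z - zeta) => v.
have -> : \sum_i \sum_j creal (A i j) * (v 0 i * conjc (v 0 j)) =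
  \sum_i \sum_j (creal (A i j * (complex.Re (v 0 i) * complex.Re (v 0 j) + complex.Im (v 0 i) * complex.Im (v 0 j)))
   + ci R * creal (A i j * (complex.Im (v 0 i) * complex.Re (v 0 j) - complex.Re (v 0 i) * complex.Im (v 0 j)))).
  apply: eq_bigr => i _; apply: eq_bigr => j _.
  case: (v 0 i) => a b; case: (v 0 j) => a' b'; apply/eqP; rewrite eq_complex /=.
  by apply/andP; split; apply/eqP; ring.
have sumC (f : 'I_n -> 'I_n -> R) : \sum_i \sum_j creal (f i j) = creal (\sum_i \sum_j f i j).
  by rewrite /creal rmorph_sum; apply: eq_bigr => i _; rewrite rmorph_sum.
have -> : \sum_i \sum_j (creal (A i j * (complex.Re (v 0 i) * complex.Re (v 0 j) + complex.Im (v 0 i) * complex.Im (v 0 j)))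
   + ci R * creal (A i j * (complex.Im (v 0 i) * complex.Re (v 0 j) - complex.Re (v 0 i) * complex.Im (v 0 j)))) =
  creal (qfm v) + ci R * creal (\sum_i \sum_j A i j * (complex.Im (v 0 i) * complex.Re (v 0 j) - complex.Re (v 0 i) * complex.Im (v 0 j))).
  rewrite /qfm /bfm -!sumC mulr_sumr -big_split; apply: eq_bigr => i _.
  by rewrite mulr_sumr -big_split.
rewrite [X in ci R * creal X](_ : _ = 0); first by rewrite /creal rmorph0 mulr0 addr0.
(* By symmetry of [A] the imaginary part changes sign when the indices are exchanged, hence it is
   0. *)
have E : \sum_i \sum_j A i j * (complex.Im (v 0 i) * complex.Re (v 0 j) - complex.Re (v 0 i) * complex.Im (v 0 j)) =
  - \sum_i \sum_j A i j * (complex.Im (v 0 i) * complex.Re (v 0 j) - complex.Re (v 0 i) * complex.Im (v 0 j)).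
  rewrite [in LHS]exchange_big -sumrN; apply: eq_bigr => i _; rewrite -sumrN; apply: eq_bigr => j _.
  by rewrite (A_symE j i); ring.
set S := \sum_i _ in E *; lra.
Qed.

End Form.

(** * Taylor expansion in several variables *)

Section MultiTaylor.
Variable R : realType.
Variable n : nat.
Implicit Types (F G : Cn R n -> Cx R) (z : Cn R n).

Lemma updK z k c c' : upd (upd z k c) k c' = upd z k c'.
Proof. by apply/rowP => i; rewrite !mxE; case: eqP. Qed.

Lemma upd_id z (k : 'I_n) : upd z k (z 0 k) = z.
Proof. by apply/rowP => i; rewrite !mxE; case: eqP => // /val_inj ->. Qed.

Lemma upd_same z (k : 'I_n) c : upd z k c 0 k = c.
Proof. by rewrite mxE eqxx. Qed.

Lemma upd_other z (k i : 'I_n) c : i != k -> upd z k c 0 i = z 0 i.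
Proof. by rewrite mxE => /negbTE; rewrite -val_eqE /= => ->. Qed.

Lemma eq_big_seq_In (I : Type) (s : seq I) (H K : I -> Cx R) :
  (forall i, List.In i s -> H i = K i) -> \sum_(i <- s) H i = \sum_(i <- s) K i.
Proof.
elim: s => [|i s IH] HK; first by rewrite !big_nil.
by rewrite !big_cons HK ?IH//=; [move=> j js; apply: HK; right|left].
Qed.

Lemma normc_sum (I : Type) (s : seq I) (H : I -> Cx R) :
  normc (\sum_(i <- s) H i) <= \sum_(i <- s) normc (H i).
Proof.
elim: s => [|i s IH]; first by rewrite !big_nil normc0.
by rewrite !big_cons; apply: le_trans (ncD _ _) _; rewrite lerD2l.
Qed.

Variables (z0 : Cn R n) (r : R) (M : nat).
Hypothesis r0 : 0 < r.

Let P z := forall i, normc (z 0 i - z0 0 i) <= r.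

Definition tmom (k : 'I_n) l F z : Cx R := mom (fun w => F (upd z k (z0 0 k + w))) r l.

(* Taylor polynomial of order M in the k-th variable at z0, whose coefficients are
   functions of the other variables. *)
Definition tay (k : 'I_n) F z : Cx R :=
  \sum_(l < M) ((z 0 k - z0 0 k) / creal r) ^+ l * tmom k l F z.

Definition tays (s : seq 'I_n) F := foldr tay F s.

Let cslice (X : topologicalType) (u : X -> Cn R n) (w : X -> Cx R) (k : 'I_n) F :
  continuous F -> continuous u -> continuous w -> continuous (fun x => F (upd (u x) k (z0 0 k + w x))).
Proof.
move=> cF cu cw x.
apply: (@continuous_comp _ _ _ (fun x => upd (u x) k (z0 0 k + w x)) F); last exact: cF.
exact: (@continuous_upd R X n k u (fun x => z0 0 k + w x) cu (continuousCD (@continuousCcst R _ _) cw) x).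
Qed.

Let cre : continuous (fun t : R => creal r * ei t : Cx R).
Proof. exact: (continuousCM (@continuousCcst R _ _) (@continuous_ei R)). Qed.

Let ceV l : continuous (fun t : R => ei t ^- l : Cx R).
Proof.
apply: (@continuousCV R _ (fun t => ei t ^+ l)); first exact: (@continuousCX R _ _ l (@continuous_ei R)).
by move=> t; rewrite expf_neq0// ei_neq0.
Qed.

Let cint (k : 'I_n) l F z : continuous F ->
  continuous (fun t : R => F (upd z k (z0 0 k + creal r * ei t)) * ei t ^- l : Cx R).
Proof.
move=> cF.
have h := @cslice _ _ _ k F cF (@continuous_rowcst R _ n z) cre.
exact: (continuousCM h (@ceV l)).
Qed.

Lemma continuous_tmom k l F : continuous F -> continuous (tmom k l F).
Proof.
move=> cF; apply: (continuousCM (@continuousCcst R _ _) _).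
apply: (@citg_cont_param R _ (fun p : Cn R n * R => F (upd p.1 k (z0 0 k + creal r * ei p.2)) * ei p.2 ^- l)).
have h2 : continuous (fun p : Cn R n * R => p.2) := @continuous_snd _ _.
apply: continuousCM.
  apply: cslice => //; first exact: continuous_fst.
  by move=> p; apply: (@continuous_comp _ _ _ (fun p : Cn R n * R => p.2) (fun t : R => creal r * ei t : Cx R)); [exact: h2|exact: cre].
by move=> p; apply: (@continuous_comp _ _ _ (fun p : Cn R n * R => p.2) (fun t : R => ei t ^- l : Cx R)); [exact: h2|exact: ceV].
Qed.

Lemma continuousC_sum (X : topologicalType) (I : Type) (s : seq I) (H : I -> X -> Cx R) :
  (forall i, continuous (H i)) -> continuous (fun x => \sum_(i <- s) H i x : Cx R).
Proof.
move=> cH; elim: s => [|i s IH].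
  rewrite (_ : (fun x => _) = fun=> 0); first exact: (@continuousCcst R _ _).
  by apply/funext => x; rewrite big_nil.
rewrite (_ : (fun x => _) = fun x => H i x + \sum_(j <- s) H j x); first exact: (continuousCD (cH i) IH).
by apply/funext => x; rewrite big_cons.
Qed.

Lemma continuous_tay k F : continuous F -> continuous (tay k F).
Proof.
move=> cF; apply: continuousC_sum => l; apply: continuousCM; last exact: continuous_tmom.
apply: (@continuousCX R _ _ l); apply: (continuousCM _ (@continuousCcst R _ _)).
exact: (continuousCB (@continuous_coord R n k) (@continuousCcst R _ _)).
Qed.

Lemma continuous_tays s F : continuous F -> continuous (tays s F).
Proof. move=> cF; elim: s => [|k s IH]; first exact: cF.
exact: (@continuous_tay k (tays s F) IH). Qed.

Lemma tmomB k l F G z : continuous F -> continuous G ->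
  tmom k l (fun z => F z - G z) z = tmom k l F z - tmom k l G z.
Proof.
move=> cF cG; rewrite /tmom /mom -mulrBr -citgB; [|exact: cint|exact: cint].
by congr (_ * _); apply: citg_eq => t _; rewrite mulrBl.
Qed.

Lemma tayB k F G z : continuous F -> continuous G ->
  tay k (fun z => F z - G z) z = tay k F z - tay k G z.
Proof.
by move=> cF cG; rewrite /tay -sumrB; apply: eq_bigr => l _; rewrite tmomB// mulrBr.
Qed.

Lemma tmom_bound (k : 'I_n) l F z B : continuous F ->
  (forall t, normc (F (upd z k (z0 0 k + creal r * ei t))) <= B) ->
  normc (tmom k l F z) <= 2 * B.
Proof.
move=> cF HB; rewrite /tmom /mom normcM normcV normc_creal.
have p0 : 0 < 2 * pi :> R by rewrite mulr_gt0// pi_gt0.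
rewrite (gtr0_norm p0) ler_pdivrMl// mulrCA [2 * pi * B]mulrC -[X in B * X]subr0.
apply: (citg_norm (ltW p0) (@cint k l F z cF)) => t _.
by rewrite normcM normcV ncX normc_ei expr1n invr1 mulr1.
Qed.

Let nre t : normc (creal r * ei t : Cx R) = r.
Proof. by rewrite normcM normc_creal normc_ei mulr1 gtr0_norm. Qed.

Let Pupd z (k : 'I_n) t : P z -> P (upd z k (z0 0 k + creal r * ei t)).
Proof.
move=> Pz i; have [->|ik] := eqVneq i k; last by rewrite upd_other.
by rewrite upd_same addrC addKr nre.
Qed.

Lemma tay_bound (k : 'I_n) F z B : continuous F -> P z ->
  (forall t, normc (F (upd z k (z0 0 k + creal r * ei t))) <= B) ->
  normc (tay k F z) <= (2 * M%:R) * B.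
Proof.
move=> cF Pz HB.
have B0 : 0 <= B := le_trans (nc_ge0 _) (HB 0).
have -> : 2 * M%:R * B = \sum_(l < M) (2 * B) by rewrite sumr_const card_ord -mulr_natr; ring.
apply: le_trans (normc_sum _ _) _; apply: ler_sum => l _.
rewrite normcM ncX normcM normcV normc_creal (gtr0_norm r0).
apply: le_trans (_ : 1 * normc (tmom k l F z) <= _).
  rewrite ler_wpM2r ?nc_ge0// exprn_ile1// ?ler_pdivrMr// ?mul1r ?Pz//.
  by rewrite divr_ge0 ?nc_ge0// ltW.
by rewrite mul1r; exact: tmom_bound.
Qed.

(** Within [r / 2] of the centre this is [taylor1]; farther away the power (2 |a| / r)^M is at least
    1 and the crude bounds on [F] and [tay k F] suffice. The constant 5 + 2 M dominates both 4 and 1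
    + 2 M. *)
Lemma tay1_error (k : 'I_n) F (B : R) : continuous F -> (forall z, P z -> normc (F z) <= B) ->
  (forall z, P z -> forall i : 'I_n, cderiv (fun w => F (upd z i w)) (z 0 i)) ->
  forall z, P z ->
  normc (F z - tay k F z) <= (5 + 2 * M%:R) * B * (2 / r) ^+ M * normc (z 0 k - z0 0 k) ^+ M.
Proof.
move=> cF HB dF z Pz.
have B0 : 0 <= B := le_trans (nc_ge0 _) (HB z Pz).
set a := z 0 k - z0 0 k; pose f w := F (upd z k (z0 0 k + w)).
have fa : f a = F z by rewrite /f /a addrC subrK upd_id.
have cf : continuous f.
  have cid : continuous (fun w : Cx R => w) by move=> ?; exact: cvg_id.
  exact: (@cslice _ _ _ k F cF (@continuous_rowcst R _ n z) cid).
have HBc t : normc (F (upd z k (z0 0 k + creal r * ei t))) <= B by apply: HB; exact: Pupd.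
have df w : normc w <= r -> cderiv f w.
  move=> wr; have Pz' : P (upd z k (z0 0 k + w)).
    move=> i; have [->|ik] := eqVneq i k; last by rewrite upd_other.
    by rewrite upd_same addrC addKr.
  have [D HD] := dF _ Pz' k; rewrite upd_same in HD.
  exists D => e e0; have [dl dl0 Hdl] := HD e e0; exists dl => // w' ww'.
  have E : w' - w = (z0 0 k + w') - (z0 0 k + w) by rewrite opprD addrACA subrr add0r.
  by have := Hdl (z0 0 k + w'); rewrite -E !updK; apply.
have M0 : 0 <= 2 * M%:R :> R by rewrite mulr_ge0.
have a0 := nc_ge0 a.
have [ar|ar] := leP (normc a) (r / 2).
  have nar : normc a < r.
    apply: le_lt_trans ar _.
    by rewrite ltr_pdivrMr// ltr_pMr// ltr1n.
  have := taylor1 r0 cf df nar M ar HBc; rewrite fa => h; apply: le_trans h _.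
  have -> : (5 + 2 * M%:R) * B * (2 / r) ^+ M * normc a ^+ M = (5 + 2 * M%:R) * B * (2 * (normc a / r)) ^+ M.
    by rewrite -mulrA -exprMn; congr (_ * _ ^+ _); ring.
  have q0 : 0 <= normc a / r by rewrite divr_ge0// ltW.
  apply: ler_pM; rewrite ?mulr_ge0 ?exprn_ge0//; first by rewrite ler_wpM2r//; lra.
  by apply: lerXn2r; [rewrite nnegrE|rewrite nnegrE mulr_ge0|rewrite ler_peMl// ler1n].
apply: le_trans (ncD _ _) _; rewrite ncN.
have h1 := tay_bound cF Pz HBc.
apply: le_trans (lerD (HB z Pz) h1) _.
have -> : B + 2 * M%:R * B = (1 + 2 * M%:R) * B * 1 by ring.
have -> : (5 + 2 * M%:R) * B * (2 / r) ^+ M * normc a ^+ M = (5 + 2 * M%:R) * B * (normc a / (r / 2)) ^+ M.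
  rewrite -mulrA -exprMn; congr (_ * _ ^+ _); field; exact: lt0r_neq0.
apply: ler_pM; rewrite ?mulr_ge0 ?addr_ge0//; first by rewrite ler_wpM2r//; lra.
by apply: exprn_ege1; rewrite ler_pdivlMr ?mul1r ?divr_gt0// ltW.
Qed.

(** One variable is peeled off through F - tay_k T = (F - tay_k F) + tay_k (F - T), with T the
    expansion in the variables of [s]. The circles used by tay_k move coordinate [k] alone, which is
    not in [s], so the error bound for T passes through unchanged. *)
Lemma tays_error F (B : R) : continuous F -> (forall z, P z -> normc (F z) <= B) ->
  (forall z, P z -> forall i : 'I_n, cderiv (fun w => F (upd z i w)) (z 0 i)) ->
  forall s, uniq s -> exists2 C, 0 <= C & forall z, P z ->
  normc (F z - tays s F z) <= C * \sum_(i <- s) normc (z 0 i - z0 0 i) ^+ M.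
Proof.
move=> cF HB dF; elim=> [_|k s IH]; first by exists 0 => // z _; rewrite subrr normc0 mul0r.
rewrite cons_uniq => /andP[ks us]; have [C C0 HC] := IH us.
pose C1 := (5 + 2 * M%:R) * B * (2 / r) ^+ M.
have H1 := @tay1_error k F B cF HB dF.
exists (`|C1| + 2 * M%:R * C); first by rewrite addr_ge0 ?mulr_ge0.
move=> z Pz; have cT := @continuous_tays s F cF.
have -> : F z - tays (k :: s) F z = (F z - tay k F z) + tay k (fun z => F z - tays s F z) z.
  rewrite (tayB k z cF cT) addrA subrK; reflexivity.
have cD : continuous (fun z => F z - tays s F z) by exact: (continuousCB cF cT).
set S := \sum_(i <- s) normc (z 0 i - z0 0 i) ^+ M.
have HD t : normc (F (upd z k (z0 0 k + creal r * ei t)) - tays s F (upd z k (z0 0 k + creal r * ei t))) <= C * S.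
  suff <- : \sum_(i <- s) normc (upd z k (z0 0 k + creal r * ei t) 0 i - z0 0 i) ^+ M = S by exact: (HC _ (@Pupd z k t Pz)).
  by apply: eq_big_seq => i si; rewrite upd_other//; apply: contraNneq ks => <-.
have H2 := tay_bound cD Pz HD.
apply: le_trans (ncD _ _) _; apply: le_trans (lerD (H1 z Pz) H2) _.
rewrite big_cons -/C1 -/S.
have S0 : 0 <= S by apply: sumr_ge0 => i _; rewrite exprn_ge0// nc_ge0.
have a0 : 0 <= normc (z 0 k - z0 0 k) ^+ M by rewrite exprn_ge0// nc_ge0.
rewrite mulrA mulrDr mulrDl mulrDl.
have h1 : C1 * normc (z 0 k - z0 0 k) ^+ M <= `|C1| * normc (z 0 k - z0 0 k) ^+ M.
  by rewrite ler_wpM2r// ler_norm.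
have h2 : 0 <= 2 * M%:R * C * normc (z 0 k - z0 0 k) ^+ M by rewrite !mulr_ge0.
have h3 : 0 <= `|C1| * S by rewrite mulr_ge0.
lra.
Qed.

Definition mono (g : {ffun 'I_n -> nat}) (v : Cn R n) : Cx R := \prod_i v 0 i ^+ g i.


Definition indep_of (s : seq 'I_n) (G : Cn R n -> Cx R) :=
  forall z z', (forall i, i \notin s -> z 0 i = z' 0 i) -> G z = G z'.

(** Invariant of the successive expansions: polynomial in the shifted coordinates listed in [s],
    with continuous coefficients depending on the other coordinates only. *)
Definition semipoly (s : seq 'I_n) (H : Cn R n -> Cx R) :=
  exists L : seq ({ffun 'I_n -> nat} * (Cn R n -> Cx R)),
    (forall p, List.In p L -> [/\ continuous p.2, indep_of s p.2 &
        forall i, i \notin s -> p.1 i = 0%N]) /\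
    forall z, H z = \sum_(p <- L) mono p.1 (z - z0) * p.2 z.

Lemma tmomD (k : 'I_n) l F G z : continuous F -> continuous G ->
  tmom k l (fun z => F z + G z) z = tmom k l F z + tmom k l G z.
Proof.
move=> cF cG; rewrite /tmom /mom -mulrDr -citgD; [|exact: cint|exact: cint].
by congr (_ * _); apply: citg_eq => t _; rewrite mulrDl.
Qed.

Lemma mono_upd (g : {ffun 'I_n -> nat}) z (k : 'I_n) c : g k = 0%N -> mono g (upd z k c - z0) = mono g (z - z0).
Proof.
move=> gk; apply: eq_bigr => i _; have [->|ik] := eqVneq i k; first by rewrite gk !expr0.
by rewrite !mxE -val_eqE in ik *; rewrite (negbTE ik).
Qed.

Lemma tmom_mono (k : 'I_n) l (g : {ffun 'I_n -> nat}) G z : g k = 0%N -> continuous G ->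
  tmom k l (fun z => mono g (z - z0) * G z) z = mono g (z - z0) * tmom k l G z.
Proof.
move=> gk cG; rewrite /tmom /mom mulrCA -(@citgZ R _ _ (mono g (z - z0)) _ (@cint k l G z cG)).
by congr (_ * _); apply: citg_eq => t _; rewrite mono_upd// mulrA.
Qed.

Lemma continuousC_prod (X : topologicalType) (I : Type) (s : seq I) (H : I -> X -> Cx R) :
  (forall i, continuous (H i)) -> continuous (fun x => \prod_(i <- s) H i x : Cx R).
Proof.
move=> cH; elim: s => [|i s IH].
  rewrite (_ : (fun x => _) = fun=> 1); first exact: (@continuousCcst R _ _).
  by apply/funext => x; rewrite big_nil.
rewrite (_ : (fun x => _) = fun x => H i x * \prod_(j <- s) H j x : Cx R); first exact: (continuousCM (cH i) IH).
by apply/funext => x; rewrite big_cons.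
Qed.

Lemma continuous_mono (X : topologicalType) (u : X -> Cn R n) g :
  continuous u -> continuous (fun x => mono g (u x)).
Proof.
move=> cu; apply: continuousC_prod => i; apply: (@continuousCX R _ _ (g i)).
exact: (@continuous_coord_comp R X n u i cu).
Qed.

Let cmz0 g : continuous (fun z : Cn R n => mono g (z - z0)).
Proof. exact: (@continuous_mono _ _ g (continuous_rowB (@continuous_rowid R n) (@continuous_rowcst R _ n z0))). Qed.

Lemma tmom_sum (k : 'I_n) l (L : seq ({ffun 'I_n -> nat} * (Cn R n -> Cx R))) z :
  (forall p, List.In p L -> continuous p.2 /\ p.1 k = 0%N) ->
  tmom k l (fun z => \sum_(p <- L) mono p.1 (z - z0) * p.2 z) z =
    \sum_(p <- L) mono p.1 (z - z0) * tmom k l p.2 z /\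
  continuous (fun z => \sum_(p <- L) mono p.1 (z - z0) * p.2 z : Cx R).
Proof.
elim: L => [_|p L IH HL].
  have E : (fun z => \sum_(p <- [::]) mono p.1 (z - z0) * p.2 z) = (fun=> 0 : Cx R) :> (Cn R n -> Cx R).
    by apply/funext => x; rewrite big_nil.
  rewrite E big_nil; split; last exact: (@continuousCcst R _ _).
  have c0 := @continuousCcst R (Cn R n) 0.
  have := tmomB k l z c0 c0; rewrite (_ : (fun _ => 0 - 0) = fun=> 0); last by apply/funext => x; rewrite subrr.
  by move=> ->; rewrite subrr.
have [cp pk] := HL p (or_introl erefl).
have [h1 h2] := IH (fun q hq => HL q (or_intror hq)).
have E : (fun z => \sum_(p <- p :: L) mono p.1 (z - z0) * p.2 z) =
    (fun z => mono p.1 (z - z0) * p.2 z + \sum_(p <- L) mono p.1 (z - z0) * p.2 z).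
  by apply/funext => x; rewrite big_cons.
have cm := continuousCM (@cmz0 p.1) cp.
rewrite E big_cons; split; last exact: (continuousCD cm h2).
by rewrite (tmomD k l z cm h2) h1 tmom_mono.
Qed.

Lemma tay_semipoly (k : 'I_n) s H : k \notin s -> semipoly s H -> semipoly (k :: s) (tay k H).
Proof.
move=> ks [L [HL HE]].
have {HE} -> : H = fun z => \sum_(p <- L) mono p.1 (z - z0) * p.2 z by apply/funext.
have HLk p : List.In p L -> continuous p.2 /\ p.1 k = 0%N by move/HL => [h1 _ h3]; split => //; exact: h3.
pose nw (l : 'I_M) (p : {ffun 'I_n -> nat} * (Cn R n -> Cx R)) :=
  ([ffun i => if i == k then l : nat else p.1 i],
   (fun z => (creal r)^-1 ^+ l * tmom k l p.2 z) : Cn R n -> Cx R).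
exists [seq nw l p | l <- enum 'I_M, p <- L]; split.
  move=> q; elim: (enum 'I_M) => //= l e IH; rewrite List.in_app_iff => -[|]; last exact: IH.
  move/List.in_map_iff => [p [<- /[dup] pL /HL[h1 h2 h3]]]; split.
  - exact: (continuousCM (@continuousCcst R _ _) (@continuous_tmom k l p.2 h1)).
  - move=> z z' zz' /=; congr (_ * _); rewrite /tmom.
    rewrite (_ : (fun w => p.2 (upd z k (z0 0 k + w))) = fun w => p.2 (upd z' k (z0 0 k + w)))//.
    apply/funext => w; apply: h2 => i si; have [->|ik] := eqVneq i k; first by rewrite !upd_same.
    by rewrite !upd_other// zz'// inE negb_or ik.
  - by move=> i; rewrite inE negb_or => /andP[ik si]; rewrite /= ffunE (negbTE ik) h3.
move=> z; rewrite big_flatten big_map big_enum /tay; apply: eq_bigr => l _; rewrite big_map.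
rewrite (tmom_sum l z HLk).1 mulr_sumr; apply: eq_big_seq_In => p pL.
have [_ pk] := HLk p pL.
have -> : mono [ffun i => if i == k then l : nat else p.1 i] (z - z0) = (z 0 k - z0 0 k) ^+ l * mono p.1 (z - z0).
  rewrite /mono (bigD1 k)//= [in RHS](bigD1 k)//= pk expr0 mul1r ffunE eqxx !mxE; congr (_ * _).
  by apply: eq_bigr => i ik; rewrite ffunE (negbTE ik).
by rewrite exprMn mulrACA.
Qed.

Lemma tays_semipoly s F : continuous F -> uniq s -> semipoly s (tays s F).
Proof.
move=> cF; elim: s => [_|k s IH]; last by rewrite cons_uniq => /andP[ks /IH]; exact: tay_semipoly.
exists [:: ([ffun=> 0%N], F)]; split.
  move=> p [<-|//]; split => // [z z' zz'|i _]; last by rewrite ffunE.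
  by congr F; apply/rowP => i; exact: zz'.
by move=> z; rewrite big_seq1 /mono big1 ?mul1r// => i _; rewrite ffunE expr0.
Qed.

Lemma multi_taylor F (B : R) : continuous F -> (forall z, P z -> normc (F z) <= B) ->
  (forall z, P z -> forall i : 'I_n, cderiv (fun w => F (upd z i w)) (z 0 i)) ->
  exists2 C, 0 <= C & exists L : seq ({ffun 'I_n -> nat} * Cx R), forall z, P z ->
  normc (F z - \sum_(p <- L) p.2 * mono p.1 (z - z0)) <= C * \sum_i normc (z 0 i - z0 0 i) ^+ M.
Proof.
move=> cF HB dF.
have [C C0 HC] := tays_error cF HB dF (enum_uniq 'I_n); exists C => //.
have [L [HL HE]] := tays_semipoly cF (enum_uniq 'I_n).
(* All coordinates being expanded, each coefficient is constant and may be evaluated at [z0]. *)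
exists [seq (p.1, p.2 z0) | p <- L] => z Pz; rewrite big_map.
have -> : \sum_(p <- L) p.2 z0 * mono p.1 (z - z0) = tays (enum 'I_n) F z.
  rewrite HE; apply: eq_big_seq_In => p /HL[_ h _]; rewrite mulrC; congr (_ * _).
  by apply: h => i; rewrite mem_enum.
by have := HC z Pz; rewrite big_enum.
Qed.

End MultiTaylor.

(** * Differentiability in epsilon-delta form and first-order expansions *)

Section Bridges.
Variable R : realType.

Lemma nbhs_normc (z : Cx R) (P : set (Cx R)) : nbhs z P ->
  exists2 dl : R, 0 < dl & forall w, normc (w - z) < dl -> P w.
Proof.
move=> /nbhs_ballP[e /= /creal_gt0[r r0 ->] H]; exists r => // w wr; apply: H.
by rewrite -ball_normE /= normcE_creal ltcR ncB.
Qed.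

Lemma derivable_cderiv (f : Cx R -> Cx R) : derivable f 0 1 -> cderiv f 0.
Proof.
rewrite /derivable => /cvg_ex[/= D HD]; exists D => e e0.
have FF : Filter (0 : Cx R)^' by exact: _.
have := (cvgcP FF _ _).1 HD e e0; rewrite /dnbhs near_withinE => hn; have [dl dl0 Hdl] := nbhs_normc hn.
exists dl => // w wdl; rewrite subr0 in wdl *.
have [->|w0] := eqVneq w 0; first by rewrite subrr mulr0 subr0 normc0 mulr0.
have := Hdl w; rewrite subr0 => /(_ wdl w0).
rewrite addr0 /GRing.scale /= mulr1 => h.
have -> : f w - f 0 - D * w = - ((D - w^-1 * (f w - f 0)) * w).
  by rewrite mulrBl mulrAC mulVf// mul1r opprB.
by rewrite ncN normcM ler_wpM2r ?nc_ge0// ltW.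
Qed.

(** A list may repeat exponents, so the derivative [D] at 0 collects every coefficient of exponent
    1. *)
Lemma poly_small (L : seq (nat * Cx R)) : exists D : Cx R, exists2 K : R, 0 <= K & forall h : Cx R,
  normc h <= 1 -> normc (\sum_(p <- L) p.2 * h ^+ p.1 - \sum_(p <- L) p.2 * 0 ^+ p.1 - D * h) <= K * normc h ^+ 2.
Proof.
elim: L => [|[k a] L [D [K K0 HK]]].
  by exists 0, 0 => // h _; rewrite !big_nil subrr mul0r subrr normc0 mul0r.
exists (D + if k == 1%N then a else 0), (K + normc a); first by rewrite addr_ge0// nc_ge0.
move=> h h1; rewrite !big_cons /=; set A := \sum_(p <- L) _; set B := \sum_(p <- L) _.
have -> : a * h ^+ k + A - (a * 0 ^+ k + B) - (D + (if k == 1%N then a else 0)) * h =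
  (A - B - D * h) + a * (h ^+ k - 0 ^+ k - (if k == 1%N then 1 else 0) * h) by case: ifP => _; ring.
apply: le_trans (ncD _ _) _; rewrite mulrDl; apply: lerD; first exact: HK.
rewrite normcM ler_wpM2l ?nc_ge0//.
case: k => [|[|k]]/=; rewrite ?expr0 ?expr1 ?mul1r ?mul0r ?subr0 ?subrr ?normc0 ?exprn_ge0 ?nc_ge0//.
rewrite expr0n /= subr0 ncX -addn2 exprD.
by rewrite ler_piMl ?exprn_ge0 ?nc_ge0// exprn_ile1// nc_ge0.
Qed.

Lemma cderiv_small (f : Cx R -> Cx R) (c D : Cx R) (K r : R) : 0 < r ->
  (forall h, normc h <= r -> normc (f (c + h) - f c - D * h) <= K * normc h ^+ 2) -> cderiv f c.
Proof.
move=> r0 H; exists D => e e0.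
have K0 : 0 < `|K| + 1 by rewrite ltr_wpDl.
exists (Num.min r (e / (`|K| + 1))); first by rewrite lt_min r0 divr_gt0.
move=> w; rewrite lt_min => /andP[wr we].
have := H (w - c) (ltW wr); rewrite [c + _]addrC subrK => h; apply: le_trans h _.
rewrite expr2 mulrA ler_wpM2r ?nc_ge0//.
move: we; rewrite ltr_pdivlMr// => we; apply: le_trans (ltW we); rewrite mulrC ler_wpM2l ?nc_ge0//.
by rewrite (le_trans (ler_norm _))// lerDl.
Qed.

Lemma is_derive0_cst (f : R -> R) (a b : R) : a <= b ->
  (forall x, a <= x <= b -> is_derive x (1 : R) f 0) -> f a = f b.
Proof.
rewrite le_eqVlt => /orP[/eqP->//|ab] H.
have [||c _] := @MVT_segment R f (fun=> 0) a b (ltW ab).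
- by move=> x; rewrite in_itv /= => /andP[/ltW h1 /ltW h2]; apply: H; rewrite h1.
- apply: derivable_within_continuous => x; rewrite in_itv /= => h; apply: ex_derive.
  exact: H.
by rewrite mul0r => /eqP; rewrite subr_eq0 => /eqP.
Qed.

Lemma ei_taylor (t : R) : 0 <= t -> normc (ei t - 1 - ci R * creal t) <= 4 * t ^+ 2.
Proof.
move=> t0; have E := citg_ei t0; rewrite ei0 in E.
have c1 : continuous (fun u : R => ci R * ei u : Cx R).
  exact: (continuousCM (@continuousCcst R _ _) (@continuous_ei R)).
have c2 : continuous (fun u : R => ci R : Cx R) by exact: (@continuousCcst R _ _).
rewrite -E (_ : ci R * creal t = citg 0 t (fun=> ci R)); last by rewrite citg_cst// subr0 mulrC.
rewrite -citgB//.
have -> : 4 * t ^+ 2 = 2 * ((2 * t) * (t - 0)) by ring.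
apply: (citg_norm t0 (continuousCB c1 c2)) => u.
move=>  /andP[u0 ut]; have -> : ci R * ei u - ci R = ci R * (ei u - ei 0) by rewrite ei0; ring.
rewrite normcM normc_ci mul1r; apply: le_trans (ei_lip _ _) _.
by rewrite subr0 ger0_norm// ler_pM2l.
Qed.

End Bridges.

Section EiConj.
Variable R : realType.

Lemma ei_conj (t : R) : ei t * conjc (ei t) = 1.
Proof.
apply/eqP; rewrite eq_complex /=; apply/andP; split; apply/eqP; last by ring.
by have := cos2Dsin2 t; rewrite !expr2 mulrN opprK.
Qed.

Lemma ei_taylor_abs (t : R) : normc (ei t - 1 - ci R * creal t) <= 4 * t ^+ 2.
Proof.
have [t0|t0] := leP 0 t; first exact: ei_taylor.
have := @ei_taylor R (- t); rewrite oppr_ge0 sqrrN => /(_ (ltW t0)).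
suff <- : conjc (ei t - 1 - ci R * creal t) = ei (- t) - 1 - ci R * creal (- t) by rewrite ncJ.
apply/eqP; rewrite eq_complex /= cosN sinN; apply/andP; split; apply/eqP; ring.
Qed.

Lemma cvg0_list (T : Type) (Fs : set_system T) (FF : Filter Fs) (I : Type) (L : seq (I * Cx R)) (h : I -> T -> Cx R) :
  (forall i, h i x @[x --> Fs] --> (0 : Cx R)) -> \sum_(p <- L) p.2 * h p.1 x @[x --> Fs] --> (0 : Cx R).
Proof.
move=> H; apply/cvgcP; elim: L => [|p L IH] e e0.
  by apply: nearW => x; rewrite big_nil subrr normc0.
have e2 : 0 < e / 2 by rewrite divr_gt0.
have p1 : 0 < normc p.2 + 1 by rewrite ltr_wpDl ?nc_ge0.
have H1 := (cvgcP FF _ _).1 (H p.1) _ (divr_gt0 e2 p1).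
apply: filterS2 H1 (IH _ e2) => x h1 h2.
rewrite big_cons opprD addrA sub0r -sub0r addrC.
rewrite sub0r ncN in h1; rewrite sub0r addrC -opprD ncN.
rewrite sub0r ncN in h2.
apply: le_lt_trans (ncD _ _) _; rewrite normcM.
have : normc p.2 * normc (h p.1 x) <= e / 2.
  apply: le_trans (ler_wpM2l (nc_ge0 _) (ltW h1)) _.
  by rewrite mulrCA; apply: ler_piMr; [exact: ltW|rewrite ler_pdivrMr// mul1r lerDl].
by move=> h3; rewrite [ltRHS]splitr; exact: ler_ltD.
Qed.

End EiConj.

(** * Orthogonal projection and polynomial spaces *)

Section Projection.
Variables (R : realType) (X : Type) (W : (X -> Cx R) -> Prop)
  (ip : (X -> Cx R) -> (X -> Cx R) -> Cx R).
Hypothesis W0 : W (fun=> 0).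
Hypothesis W_lin : forall f g c, W f -> W g -> W (fun x => f x + c * g x).
Hypothesis ip_lin : forall f g h c, W f -> W g -> W h ->
  ip (fun x => f x + c * g x) h = ip f h + c * ip g h.
Hypothesis ip_sym : forall f g, W f -> W g -> ip g f = conjc (ip f g).
Hypothesis ip_pos : forall f, W f -> exists2 r : R, 0 <= r & ip f f = creal r.

Lemma ip_linr f g h c : W f -> W g -> W h ->
  ip h (fun x => f x + c * g x) = ip h f + conjc c * ip h g.
Proof.
move=> Wf Wg Wh; rewrite (ip_sym (W_lin c Wf Wg) Wh) ip_lin// rmorphD rmorphM.
by rewrite (ip_sym Wf Wh) (ip_sym Wg Wh).
Qed.

(* The limit form may be degenerate on functions that agree on the boundary, hence
   the projection below is by Gram-Schmidt with this case distinction. *)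
Lemma ip_degenerate e f : W e -> W f -> ip e e = 0 -> ip f e = 0.
Proof.
move=> We Wf ee; apply/eqP/negPn/negP => fe0.
have [r r0 Hr] := ip_pos Wf.
set a := ip f e in fe0; pose Na := normc a ^+ 2.
have Na0 : 0 < Na.
  by rewrite exprn_gt0// lt_def nc_ge0 andbT; apply: contra fe0 => /eqP/eq0_normc ->.
have aa : a * conjc a = creal Na.
  rewrite /Na normc_sqr; case: (a) => x y; apply/eqP; rewrite eq_complex /=.
  by apply/andP; split; apply/eqP; ring.
(* Chosen so that the square norm of f - t a e, which is r - 2 t |a|^2 because [ip e e = 0], equals
   - 1. *)
pose t := (r + 1) / (2 * Na).
pose c := creal (- t) * a.
have [s s0 Hs] := ip_pos (W_lin c Wf We).
have : s = r - 2 * t * Na.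
  have cc : conjc c = creal (- t) * conjc a by rewrite /c rmorphM; congr (_ * _); apply/eqP; rewrite eq_complex /= oppr0 !eqxx.
  have h : creal s = creal r - creal (2 * t) * creal Na.
    rewrite -Hs ip_lin ?ip_linr//; last exact: W_lin.
    rewrite Hr ee -/a (ip_sym Wf We) -/a cc /c -aa /creal !rmorphN !rmorphM /=.
    by rewrite (_ : (2%:C)%C = 2) ?rmorphMn ?rmorph1//; ring.
  by have := congr1 (@complex.Re R) h; rewrite /= !mul0r !subr0.
have -> : 2 * t * Na = r + 1 by rewrite /t; field; exact: lt0r_neq0.
by move=> sE; move: s0; rewrite sE; lra.
Qed.

Fixpoint comb (L : seq (X -> Cx R)) (h : X -> Cx R) : Prop :=
  match L with
  | [::] => h = fun=> 0
  | e :: L' => exists c h', comb L' h' /\ h = fun x => h' x + c * e x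
  end.

Lemma comb_lin L f g c : comb L f -> comb L g -> comb L (fun x => f x + c * g x).
Proof.
elim: L f g => [f g -> ->|e L IH f g [a [f' [Hf ->]]] [b [g' [Hg ->]]]].
  by apply/funext => x; rewrite mulr0 addr0.
exists (a + c * b), (fun x => f' x + c * g' x); split; first exact: IH.
by apply/funext => x; ring.
Qed.

Fixpoint allW (L : seq (X -> Cx R)) : Prop := if L is e :: L' then W e /\ allW L' else True.

Lemma combW L h : allW L -> comb L h -> W h.
Proof.
elim: L h => [h _ -> //|e L IH h [We WL] [c [h' [Hh ->]]]].
by apply: W_lin => //; exact: IH.
Qed.

Fixpoint perp (L : seq (X -> Cx R)) (f : X -> Cx R) : Prop :=
  if L is e :: L' then ip f e = 0 /\ perp L' f else True.

Lemma ip0r f : W f -> ip f (fun=> 0) = 0.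
Proof.
move=> Wf; have := ip_linr (-1) W0 W0 Wf.
rewrite (_ : (fun _ => 0 + -1 * 0) = fun=> 0); last by apply/funext => x; rewrite mulr0 addr0.
by rewrite rmorphN rmorph1 mulN1r subrr.
Qed.

Lemma perp_comb L f h : W f -> allW L -> perp L f -> comb L h -> ip f h = 0.
Proof.
move=> Wf; elim: L h => [h _ _ -> |e L IH h [We WL] [fe fL] [c [h' [Hh ->]]]]; first exact: ip0r.
by rewrite ip_linr//; [rewrite IH// fe mulr0 addr0|exact: combW Hh].
Qed.

Lemma perp_lin L f g c : W f -> W g -> allW L -> perp L f -> perp L g -> perp L (fun x => f x + c * g x).
Proof.
move=> Wf Wg; elim: L => //= e L IH [We WL] [fe fL] [ge gL]; split; last exact: IH.
by rewrite ip_lin// fe ge mulr0 addr0.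
Qed.

Lemma projection L f : allW L -> W f -> exists2 h, comb L h & perp L (fun x => f x + -1 * h x).
Proof.
elim: L f => [f _ _|e L IH f [We WL] Wf]; first by exists (fun=> 0).
have [hf Hf Pf] := IH f WL Wf; have [he He Pe] := IH e WL We.
have Whf := combW WL Hf; have Whe := combW WL He.
set f' := (fun x => f x + -1 * hf x) in Pf; set e' := (fun x => e x + -1 * he x) in Pe.
have Wf' : W f' := W_lin (-1) Wf Whf; have We' : W e' := W_lin (-1) We Whe.
have eE : e = fun x => e' x + 1 * he x by apply/funext => x; rewrite /e'; ring.
(* In the degenerate case the residual [f'] is orthogonal to [e'] and to the combinations of [L],
   hence already to [e]. *)
have [ee|ee] := eqVneq (ip e' e') 0.
  exists (fun x => hf x + 0 * e x); first by exists 0, hf.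
  rewrite (_ : (fun x => f x + _) = f'); last by apply/funext => x; rewrite /f' mul0r addr0.
  split => //; rewrite eE ip_linr// (ip_degenerate We' Wf' ee) (perp_comb Wf' WL Pf He).
  by rewrite mulr0 addr0.
pose c := ip f' e' / ip e' e'.
exists (fun x => (hf x + - c * he x) + c * e x).
  by exists c, (fun x => hf x + - c * he x); split => //; exact: comb_lin.
rewrite (_ : (fun x => f x + _) = fun x => f' x + - c * e' x); last first.
  by apply/funext => x; rewrite /f' /e'; ring.
split; last exact: perp_lin.
have Wg := W_lin (- c) Wf' We'.
rewrite {1}eE ip_linr// (perp_comb Wg WL _ He); last exact: perp_lin.
by rewrite mulr0 addr0 ip_lin// /c mulNr divfK// subrr.
Qed.

Lemma comb_ind (P : (X -> Cx R) -> Prop) L h : P (fun=> 0) ->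
  (forall f g c, P f -> P g -> P (fun x => f x + c * g x)) ->
  (forall e, List.In e L -> P e) -> comb L h -> P h.
Proof.
move=> P0 Plin; elim: L h => [h _ -> //|e L IH h He [c [h' [Hh ->]]]].
by apply: Plin; [apply: IH => // e' e'L; apply: He; right|apply: He; left].
Qed.

Lemma allW_In L : (forall e, List.In e L -> W e) -> allW L.
Proof.
elim: L => //= e L IH H; split; first by apply: H; left.
by apply: IH => e' e'L; apply: H; right.
Qed.

Lemma perp_In L f e : perp L f -> List.In e L -> ip f e = 0.
Proof. by elim: L => //= e' L IH [h1 h2] [<-|]; [|exact: IH]. Qed.

End Projection.

(** * Spans of monomials of bounded total degree *)

Section PolySpan.
Variables (R : realType) (n : nat).
Local Notation fam := ('I_n -> Cn R n -> Cx R).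
Local Notation expo := {ffun 'I_n -> nat}.

(** One notion covers real coordinates, holomorphic coordinates, and shifted coordinates with their
    conjugates, so a change of generators amounts to substituting elements of degree one. For
    holomorphic polynomials both families are the coordinates. *)
Inductive psp (u v : fam) : nat -> (Cn R n -> Cx R) -> Prop :=
| psp_mon N (a b : expo) : (\sum_i a i + \sum_i b i <= N)%N ->
    psp u v N (fun z => \prod_i (u i z ^+ a i * v i z ^+ b i))
| psp_lin N f g c : psp u v N f -> psp u v N g -> psp u v N (fun z => f z + c * g z).

Lemma psp_eq u v N f g : psp u v N f -> (forall z, f z = g z) -> psp u v N g.
Proof. by move=> H fg; rewrite (_ : g = f)//; apply/funext => z; rewrite fg. Qed.

Lemma psp_le u v N M f : (N <= M)%N -> psp u v N f -> psp u v M f.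
Proof.
move=> NM H; elim: H NM => [N' a b ab NM|N' f' g c _ IHf _ IHg NM]; last by apply: psp_lin; [exact: IHf|exact: IHg].
by apply: psp_mon; exact: leq_trans NM.
Qed.

Lemma psp1 u v N : psp u v N (fun=> 1).
Proof.
apply: psp_eq (psp_mon u v (N := N) (a := [ffun=> 0%N]) (b := [ffun=> 0%N]) _) _.
  by rewrite !big1// => i _; rewrite ffunE.
by move=> z; rewrite big1// => i _; rewrite !ffunE !expr0 mulr1.
Qed.

Lemma psp0 u v N : psp u v N (fun=> 0).
Proof. by apply: psp_eq (psp_lin (-1) (psp1 u v N) (psp1 u v N)) _ => z; rewrite mulN1r subrr. Qed.

Lemma psp_add u v N f g : psp u v N f -> psp u v N g -> psp u v N (fun z => f z + g z).
Proof. by move=> hf hg; apply: psp_eq (psp_lin 1 hf hg) _ => z; rewrite mul1r. Qed.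

Lemma psp_scale u v N f c : psp u v N f -> psp u v N (fun z => c * f z).
Proof. by move=> hf; apply: psp_eq (psp_lin c (psp0 u v N) hf) _ => z; rewrite add0r. Qed.

Lemma psp_mul u v N M f g : psp u v N f -> psp u v M g -> psp u v (N + M) (fun z => f z * g z).
Proof.
move=> Hf; elim: Hf g => {N f} [N a b ab g Hg|N f1 f2 c _ IH1 _ IH2 g Hg]; last first.
  by apply: psp_eq (psp_lin c (IH1 g Hg) (IH2 g Hg)) _ => z; ring.
elim: Hg => {M g} [M a' b' ab'|M g1 g2 c _ IH1 _ IH2]; last first.
  by apply: psp_eq (psp_lin c IH1 IH2) _ => z; ring.
apply: psp_eq (psp_mon u v (N := N + M) (a := [ffun i => (a i + a' i)%N]) (b := [ffun i => (b i + b' i)%N]) _) _.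
  rewrite (eq_bigr (fun i => a i + a' i)%N); last by move=> i _; rewrite ffunE.
  rewrite [X in (_ + X)%N](eq_bigr (fun i => b i + b' i)%N); last by move=> i _; rewrite ffunE.
  by rewrite !big_split /= addnACA; exact: leq_add.
move=> z; rewrite -big_split /=; apply: eq_bigr => i _; rewrite !ffunE !exprD; ring.
Qed.

Lemma psp_exp u v N f k : psp u v N f -> psp u v (k * N) (fun z => f z ^+ k).
Proof.
move=> Hf; elim: k => [|k IH]; first by apply: psp_eq (psp1 u v _) _ => z; rewrite expr0.
by rewrite mulSn; apply: psp_eq (psp_mul Hf IH) _ => z; rewrite exprS.
Qed.

Lemma psp_prod u v (I : Type) (s : seq I) (N : I -> nat) (f : I -> Cn R n -> Cx R) :
  (forall i, psp u v (N i) (f i)) -> psp u v (\sum_(i <- s) N i) (fun z => \prod_(i <- s) f i z).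
Proof.
move=> H; elim: s => [|i s IH].
  by rewrite big_nil; apply: psp_eq (psp1 u v _) _ => z; rewrite big_nil.
by rewrite big_cons; apply: psp_eq (psp_mul (H i) IH) _ => z; rewrite big_cons.
Qed.

Lemma psp_sum u v (I : Type) (s : seq I) (P : pred I) N (f : I -> Cn R n -> Cx R) :
  (forall i, P i -> psp u v N (f i)) -> psp u v N (fun z => \sum_(i <- s | P i) f i z).
Proof.
move=> H; elim: s => [|i s IH].
  by apply: psp_eq (psp0 u v _) _ => z; rewrite big_nil.
case Pi : (P i); last by apply: psp_eq IH _ => z; rewrite big_cons Pi.
by apply: psp_eq (psp_add (H i Pi) IH) _ => z; rewrite big_cons Pi.
Qed.

Lemma psp_change u v u' v' N f : (forall i, psp u v 1 (u' i)) -> (forall i, psp u v 1 (v' i)) ->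
  psp u' v' N f -> psp u v N f.
Proof.
move=> Hu Hv; elim=> {N f} [N a b ab|N f g c _ IHf _ IHg]; last exact: psp_lin.
have h i : psp u v (a i + b i) (fun z => u' i z ^+ a i * v' i z ^+ b i).
  have h1 := psp_exp (a i) (Hu i); have h2 := psp_exp (b i) (Hv i).
  by rewrite !muln1 in h1 h2; exact: psp_mul.
apply: psp_le (psp_prod (index_enum 'I_n) h).
by rewrite big_split.
Qed.

Lemma psp_genl u v i : psp u v 1 (u i).
Proof.
apply: psp_eq (psp_mon u v (N := 1) (a := [ffun j => (j == i : nat)]) (b := [ffun=> 0%N]) _) _.
  rewrite (bigD1 i)//= ffunE eqxx !big1 ?addn0// => j; rewrite ffunE//.
  by move=> /negbTE ->.
move=> z; rewrite (bigD1 i)//= !ffunE eqxx expr1 expr0 mulr1 big1 ?mulr1// => j ji.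
by rewrite !ffunE (negbTE ji) !expr0 mulr1.
Qed.

Lemma psp_genr u v i : psp u v 1 (v i).
Proof.
apply: psp_eq (psp_mon u v (N := 1) (b := [ffun j => (j == i : nat)]) (a := [ffun=> 0%N]) _) _.
  rewrite [X in (_ + X)%N](bigD1 i)//= ffunE eqxx !big1 ?addn0// => j; rewrite ffunE//.
  by move=> /negbTE ->.
move=> z; rewrite (bigD1 i)//= !ffunE eqxx expr1 expr0 mul1r big1 ?mulr1// => j ji.
by rewrite !ffunE (negbTE ji) !expr0 mulr1.
Qed.

Lemma psp_continuous u v N f : (forall i, continuous (u i)) -> (forall i, continuous (v i)) ->
  psp u v N f -> continuous f.
Proof.
move=> cu cv; elim=> {N f} [N a b _|N f g c _ cf _ cg].
  apply: (@continuousC_prod R _ _ (index_enum 'I_n) (fun i z => u i z ^+ a i * v i z ^+ b i)) => i.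
  exact: (continuousCM (@continuousCX R _ _ (a i) (cu i)) (@continuousCX R _ _ (b i) (cv i))).
exact: (continuousCD cf (continuousCM (@continuousCcst R _ c) cg)).
Qed.

End PolySpan.

Section Polynomials.
Variables (R : realType) (n : nat).
Local Notation fam := ('I_n -> Cn R n -> Cx R).
Local Notation expo := {ffun 'I_n -> nat}.

Definition reF : fam := fun i z => creal (complex.Re (z 0 i)).
Definition imF : fam := fun i z => creal (complex.Im (z 0 i)).
Definition idF : fam := fun i z => z 0 i.
Definition shF (w : Cn R n) : fam := fun i z => z 0 i - w 0 i.
Definition cshF (w : Cn R n) : fam := fun i z => conjc (z 0 i - w 0 i).

Let expo_le (a : expo) N i : (\sum_i a i <= N)%N -> (a i < N.+1)%N.
Proof. by rewrite ltnS; apply: leq_trans; rewrite (bigD1 i)//= leq_addr. Qed.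

Let inord_expo (a : expo) N : (\sum_i a i <= N)%N ->
  forall i, ([ffun i => inord (a i)] : {ffun 'I_n -> 'I_N.+1}) i = a i :> nat.
Proof. by move=> h i; rewrite ffunE inordK//; exact: expo_le. Qed.

Lemma polyPN_psp N p : polyPN N p -> psp reF imF N p.
Proof.
move=> [c Hc]; apply: (psp_eq (f := fun z => \sum_(a : {ffun 'I_n -> 'I_N.+1}) \sum_(b : {ffun 'I_n -> 'I_N.+1})
         (if (\sum_(i < n) (a i : nat) + \sum_(i < n) (b i : nat) <= N)%N
          then c a b * \prod_(i < n) (creal (complex.Re (z 0 i)) ^+ a i *
                                       creal (complex.Im (z 0 i)) ^+ b i)
          else 0))); last by move=> z; rewrite Hc.
apply: psp_sum => a _; apply: psp_sum => b _.
case ab : (\sum_(i < n) a i + \sum_(i < n) b i <= N)%N; last exact: psp0.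
apply: psp_scale.
apply: psp_eq (psp_mon reF imF (N := N) (a := [ffun i => a i : nat]) (b := [ffun i => b i : nat]) _) _.
  rewrite (eq_bigr (fun i => a i : nat)); last by move=> i _; rewrite ffunE.
  by rewrite [X in (_ + X)%N](eq_bigr (fun i => b i : nat)) => [//|i _]; rewrite ffunE.
by move=> z; apply: eq_bigr => i _; rewrite !ffunE.
Qed.

Lemma polyHPN_psp N p : polyHPN N p -> psp idF idF N p.
Proof.
move=> [c Hc]; apply: (psp_eq (f := fun z => \sum_(a : {ffun 'I_n -> 'I_N.+1})
         (if (\sum_(i < n) (a i : nat) <= N)%N
          then c a * \prod_(i < n) (z 0 i) ^+ a i
          else 0))); last by move=> z; rewrite Hc.
apply: psp_sum => a _.
case ab : (\sum_(i < n) a i <= N)%N; last exact: psp0.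
apply: psp_scale.
apply: psp_eq (psp_mon idF idF (N := N) (a := [ffun i => a i : nat]) (b := [ffun i => 0%N]) _) _.
  rewrite (eq_bigr (fun i => a i : nat)); last by move=> i _; rewrite ffunE.
  by rewrite [X in (_ + X)%N]big1 ?addn0// => i _; rewrite ffunE.
by move=> z; apply: eq_bigr => i _; rewrite !ffunE expr0 mulr1.
Qed.

(** A monomial has the indicator of its exponents as coefficient array; [inord] does not truncate,
    since each exponent is at most [N]. *)
Lemma psp_polyPN N p : psp reF imF N p -> polyPN N p.
Proof.
elim=> {N p} [N a b ab|N f g k _ [c1 H1] _ [c2 H2]]; last first.
  exists (fun a b => c1 a b + k * c2 a b) => z; rewrite H1 H2 mulr_sumr -big_split /=.
  apply: eq_bigr => a _; rewrite mulr_sumr -big_split /=; apply: eq_bigr => b _.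
  by case: ifP => _; ring.
have aN : (\sum_i a i <= N)%N by apply: leq_trans ab; exact: leq_addr.
have bN : (\sum_i b i <= N)%N by apply: leq_trans ab; exact: leq_addl.
pose a0 : {ffun 'I_n -> 'I_N.+1} := [ffun i => inord (a i)].
pose b0 : {ffun 'I_n -> 'I_N.+1} := [ffun i => inord (b i)].
exists (fun a' b' => if (a' == a0) && (b' == b0) then 1 else 0) => z.
rewrite (bigD1 a0)//= (bigD1 b0)//= !eqxx /= [X in _ = _ + X + _]big1 => [|b' /negbTE bb]; last by rewrite bb; case: ifP; rewrite ?mul0r.
rewrite [X in _ = _ + X]big1 => [|a' /negbTE aa]; last by rewrite big1// => b' _; rewrite aa; case: ifP; rewrite ?mul0r.
rewrite (eq_bigr (fun i => a i)); last by move=> i _; exact: inord_expo.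
rewrite [X in (_ + X <= _)%N](eq_bigr (fun i => b i)); last by move=> i _; exact: inord_expo.
rewrite ab !addr0 mul1r; apply: eq_bigr => i _.
by rewrite (inord_expo aN) (inord_expo bN).
Qed.

Lemma psp_polyHPN N p : psp idF idF N p -> polyHPN N p.
Proof.
elim=> {N p} [N a b ab|N f g k _ [c1 H1] _ [c2 H2]]; last first.
  exists (fun a => c1 a + k * c2 a) => z; rewrite H1 H2 mulr_sumr -big_split /=.
  by apply: eq_bigr => a _; case: ifP => _; ring.
pose ab' : expo := [ffun i => (a i + b i)%N].
have aN : (\sum_i ab' i <= N)%N.
  by rewrite (eq_bigr (fun i => a i + b i)%N) ?big_split// => i _; rewrite ffunE.
pose a0 : {ffun 'I_n -> 'I_N.+1} := [ffun i => inord (ab' i)].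
exists (fun a' => if a' == a0 then 1 else 0) => z.
rewrite (bigD1 a0)//= !eqxx /= [X in _ = _ + X]big1 => [|a' /negbTE aa]; last by rewrite aa; case: ifP; rewrite ?mul0r.
rewrite (eq_bigr (fun i => ab' i)); last by move=> i _; exact: inord_expo.
rewrite aN !addr0 mul1r; apply: eq_bigr => i _.
by rewrite (inord_expo aN) ffunE exprD.
Qed.

(** With v = z - w, Re z = Re w + (v + conj v) / 2 and Im z = Im w + i (conj v - v) / 2, both of
    degree one in the new generators. *)
Lemma psp_reim_shift w N p : psp reF imF N p -> psp (shF w) (cshF w) N p.
Proof.
apply: psp_change => i.
  have h1 := psp_scale (creal (complex.Re (w 0 i))) (psp1 (shF w) (cshF w) 1).
  have h2 := psp_lin (creal 2^-1) h1 (psp_genl (shF w) (cshF w) i).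
  apply: psp_eq (psp_lin (creal 2^-1) h2 (psp_genr (shF w) (cshF w) i)) _ => z.
  rewrite /reF /shF /cshF; case: (z 0 i) => x y; case: (w 0 i) => x' y'.
  by apply/eqP; rewrite eq_complex /=; apply/andP; split; apply/eqP; field.
have h1 := psp_scale (creal (complex.Im (w 0 i))) (psp1 (shF w) (cshF w) 1).
have h2 := psp_lin (creal (- 2^-1) * ci R) h1 (psp_genl (shF w) (cshF w) i).
apply: psp_eq (psp_lin (creal 2^-1 * ci R) h2 (psp_genr (shF w) (cshF w) i)) _ => z.
rewrite /imF /shF /cshF; case: (z 0 i) => x y; case: (w 0 i) => x' y'.
by apply/eqP; rewrite eq_complex /=; apply/andP; split; apply/eqP; field.
Qed.

Lemma psp_id_reim N p : psp idF idF N p -> psp reF imF N p.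
Proof.
have h i : psp reF imF 1 (idF i).
  apply: psp_eq (psp_lin (ci R) (psp_genl reF imF i) (psp_genr reF imF i)) _ => z.
  rewrite /idF /reF /imF; case: (z 0 i) => x y.
  by apply/eqP; rewrite eq_complex /=; apply/andP; split; apply/eqP; ring.
exact: psp_change.
Qed.

Lemma psp_mono_shift w (g : expo) N : (\sum_i g i <= N)%N -> psp idF idF N (fun z => mono g (z - w)).
Proof.
move=> gN; have h i : psp idF idF 1 (shF w i).
  by apply: psp_eq (psp_lin (- w 0 i) (psp_genl idF idF i) (psp1 idF idF 1)) _ => z; rewrite mulr1.
apply: (psp_change h h).
apply: psp_eq (psp_mon (shF w) (shF w) (N := N) (a := g) (b := [ffun=> 0%N]) _) _.
  by rewrite [X in (_ + X)%N]big1 ?addn0// => i _; rewrite ffunE.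
by move=> z; apply: eq_bigr => i _; rewrite ffunE expr0 mulr1 !mxE.
Qed.

Lemma continuous_idF i : continuous (@idF i).
Proof. exact: continuous_coord. Qed.

Lemma cderiv_lin (f g : Cx R -> Cx R) c w : cderiv f w -> cderiv g w -> cderiv (fun x => f x + c * g x) w.
Proof.
move=> [D1 H1] [D2 H2]; exists (D1 + c * D2) => e e0.
have e2 : 0 < e / 2 by rewrite divr_gt0.
have c1 : 0 < normc c + 1 by rewrite ltr_wpDl ?nc_ge0.
have [d1 d10 K1] := H1 _ e2; have [d2 d20 K2] := H2 _ (divr_gt0 e2 c1).
exists (Num.min d1 d2); first by rewrite lt_min d10.
move=> x; rewrite lt_min => /andP[/K1 h1 /K2 h2].
have -> : f x + c * g x - (f w + c * g w) - (D1 + c * D2) * (x - w) =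
  (f x - f w - D1 * (x - w)) + c * (g x - g w - D2 * (x - w)) by ring.
apply: le_trans (ncD _ _) _; rewrite [e in leRHS]splitr mulrDl normcM; apply: lerD => //.
apply: le_trans (ler_wpM2l (nc_ge0 _) h2) _; rewrite mulrA ler_wpM2r ?nc_ge0//.
by rewrite mulrCA; apply: ler_piMr; [exact: ltW|rewrite ler_pdivrMr// mul1r lerDl].
Qed.

Lemma cderiv_derivable (f : Cx R -> Cx R) : cderiv f 0 -> derivable f 0 1.
Proof.
move=> [D HD]; apply/cvg_ex; exists D.
have FF : Filter (0 : Cx R)^' by exact: _.
apply/(cvgcP FF) => e e0.
have [dl dl0 Hdl] := HD (e / 2) (divr_gt0 e0 (ltr0n R 2)).
rewrite /dnbhs near_withinE; have := near_normc (0 : Cx R) dl0; apply: filterS => h; rewrite sub0r ncN => hd h0.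
have h0' : 0 < normc h by rewrite lt_def nc_ge0 andbT; apply: contra h0 => /eqP/eq0_normc ->.
change (normc (D - h^-1 * (f (h * 1 + 0) - f 0)) < e); rewrite mulr1 addr0.
have := Hdl h; rewrite !subr0 => /(_ hd) K.
rewrite -(ltr_pM2r h0') -normcM.
have -> : (D - h^-1 * (f h - f 0)) * h = - (f h - f 0 - D * h).
  by rewrite mulrBl -mulrA [(f h - f 0) * h]mulrC mulrA mulVf// mul1r [RHS]opprB.
rewrite ncN; apply: le_lt_trans K _; rewrite ltr_pM2r//; lra.
Qed.

(** Along the j-th coordinate a monomial is a constant times a power of z_j + w, whose binomial
    expansion falls under [poly_small]. *)
Lemma psp_derivable N p : psp idF idF N p ->
  forall (z : Cn R n) (j : 'I_n), derivable (fun w : Cx R => p (z + w *: delta_mx 0 j)) 0 1.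
Proof.
move=> H z j; apply: cderiv_derivable.
elim: H => {N p} [N a b _|N f g c _ IHf _ IHg]; last exact: cderiv_lin.
pose k := (a j + b j)%N; pose K := \prod_(i | i != j) (z 0 i ^+ a i * z 0 i ^+ b i).
rewrite (_ : (fun w => _) = fun w => K * (z 0 j + w) ^+ k); last first.
  apply/funext => w; rewrite (bigD1 j)//= mulrC; congr (_ * _); last first.
    by rewrite /idF !mxE !eqxx mulr1 -exprD.
  by apply: eq_bigr => i ij; rewrite /idF !mxE eqxx (negbTE ij) mulr0 addr0.
pose mk (l : 'I_k.+1) : nat * Cx R := (l : nat, K * (z 0 j ^+ (k - l) *+ 'C(k, l))).
pose L := [seq mk l | l <- index_enum 'I_k.+1].
have E w : K * (z 0 j + w) ^+ k = \sum_(p <- L) p.2 * w ^+ p.1.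
  by rewrite /L big_map exprDn mulr_sumr; apply: eq_bigr => l _ /=; rewrite -mulrnAl mulrA.
have [D [C C0 HC]] := poly_small L.
by apply: (@cderiv_small R _ 0 D C 1) => // h h1; rewrite add0r !E; exact: HC.
Qed.

Lemma cvgc_unique (T : Type) (Fs : set_system T) (FF : ProperFilter Fs) (f : T -> Cx R) (a b : Cx R) :
  f @ Fs --> a -> f @ Fs --> b -> a = b.
Proof.
move=> /cvgcP Ha /cvgcP Hb; apply/eqP; rewrite -subr_eq0; apply/eqP/eq0_normc.
apply/eqP; rewrite eq_le nc_ge0 andbT; apply/ler_addgt0Pr => e e0; rewrite add0r.
have e2 : 0 < e / 2 by rewrite divr_gt0.
have [x [h1 h2]] := filter_ex (filterI (Ha _ e2) (Hb _ e2)).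
rewrite -(subrKA (f x)); apply: le_trans (ncD _ _) _; rewrite [leRHS]splitr.
by apply: lerD; apply: ltW; rewrite // ncB.
Qed.

Lemma cvgc_lin (T : Type) (Fs : set_system T) (FF : Filter Fs) (f g : T -> Cx R) (a b c : Cx R) :
  f @ Fs --> a -> g @ Fs --> b -> f x + c * g x @[x --> Fs] --> a + c * b.
Proof.
move=> /cvgcP Ha /cvgcP Hb; apply/cvgcP => e e0.
have e2 : 0 < e / 2 by rewrite divr_gt0.
have c1 : 0 < normc c + 1 by rewrite ltr_wpDl ?nc_ge0.
apply: filterS2 (Ha _ e2) (Hb _ (divr_gt0 e2 c1)) => x h1 h2.
have -> : a + c * b - (f x + c * g x) = (a - f x) + c * (b - g x) by ring.
apply: le_lt_trans (ncD _ _) _; rewrite [ltRHS]splitr normcM; apply: ltr_leD => //.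
apply: le_trans (ler_wpM2l (nc_ge0 _) (ltW h2)) _.
by rewrite mulrCA; apply: ler_piMr; [exact: ltW|rewrite ler_pdivrMr// mul1r lerDl].
Qed.

Lemma cvgc_conj (T : Type) (Fs : set_system T) (FF : Filter Fs) (f : T -> Cx R) (a : Cx R) :
  f @ Fs --> a -> conjc (f x) @[x --> Fs] --> (conjc a : Cx R).
Proof.
move=> /cvgcP Ha; apply/cvgcP => e e0; have := Ha e e0; apply: filterS => x.
by rewrite -rmorphB ncJ.
Qed.

End Polynomials.

(** * Tubes around the boundary of the ellipsoid *)

Lemma mul_outside_le0 (R : realType) (x b D : R) : 0 <= D -> (x < b - D) || (b < x) ->
  (x - (b - D)) * (b - x) <= 0.
Proof.
by move=> D0 /orP[h|h]; [rewrite mulr_le0_ge0|rewrite mulr_ge0_le0]; lra.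
Qed.

Section Ellipsoid.
Variable R : realType.
Variable n : nat.
Hypothesis hn : (1 <= n)%N.
Variable A : 'M[R]_n.
Hypothesis A_sym : A^T = A.
Hypothesis A_pd : forall v : 'rV[R]_n, v != 0 -> 0 < (v *m A *m v^T) 0 0.
Variable d : R.
Hypothesis hd : 0 < d.
Variable zeta : Cn R n.
Implicit Types (z w : Cn R n).
Local Notation edist := (@Pilot.Defs.edist R n).

Let I_sym : (1%:M : 'M[R]_n)^T = 1%:M.
Proof. exact: trmx1. Qed.

Let I_pd (v : 'rV[R]_n) : v != 0 -> 0 < (v *m 1%:M *m v^T) 0 0.
Proof.
move=> v0; rewrite mulmx1 mxE.
have [i vi] : exists i, v 0 i != 0.
  apply/existsP; move: v0; apply: contraR; rewrite negb_exists => /forallP H.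
  by apply/eqP/rowP => i; rewrite mxE; apply/eqP; have := H i; rewrite negbK.
rewrite (bigD1 i)//= mxE ltr_wpDr//; last by rewrite -expr2 exprn_even_gt0.
by apply: sumr_ge0 => j _; rewrite mxE -expr2 sqr_ge0.
Qed.

(** The Euclidean distance is the norm attached to the identity matrix, so the facts proved for
    [nfm] apply to it. *)
Lemma edistE z w : edist z w = nfm 1%:M (z - w).
Proof.
rewrite /Pilot.Defs.edist /nfm /qfm /bfm; congr Num.sqrt; apply: eq_bigr => i _.
rewrite (bigD1 i)//= big1 ?addr0; last by move=> j ji; rewrite mxE eq_sym (negbTE ji) mul0r.
by rewrite !mxE eqxx mul1r !expr2.
Qed.

Lemma edist_ge0 z w : 0 <= edist z w.
Proof. exact: sqrtr_ge0. Qed.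

Lemma edistC z w : edist z w = edist w z.
Proof. by rewrite !edistE -opprB nfmN. Qed.

Lemma edist_tri z w u : edist z u <= edist z w + edist w u.
Proof. by rewrite !edistE -(subrKA w); exact: (nfmD I_sym I_pd). Qed.

Definition Nf z : R := nfm A (z - zeta).
Let sd := Num.sqrt d.

Let sd0 : 0 < sd.
Proof. by rewrite sqrtr_gt0. Qed.

Lemma Nf_ge0 z : 0 <= Nf z.
Proof. exact: sqrtr_ge0. Qed.

Let Nf_sqr z : Nf z ^+ 2 = qfm A (z - zeta).
Proof. exact: (nfm_sqr A_pd). Qed.

Lemma ellipsoidE z : ellipsoid A zeta d z <-> Nf z < sd.
Proof.
rewrite /ellipsoid /= (rhoE A_sym) ltcR -Nf_sqr -(sqr_sqrtr (ltW hd)) -/sd.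
by rewrite ltr_pXn2r// nnegrE ?Nf_ge0// ltW.
Qed.

Lemma continuous_Nf : continuous Nf.
Proof.
apply: continuous_nfm.
exact: (continuous_rowB (@continuous_rowid R n) (@continuous_rowcst R _ n zeta)).
Qed.

Lemma dilB c z : dil zeta c z - zeta = c *: (z - zeta).
Proof. by apply/rowP => i; rewrite !mxE addrC addKr. Qed.

Lemma Nf_dil c z : Nf (dil zeta c z) = normc c * Nf z.
Proof. by rewrite /Nf dilB nfmZc. Qed.

Lemma edist_dil c z w : edist (dil zeta c z) (dil zeta c w) = normc c * edist z w.
Proof.
by rewrite !edistE -nfmZc; congr nfm; apply/rowP => i; rewrite !mxE; ring.
Qed.

Lemma Nf_edist : exists2 K : R, 0 < K & forall z w, Nf z <= Nf w + K * edist z w.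
Proof.
have [K1 K10 HK1] := nfm_coord I_sym I_pd; have [K2 K20 HK2] := nfm_le_coord A_sym A_pd.
exists (K2 * K1); first exact: mulr_gt0.
move=> z w; rewrite /Nf -(subrKA w) addrC; apply: le_trans (nfmD A_sym A_pd _ _) _.
rewrite lerD2l -mulrA; apply: HK2; first by rewrite mulr_ge0 ?edist_ge0// ltW.
by move=> i; rewrite edistE; exact: HK1.
Qed.

Lemma open_ellipsoid : open (ellipsoid A zeta d).
Proof.
have -> : ellipsoid A zeta d = Nf @^-1` [set x | x < sd].
  by apply/seteqP; split => z /ellipsoidE.
by apply: open_comp => [z _|]; [exact: continuous_Nf|exact: open_lt].
Qed.

Lemma continuous_dilr z : continuous (fun t : R => dil zeta (creal t) z).
Proof. by apply: continuous_dil; [exact: continuous_creal|move=> ?; exact: cvg_cst]. Qed.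

Lemma closure_ellipsoid z : closure (ellipsoid A zeta d) z <-> Nf z <= sd.
Proof.
split=> [cz|Nz].
  rewrite leNgt; apply/negP => Nz.
  have : nbhs z (Nf @^-1` [set x | sd < x]).
    by apply: open_nbhs_nbhs; split => //; apply: open_comp => [? _|]; [exact: continuous_Nf|exact: open_gt].
  by move/cz => [w [/ellipsoidE h1 h2]]; have := lt_trans h1 h2; rewrite ltxx.
move=> B nB.
have : \forall t \near (1 : R), B (dil zeta (creal t) z).
  have := @continuous_dilr z 1; rewrite /continuous_at /creal rmorph1 dil1; apply; exact: nB.
move=> [e /= e0 He].
pose t : R := 1 - Num.min (e / 2) (1 / 2).
have m0 : 0 < Num.min (e / 2) (1 / 2) by rewrite lt_min !divr_gt0.
have m1 : Num.min (e / 2) (1 / 2) <= 1 / 2 by rewrite ge_min lexx orbT.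
have m2 : Num.min (e / 2) (1 / 2) <= e / 2 by rewrite ge_min lexx.
exists (dil zeta (creal t) z); split; last first.
  by apply: He; rewrite /= /t opprB addrCA subrr addr0 gtr0_norm//; lra.
apply/ellipsoidE; rewrite Nf_dil normc_creal ger0_norm; last by rewrite /t; lra.
apply: le_lt_trans (_ : _ <= t * sd) _; first by rewrite ler_wpM2l// /t; lra.
by rewrite gtr_pMl// /t; lra.
Qed.

Lemma bdry_ellipsoid z : bdry (ellipsoid A zeta d) z <-> Nf z = sd.
Proof.
rewrite /bdry /setD /= (interior_id _).1; last exact: open_ellipsoid.
split=> [[/closure_ellipsoid h1 /ellipsoidE/negP]|zd].
  by rewrite -leNgt => h2; apply/eqP; rewrite eq_le h1.
by split; [apply/closure_ellipsoid; rewrite zd|move/ellipsoidE; rewrite zd ltxx].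
Qed.

Lemma tubeE e z : tube (ellipsoid A zeta d) e z <-> Nf z < sd /\ exists2 w, Nf w = sd & edist z w < e.
Proof.
rewrite /tube /=; split=> [[/ellipsoidE h [w /bdry_ellipsoid h1 h2]]|[h [w h1 h2]]].
  by split => //; exists w.
by split; [apply/ellipsoidE|exists w => //; apply/bdry_ellipsoid].
Qed.

Local Notation T := (tube (ellipsoid A zeta d)).

Lemma tube_dil e c z : normc c = 1 -> T e (dil zeta c z) <-> T e z.
Proof.
have H c' z' : normc c' = 1 -> T e z' -> T e (dil zeta c' z').
  move=> c1 /tubeE[h1 [w h2 h3]]; apply/tubeE; split; first by rewrite Nf_dil c1 mul1r.
  by exists (dil zeta c' w); rewrite ?Nf_dil ?edist_dil c1 mul1r.
move=> c1; split=> [/(H c^-1)|]; last exact: H.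
rewrite dilM mulVf ?dil1; first by apply; rewrite normcV c1 invr1.
by apply/eqP => c0; move: c1; rewrite c0 normc0 => /eqP; rewrite eq_sym oner_eq0.
Qed.

(** If [w] were outside, the segment from [y] to [w] would meet the boundary by the intermediate
    value theorem, at distance less than [e] from [y], which would put [y] in the tube. *)
Lemma tube_ball e y w : Nf y < sd -> ~ T e y -> edist y w < e -> Nf w < sd.
Proof.
move=> yd nT yw; rewrite ltNge; apply/negP => wd; apply: nT; apply/tubeE; split => //.
pose g (t : R) := Nf (y + creal t *: (w - y)).
have cg : continuous g.
  move=> t; apply: (@continuous_comp _ _ _ (fun t : R => y + creal t *: (w - y)) Nf); last exact: continuous_Nf.
  apply: continuous_rowP => i s; rewrite (_ : (fun x => _) = fun s => y 0 i + creal s * (w - y) 0 i).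
    exact: (continuousCD (@continuousCcst R _ _) (continuousCM (@continuous_creal R) (@continuousCcst R _ _))).
  by apply/funext => x; rewrite !mxE.
have g0 : g 0 = Nf y by rewrite /g /creal rmorph0 scale0r addr0.
have g1 : g 1 = Nf w by rewrite /g /creal rmorph1 scale1r addrC subrK.
have [t] : exists2 c, c \in `[0, 1] & g c = sd.
  apply: IVT => //; first exact: continuous_subspaceT.
  by rewrite g0 g1 ge_min le_max wd (ltW yd) orbT.
rewrite in_itv /= => /andP[t0 t1] gt; exists (y + creal t *: (w - y)) => //.
apply: le_lt_trans yw; rewrite !edistE opprD addrA subrr add0r -scalerN opprB nfmZc normc_creal ger0_norm//.
by rewrite ler_piMl// nfm_ge0.
Qed.

(* Convexity of the ellipsoid: shrinking the tube by lam corresponds to contracting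
   the ray through z towards its boundary point. *)
Lemma tube_ray e lam sg s z : 0 < lam -> lam <= 1 -> sg * Nf z = sd -> 0 <= s -> s < sg ->
  T (lam * e) (dil zeta (creal (sg - lam * (sg - s))) z) -> T e (dil zeta (creal s) z).
Proof.
move=> l0 l1 sgz s0 ssg /tubeE[_ [w Nw dw]]; apply: contrapT => nT.
have sg0 : 0 < sg by exact: le_lt_trans ssg.
have Nz : 0 < Nf z by rewrite -(pmulr_rgt0 _ sg0) sgz.
have l0' : creal lam != 0 :> Cx R by apply/eqP => -[h]; move: l0; rewrite h ltxx.
(* Preimage of [w] under the homothety of ratio [lam] centred at the boundary point of the ray. It
   is within [e] of an interior point off the tube, hence interior; convexity then makes [w]
   interior, a contradiction. *)
pose w' := zeta + (creal lam)^-1 *: (w - zeta - creal ((1 - lam) * sg) *: (z - zeta)).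
have h1 : Nf (dil zeta (creal s) z) < sd.
  by rewrite Nf_dil normc_creal ger0_norm// -sgz ltr_pM2r.
have h2 : edist (dil zeta (creal s) z) w' < e.
  rewrite edistE (_ : _ - w' = (creal lam)^-1 *: (dil zeta (creal (sg - lam * (sg - s))) z - w)).
    by rewrite nfmZc normcV normc_creal gtr0_norm// -edistE ltr_pdivrMl.
  apply/rowP => i; rewrite !mxE !crealB !crealM !crealB /creal rmorph1; field; exact: l0'.
have h3 := tube_ball h1 nT h2.
have E : w - zeta = creal lam *: (w' - zeta) + creal ((1 - lam) * sg) *: (z - zeta).
  apply/rowP => i; rewrite !mxE !crealM !crealB /creal rmorph1; field; exact: l0'.
have : Nf w <= lam * Nf w' + (1 - lam) * sd.
  rewrite /Nf E; apply: le_trans (nfmD A_sym A_pd _ _) _; rewrite !nfmZc !normc_creal.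
  rewrite (gtr0_norm l0) ger0_norm; last by rewrite mulr_ge0 ?subr_ge0// ltW.
  by rewrite -mulrA -[nfm A (z - zeta)]/(Nf z) sgz.
rewrite Nw leNgt => /negP; apply.
have : lam * Nf w' < lam * sd by rewrite ltr_pM2l.
by move=> h; lra.
Qed.

(** The gauge [Nf] is Lipschitz for the Euclidean distance, so a point within [e] of the boundary
    has gauge at least sqrt d - K e; dividing by [Nf z] turns this into a bound on the ray
    parameter. *)
Lemma tube_near : exists2 C : R, 0 < C & forall e sg s z, 0 < sg -> sg * Nf z = sd -> 0 <= s ->
  T e (dil zeta (creal s) z) -> s < sg /\ sg - s <= C * e * sg.
Proof.
have [K K0 HK] := Nf_edist; exists (K / sd); first by rewrite divr_gt0.
move=> e sg s z sg0 sgz s0 /tubeE[h1 [w Nw dw]].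
rewrite Nf_dil normc_creal ger0_norm// in h1.
have Nz : 0 < Nf z by rewrite -(pmulr_rgt0 _ sg0) sgz.
split; first by rewrite -(ltr_pM2r Nz) sgz.
have h2 : sd <= s * Nf z + K * e.
  have := HK w (dil zeta (creal s) z); rewrite Nw Nf_dil normc_creal (ger0_norm s0) edistC => h.
  by apply: le_trans h _; rewrite lerD2l ler_pM2l// ltW.
have h3 : sg * sd <= s * sd + K * e * sg.
  have := ler_wpM2l (ltW sg0) h2; rewrite mulrDr (mulrCA sg s) sgz; lra.
rewrite (_ : K / sd * e * sg = K * e * sg / sd); last by ring.
by rewrite ler_pdivlMr// mulrBl; lra.
Qed.

(** Here [n >= 1] provides a nonzero vector, scaled to the boundary; the infimum defining [bdist] is
    thus over a nonempty set. *)
Lemma bdry_neq0 : exists u, Nf u = sd.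
Proof.
pose i0 : 'I_n := Ordinal hn.
pose z1 : Cn R n := zeta + delta_mx 0 i0.
have N1 : 0 < Nf z1.
  rewrite lt_def Nf_ge0 andbT; apply/eqP => h.
  have := Nf_sqr z1; rewrite h expr0n => /esym/(qfm_eq0 A_pd).
  rewrite /z1 addrC addKr => /rowP/(_ i0); rewrite !mxE !eqxx => /eqP.
  by rewrite oner_eq0.
exists (dil zeta (creal (sd / Nf z1)) z1).
by rewrite Nf_dil normc_creal ger0_norm ?divfK ?lt0r_neq0// divr_ge0// ltW.
Qed.

Definition bdist z : R := inf [set edist z w | w in [set w | Nf w = sd]].

Let bdist_ne z : [set edist z w | w in [set w | Nf w = sd]] !=set0.
Proof. by have [u Nu] := bdry_neq0; exists (edist z u); exists u. Qed.

Let bdist_lb z : has_lbound [set edist z w | w in [set w | Nf w = sd]].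
Proof. by exists 0 => _ [w _ <-]; exact: edist_ge0. Qed.

Lemma bdist_lt e z : bdist z < e <-> exists2 w, Nf w = sd & edist z w < e.
Proof.
split=> [h|[w Nw h]].
  have [_ [w Nw <-] h2] := inf_lt (bdist_ne z) h.
  by exists w.
by apply: le_lt_trans h; apply: ge_inf => //; exists w.
Qed.

Lemma bdist_lip z z' : `|bdist z - bdist z'| <= edist z z'.
Proof.
have H x y : bdist x <= bdist y + edist x y.
  rewrite -lerBlDr; apply: lb_le_inf => // _ [w Nw <-].
  rewrite lerBlDr addrC; apply: le_trans (edist_tri x y w).
  by apply: ge_inf => //; exists w.
rewrite ler_norml; have := H z z'; have := H z' z; rewrite (edistC z' z) => h1 h2.
by apply/andP; split; lra.
Qed.

Lemma continuous_bdist : continuous bdist.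
Proof.
apply/continuousRP => z e e0.
have cd : continuous (fun z' => edist z z').
  rewrite (_ : (fun z' => _) = fun z' => nfm 1%:M (z - z')); last by apply/funext => z'; exact: edistE.
  apply: continuous_nfm.
  exact: (continuous_rowB (@continuous_rowcst R _ n z) (@continuous_rowid R n)).
have := (continuousRP _).1 cd z e e0; apply: filterS => z'.
rewrite [edist z z]edistE subrr nfm0 sub0r normrN ger0_norm ?edist_ge0//.
exact: le_lt_trans (bdist_lip _ _).
Qed.

Definition chi e z : R := if `[< T e z >] then 1 else 0.

(** The tube is cut out by two strict inequalities between continuous functions, so its indicator is
    a product of two functions covered by [baire1_pos]. *)
Lemma chiE e z : chi e z = (if 0 < sd - Nf z then 1 else 0) * (if 0 < e - bdist z then 1 else 0).
Proof.
rewrite /chi !subr_gt0; case: asboolP => [/tubeE[h1 h2]|nT].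
  by rewrite h1; move/bdist_lt : h2 => ->; rewrite mulr1.
case: ifPn => h1; last by rewrite mul0r.
by case: ifPn => h2; rewrite ?mulr0// mulr1; exfalso; apply: nT; apply/tubeE; split => //; apply/bdist_lt.
Qed.

Lemma ellipsoid_box : exists2 L : R, 0 < L & forall z i, Nf z <= sd -> normc (z 0 i) <= L.
Proof.
have [K K0 HK] := nfm_coord A_sym A_pd.
exists (K * sd + \sum_i normc (zeta 0 i)).
  by rewrite ltr_wpDr ?mulr_gt0// sumr_ge0// => i _; exact: nc_ge0.
move=> z i Nz; have -> : z 0 i = (z - zeta) 0 i + zeta 0 i by rewrite !mxE subrK.
apply: le_trans (ncD _ _) _; apply: lerD.
  by apply: le_trans (HK _ _) _; rewrite ler_pM2l.
by rewrite (bigD1 i)//= lerDl sumr_ge0// => j _; exact: nc_ge0.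
Qed.

Lemma chi_adm e : adm (chi e).
Proof.
split.
  have c1 := continuousRB (@continuousRcst R _ sd) continuous_Nf.
  have c2 := continuousRB (@continuousRcst R _ e) continuous_bdist.
  by have := baire1M (baire1_pos c1) (baire1_pos c2); congr baire1; apply/funext => z; rewrite -chiE.
have [L L0 HL] := ellipsoid_box; exists L => z i Lz; rewrite /chi; case: asboolP => // /tubeE[h _].
by have := HL z i (ltW h); rewrite leNgt Lz.
Qed.

Lemma chi_ge0 e z : 0 <= chi e z.
Proof. by rewrite /chi; case: ifP. Qed.

Lemma chi_dil e c z : normc c = 1 -> chi e (dil zeta c z) = chi e z.
Proof.
move=> c1; rewrite /chi; congr (if _ then _ else _).
by apply: asbool_equiv_eq; exact: tube_dil.
Qed.

(** * Existence of the boundary integral *)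

(** The limit is the lower limit, the supremum over [e0] of the infimum of [a] on ]0, e0[. Almost
    monotonicity keeps [a] near 0 below any value taken close to such an infimum, up to [eta]. *)
Lemma almost_mono_cvg (a : R -> R) : (forall e, 0 < e -> 0 <= a e) ->
  (forall eta : R, 0 < eta -> exists2 e0 : R, 0 < e0 &
     forall e lam, 0 < e -> e < e0 -> 0 < lam -> lam <= 1 -> a (lam * e) <= a e + eta) ->
  exists l : R, a e @[e --> 0^'+] --> l.
Proof.
move=> a0 Ha.
have {}Ha (eta : R) : 0 < eta -> exists2 e0 : R, 0 < e0 &
     forall e e', 0 < e' -> e' <= e -> e < e0 -> a e' <= a e + eta.
  move=> eta0; have [e0 e00 H] := Ha eta eta0; exists e0 => // e e' e'0 e'e ee0.
  have e_0 : 0 < e by exact: lt_le_trans e'e.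
  have := H e (e' / e) e_0 ee0; rewrite divfK ?lt0r_neq0//; apply; first by rewrite divr_gt0.
  by rewrite ler_pdivrMr// mul1r.
pose S e0 := [set a e | e in [set e | 0 < e < e0]].
have Sne e0 : 0 < e0 -> S e0 !=set0.
  by move=> h; exists (a (e0 / 2)); exists (e0 / 2) => //=; apply/andP; split; lra.
have Slb e0 : has_lbound (S e0) by exists 0 => _ [e /= /andP[h _] <-]; exact: a0.
pose M := [set inf (S e0) | e0 in [set e0 : R | 0 < e0]].
have Mne : M !=set0 by exists (inf (S 1)); exists 1 => //=.
have Mub : has_ubound M.
  have [e1 e10 H1] := Ha 1 ltr01; exists (a (e1 / 2) + 1) => _ [e0 /= e00 <-].
  pose e := Num.min (e0 / 2) (e1 / 2).
  have h1 : e <= e0 / 2 by rewrite /e ge_min lexx.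
  have h2 : e <= e1 / 2 by rewrite /e ge_min lexx orbT.
  have h3 : 0 < e by rewrite /e lt_min !divr_gt0.
  apply: le_trans (_ : a e <= _); last by apply: H1 => //; lra.
  apply: ge_inf => //; exists e => //=; apply/andP; split => //; lra.
exists (sup M); apply/cvgrPdist_lt => eta eta0.
have eta2 : 0 < eta / 3 by rewrite divr_gt0.
have [e0 e00 H0] := Ha _ eta2.
have [_ [e1 /andP[e10 e11] <-] He1] : exists2 x, S e0 x & x < inf (S e0) + eta / 3.
  by apply: inf_lt; [exact: Sne|rewrite ltrDl].
have [_ [e2 /= e20 <-] He2] : exists2 x, M x & sup M - eta / 3 < x.
  by apply: sup_gt => //; rewrite gtrBl.
have infM : inf (S e0) <= sup M by apply: ub_le_sup => //; exists e0.
near=> e.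
have ep : 0 < e by near: e; exact: nbhs_right_gt.
have le1 : e < e1 by near: e; exact: nbhs_right_lt.
have le2 : e < e2 by near: e; exact: nbhs_right_lt.
have h1 := H0 e1 e ep (ltW le1) e11.
have h2 : inf (S e2) <= a e by apply: ge_inf => //; exists e => //=; rewrite ep.
rewrite ltr_norml; apply/andP; split; lra.
Unshelve. all: by end_near. Qed.

Section LimitNonneg.
(* B e below averages the integrand over the dilations s in ]1, 3[ with the weight
   wt; the factor s^(2n) cancels the Jacobian. *)
Let wt (s : R) : R := Num.max 0 ((s - 1) * (3 - s)) * s ^+ (n + n).

Let cwt : continuous wt.
Proof.
have cid : continuous (@id R) by move=> ?; exact: cvg_id.
have cp (k : nat) : continuous (fun s : R => s ^+ k) by move=> s; apply: exprn_continuous.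
apply: continuousRM; last exact: cp.
apply: continuous_maxr; first exact: continuousRcst.
exact: (continuousRM (continuousRB cid (@continuousRcst _ _ _)) (continuousRB (@continuousRcst _ _ _) cid)).
Qed.

Let wt0 s : ~~ (1 < s < 3) -> wt s = 0.
Proof.
move=> H; rewrite /wt max_l ?mul0r//.
move: H; rewrite negb_and -!leNgt => /orP[h|h]; last by rewrite mulr_ge0_le0; lra.
by rewrite mulr_le0_ge0; lra.
Qed.

Let wt_ge0 s : 0 <= wt s.
Proof. by rewrite /wt mulr_ge0// ?le_max ?lexx// exprn_even_ge0// addnn odd_double. Qed.

Let wt_bounded : exists M, forall s, `|wt s| <= M.
Proof.
have cK : compact (wt @` `[1, 3]).
  by apply: continuous_compact; [exact: continuous_subspaceT|exact: segment_compact].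
move/compact_bounded : cK => [M [_ HM]]; exists (Num.max 0 (M + 1)) => s.
have [h|/wt0->] := boolP (1 < s < 3); last by rewrite normr0 le_max lexx.
rewrite le_max; apply/orP; right; apply: HM; first by rewrite ltrDl.
by exists s => //; rewrite /= in_itv /=; case/andP: h => /ltW -> /ltW ->.
Qed.

Let c0 : R := itg 1 3 (fun s => (s - 1) * (3 - s)).

Let c0_gt0 : 0 < c0.
Proof.
have dF (x : R) : is_derive x (1 : R) (fun s : R => - (s ^+ 3 / 3) + 2 * s ^+ 2 - 3 * s) ((x - 1) * (3 - x)).
  by apply: is_derive_eq; rewrite /GRing.scale /=; field.
have cid : continuous (@id R) by move=> ?; exact: cvg_id.
have ca : continuous (fun s : R => (s - 1) * (3 - s)).
  exact: (continuousRM (continuousRB cid (@continuousRcst _ _ _)) (continuousRB (@continuousRcst _ _ _) cid)).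
rewrite /c0 (itg_FTC _ ca dF) ?ler1n//.
by rewrite (_ : _ - _ = 4 / 3) ?divr_gt0//; field.
Qed.

Variable f : Cn R n -> R.
Hypothesis cf : continuous f.
Hypothesis f0 : forall z, 0 <= f z.

Let G (s : R) z := wt s * f (dil zeta (creal s) z).
Let H e (s : R) z := chi e (dil zeta (creal s) z).

Let cdil : continuous (fun p : R * Cn R n => dil zeta (creal p.1) p.2).
Proof.
apply: continuous_dil; last exact: continuous_snd.
apply: continuous_creal_comp; exact: continuous_fst.
Qed.

Let cG : continuous (fun p : R * Cn R n => G p.1 p.2).
Proof.
apply: continuousRM => p.
  apply: (@continuous_comp _ _ _ (@fst R (Cn R n)) wt); [exact: continuous_fst|exact: cwt].
apply: (@continuous_comp _ _ _ (fun p : R * Cn R n => dil zeta (creal p.1) p.2) f); [exact: cdil|exact: cf].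
Qed.

Let G_ge0 s z : 0 <= G s z.
Proof. by rewrite mulr_ge0. Qed.

Let Nf1 s z e : 1 <= s -> H e s z != 0 -> Nf z < sd.
Proof.
move=> s1; rewrite /H /chi; case: asboolP; last by rewrite eqxx.
move=> /tubeE[+ _] _; rewrite Nf_dil normc_creal ger0_norm ?(le_trans ler01)//.
by apply: le_lt_trans; rewrite ler_peMl// Nf_ge0.
Qed.

Let bHG e : baire1 (fun p : R * Cn R n => H e p.1 p.2 * G p.1 p.2).
Proof.
have [bcf _] := adm_mul (chi_adm e) cf.
have [M HM] := wt_bounded.
have h1 : baire1 (fun p : R * Cn R n => wt p.1).
  apply: (@baire1_cont _ _ _ M) => // p.
  by apply: (@continuous_comp _ _ _ (@fst R (Cn R n)) wt); [exact: continuous_fst|exact: cwt].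
have := baire1M h1 (baire1_comp cdil bcf); congr baire1; apply/funext => p.
by rewrite /H /G /= mulrCA.
Qed.

Let box_all : exists L, forall e s, boxed L (fun z => H e s z * G s z).
Proof.
have [L L0 HL] := ellipsoid_box; exists L => e s z i Lz.
have [/andP[s1 s3]|s13] := boolP (1 < s < 3); last by rewrite /G wt0// mul0r mulr0.
have [->|h] := eqVneq (H e s z) 0; first by rewrite mul0r.
by have := HL z i (ltW (Nf1 (ltW s1) h)); rewrite leNgt Lz.
Qed.

Let B e z := itg 1 3 (fun s => H e s z * G s z).

(** Fubini takes the volume integral inside; at each [s] the dilation contributes s^(-2n), which the
    power in [wt] cancels, and the remaining weight integrates to [c0]. *)
Let B_adm e : adm (B e) /\ V (B e) = c0 * V (fun z => chi e z * f z).
Proof.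
have [L HL] := box_all.
have [h1 h2] := V_itg 1 3 (bHG e) (ex_intro _ L (HL e)); split => //.
rewrite h2 mulrC /c0 -itgZ; last first.
  have cid : continuous (@id R) by move=> ?; exact: cvg_id.
  apply: itgb_cont.
  exact: (continuousRM (continuousRB cid (@continuousRcst _ _ _)) (continuousRB (@continuousRcst _ _ _) cid)).
apply: itg_eq => s /andP[s1 s3].
have sp : 0 < s by lra.
have s0 : creal s != 0 :> Cx R by apply/eqP => -[h]; move: sp; rewrite h ltxx.
have E : (fun z => H e s z * G s z) = (fun z => wt s * ((fun z => chi e z * f z) \o dil zeta (creal s)) z).
  by apply/funext => z; rewrite /H /G /= mulrCA.
have ac := adm_mul (chi_adm e) cf.
have ac' : adm ((fun z => chi e z * f z) \o dil zeta (creal s)).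
  split; first by apply: baire1_comp ac.1; apply: continuous_dil; [exact: continuousCcst|exact: continuous_rowid].
  have [L' L'0 HL'] := ellipsoid_box; exists L' => z i Lz /=.
  have [h|h] := eqVneq (chi e (dil zeta (creal s) z)) 0; first by rewrite h mul0r.
  by have := HL' z i (ltW (Nf1 s1 h)); rewrite leNgt Lz.
rewrite E VZ// (V_dil zeta s0 ac) normc_creal (gtr0_norm sp) /wt max_r; last by rewrite mulr_ge0; lra.
rewrite [RHS]mulrC -mulrA; congr (_ * _).
by rewrite mulrA -exprM mul2n addnn divff ?mul1r// expf_neq0// lt0r_neq0.
Qed.

(** Uniform continuity over a compact set of parameters. The range up to 6 is that of the boundary
    parameters [sg] in [B_mono]: a ray meeting the integrand does so at some s1 < 3 with sg - s1 <=
    sg / 2. *)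
Let unif (eta : R) : 0 < eta -> exists2 dl : R, 0 < dl & forall s t z, 0 <= s <= 6 -> Nf z <= sd ->
  `|s - t| < dl -> `|G s z - G t z| <= eta.
Proof.
move=> eta0.
have [L L0 HL] := ellipsoid_box.
pose K := (`[0, 6]%classic : set R) `*` [set z : Cn R n | forall i, `|complex.Re (z 0 i)| <= L /\ `|complex.Im (z 0 i)| <= L].
have cK : compact K by apply: compact_setX; [exact: segment_compact|exact: box_compact].
pose g (p : R * (R * Cn R n)) := G (p.1 + p.2.1) p.2.2.
have cg : continuous g.
  move=> p; apply: (@continuous_comp _ _ _ (fun p : R * (R * Cn R n) => (p.1 + p.2.1, p.2.2)) (fun q => G q.1 q.2)).
    apply: continuous_pair; last by apply: continuous_snd_comp; exact: continuous_snd.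
    apply: continuousRD; first exact: continuous_fst.
    by apply: continuous_fst_comp; exact: continuous_snd.
  exact: cG.
have [dl /= dl0 Hdl] := near_compact_continuous 0 cg cK eta0.
exists dl => // s t z s6 Nz st.
have Kz : K (s, z).
  split; first by rewrite /= in_itv.
  by move=> i; split; apply: le_trans (HL z i Nz); [exact: Re_le_normc|exact: Im_le_normc].
have hb : ball_ [eta Num.Def.normr] 0 dl (t - s) by rewrite /= sub0r normrN distrC.
by have := Hdl (t - s) hb (s, z) Kz; rewrite /g /= add0r subrK; exact: ltW.
Qed.

Let chi01 e z : chi e z = 0 \/ chi e z = 1.
Proof. by rewrite /chi; case: ifP; [right|left]. Qed.

Let chi1 e z : chi e z = 1 -> T e z.
Proof. by rewrite /chi; case: asboolP => // _ /eqP; rewrite eq_sym oner_eq0. Qed.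

Let chiT e z : T e z -> chi e z = 1.
Proof. by rewrite /chi; case: asboolP. Qed.

(* Rescaling the ray of z about sg, the dilation taking z to the boundary, compares
   the tubes of width lam e and e pointwise in z. *)
Let B_mono : exists2 C : R, 0 < C & forall eta : R, 0 < eta ->
  exists2 e0 : R, 0 < e0 & forall e lam z, 0 < e -> e < e0 -> 0 < lam -> lam <= 1 ->
   lam^-1 * B (lam * e) z <= B e z + eta * C * e * (if 0 < sd - Nf z then 1 else 0).
Proof.
have [C C0 HC] := tube_near; have [K K0 HK] := Nf_edist.
(* The error is [eta] times the length [2 * C * e * sg] of the support of [J], and [sg <= 6]. *)
exists (12 * C); first by rewrite mulr_gt0.
move=> eta eta0.
have [dl dl0 Hdl] := unif eta0.
(* The first bound keeps the tube away from the centre, so that [Nf z] is positive; the second gives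
   [C * e <= 1 / 2]; the third makes parameter shifts of size at most [6 * C * e] smaller than
   [dl]. *)
exists (Num.min (sd / K) (Num.min ((2 * C)^-1) (dl / (7 * C)))).
  by rewrite !lt_min !divr_gt0 ?invr_gt0 ?mulr_gt0.
move=> e lam z e0; rewrite !lt_min => /andP[eK /andP[eC edl]] l0 l1.
have B0 e' : (forall s, 1 < s -> s < 3 -> H e' s z = 0) -> B e' z = 0.
  move=> H0; rewrite /B (@itg_eq _ _ _ _ (fun=> 0)) ?itg0// => s _.
  have [/andP[s1 s3]|s13] := boolP (1 < s < 3); last by rewrite /G wt0// mul0r mulr0.
  by rewrite H0// mul0r.
have Bge0 e' : 0 <= B e' z.
  rewrite /B -(itg0 1 3); apply: itg_le; first exact: itgb_cst.
    have := bHG e'; move/(baire1_comp (@pair_continuousl R (Cn R n) z)); exact: baire1_itgb.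
  by move=> s _; rewrite mulr_ge0// chi_ge0.
have rhs0 : 0 <= eta * (12 * C) * e * (if 0 < sd - Nf z then 1 else 0).
  by case: ifP => _; rewrite ?mulr0// mulr1 !mulr_ge0// ltW.
have [h0|hne] := pselect (forall s, 1 < s -> s < 3 -> H (lam * e) s z = 0).
  by rewrite (B0 _ h0) mulr0 addr_ge0.
have {hne} [s1 [s11 s13 Hs1]] : exists s1, [/\ 1 < s1, s1 < 3 & H (lam * e) s1 z = 1].
  apply: contrapT => hne'; apply: hne => s h1 h3.
  by case: (chi01 (lam * e) (dil zeta (creal s) z)) => // h; exfalso; apply: hne'; exists s.
have s10 : 0 <= s1 by lra.
have Nzd : Nf z < sd by apply: (@Nf1 s1 z (lam * e)); [exact: ltW|rewrite Hs1 oner_neq0].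
have lee : lam * e <= e by rewrite ler_piMl// ltW.
have Nz0 : 0 < Nf z.
  rewrite lt_def Nf_ge0 andbT; apply/eqP => Nz0.
  have /tubeE[_ [w Nw dw]] := chi1 Hs1.
  have := HK w (dil zeta (creal s1) z); rewrite Nw Nf_dil Nz0 mulr0 add0r edistC => h.
  have : K * edist (dil zeta (creal s1) z) w < sd.
    rewrite mulrC -ltr_pdivlMr//; apply: lt_trans eK; exact: lt_le_trans dw lee.
  by rewrite ltNge h.
rewrite subr_gt0 Nzd mulr1.
pose sg := sd / Nf z.
have sgz : sg * Nf z = sd by rewrite divfK// lt0r_neq0.
have sg0 : 0 < sg by rewrite divr_gt0.
have Ce2 : C * e <= 1 / 2.
  have := ltW eC; rewrite -[leRHS]mul1r ler_pdivlMr ?mulr_gt0// => h.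
  by rewrite ler_pdivlMr//; lra.
have sg6 : sg <= 6.
  have [h1 h2] := HC _ _ _ _ sg0 sgz s10 (chi1 Hs1).
  have h3 : C * (lam * e) * sg <= 1 / 2 * sg.
    by rewrite ler_pM2r//; apply: le_trans Ce2; rewrite ler_pM2l.
  lra.
(* The map [lam * s + l] is the contraction of the ray parameter by [lam] that fixes [sg]. *)
pose l := sg - lam * sg.
(* Indicator of an interval ending at [sg], of twice the length given by [tube_near], so that the
   parameters that matter lie strictly inside. *)
pose J (s : R) : R := if 0 < (s - (sg - 2 * C * e * sg)) * (sg - s) then 1 else 0.
have bHe e' : baire1 (fun s => H e' s z * G s z).
  by have := bHG e'; move/(baire1_comp (@pair_continuousl R (Cn R n) z)).
have supp e' x : 3 < `|x| -> H e' x z * G x z = 0.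
  move=> x3; rewrite /G wt0 ?mul0r ?mulr0//; apply: contraL x3 => /andP[h1 h2].
  by rewrite -leNgt ger0_norm; lra.
have BE e' : B e' z = rint (fun s => H e' s z * G s z).
  symmetry; apply: rint_itg => x x13; rewrite /G wt0 ?mul0r ?mulr0//.
  by apply: contra x13 => /andP[/ltW -> /ltW ->].
have l0' : lam != 0 by exact: lt0r_neq0.
have := rint_affine l l0' (bHe (lam * e)) (supp (lam * e)).
rewrite (gtr0_norm l0) -BE => <-.
have bJ : baire1 J.
  apply: baire1_pos.
  have cid : continuous (@id R) by move=> ?; exact: cvg_id.
  exact: (continuousRM (continuousRB cid (@continuousRcst _ _ _)) (continuousRB (@continuousRcst _ _ _) cid)).
have bL := baire1_affine lam l (bHe (lam * e)).
have point s : H (lam * e) (lam * s + l) z * G (lam * s + l) z <= H e s z * G s z + eta * J s.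
  set t := lam * s + l.
  have tE : t = sg - lam * (sg - s) by rewrite /t /l; ring.
  have J0 : 0 <= J s by rewrite /J; case: ifP.
  have R0 : 0 <= H e s z * G s z + eta * J s.
    by rewrite addr_ge0// mulr_ge0// ?chi_ge0// ltW.
  have [Ht|Ht] : H (lam * e) t z = 0 \/ H (lam * e) t z = 1 := chi01 _ _; first by rewrite Ht mul0r.
  have [/andP[t1 t3]|t13] := boolP (1 < t < 3); last by rewrite {1}/G wt0// mul0r mulr0.
  have t0 : 0 <= t by lra.
  have [tsg h2] := HC _ _ _ _ sg0 sgz t0 (chi1 Ht).
  have h3 : sg - s <= C * e * sg.
    have : lam * (sg - s) <= lam * (C * e * sg).
      by apply: le_trans (_ : _ <= sg - t) _; [rewrite tE; lra|apply: le_trans h2 _; lra].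
    by rewrite ler_pM2l.
  have ssg : s < sg by have : 0 < lam * (sg - s) by [rewrite tE in tsg; lra]; rewrite pmulr_rgt0// subr_gt0.
  have Cesg : C * e * sg <= 1 / 2 * sg by rewrite ler_pM2r.
  have Cesg0 : 0 < C * e * sg := mulr_gt0 (mulr_gt0 C0 e0) sg0.
  have s0 : 0 <= s by lra.
  have Hs : H e s z = 1.
    apply: chiT; apply: (tube_ray l0 l1 sgz s0 ssg); rewrite -tE; exact: chi1.
  have Js : J s = 1.
    rewrite /J mulr_gt0//; [|by rewrite subr_gt0]; lra.
  rewrite Ht Hs Js !mul1r mulr1.
  have s6 : 0 <= s <= 6 by rewrite s0 /=; lra.
  have := Hdl s t z s6 (ltW Nzd).
  have st : `|s - t| < dl.
    have -> : s - t = - ((1 - lam) * (sg - s)) by rewrite tE; ring.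
    rewrite normrN ger0_norm; last by rewrite mulr_ge0 ?subr_ge0// ltW.
    have h5 : (1 - lam) * (sg - s) <= sg - s by rewrite ler_piMl ?gerBl ?subr_ge0// ltW.
    have h6 : C * e * sg <= C * e * 6 by rewrite ler_pM2l// mulr_gt0.
    have h7 : e * (7 * C) < dl by rewrite -ltr_pdivlMr// mulr_gt0.
    have : 0 < C * e by rewrite mulr_gt0.
    by move=> h8; lra.
  by move=> /(_ st); rewrite ler_norml => /andP[h4 _]; lra.
(* Large enough for the integrand, its affine substitute and [J] to vanish outside [[- M, M]]. *)
pose M := (3 + `|l|) / lam + 3 + sg.
have Ml : 0 <= (3 + `|l|) / lam by rewrite divr_ge0// ?addr_ge0// ltW.
have outM (F : R -> R) : (forall x, M < `|x| -> F x = 0) -> rint F = itg (- M) M F.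
  by move=> h; apply: rint_itg => x; rewrite -ler_norml -ltNge; exact: h.
rewrite outM; last first.
  move=> x Mx; apply: supp.
  have h1 : 3 + `|l| < lam * `|x|.
    rewrite -ltr_pdivrMl// mulrC; apply: le_lt_trans Mx; rewrite /M; lra.
  have h2 : lam * `|x| - `|l| <= `|lam * x + l|.
    have := ler_normB (lam * x + l) l; rewrite addrK normrM (gtr0_norm l0); lra.
  lra.
have h6 : B e z = itg (- M) M (fun s => H e s z * G s z).
  by rewrite BE; apply: outM => x Mx; apply: supp; apply: le_lt_trans Mx; rewrite /M; lra.
have Cesg0 : 0 < C * e * sg := mulr_gt0 (mulr_gt0 C0 e0) sg0.
have Cesg : 2 * C * e * sg <= sg.
  by have : C * e * sg <= 1 / 2 * sg by [rewrite ler_pM2r]; lra.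
have Jout x : ~~ (sg - 2 * C * e * sg <= x <= sg) -> J x = 0.
  rewrite negb_and -!ltNge /J => h; rewrite ifF//; apply/negbTE; rewrite -leNgt.
  have D0 : 0 <= 2 * C * e * sg := mulr_ge0 (mulr_ge0 (mulr_ge0 (ler0n R 2) (ltW C0)) (ltW e0)) (ltW sg0).
  exact: mul_outside_le0 D0 h.
have h7 : itg (- M) M J = itg (sg - 2 * C * e * sg) sg J.
  rewrite -(rint_itg Jout); symmetry; apply: outM => x Mx; apply: Jout.
  apply: contraL Mx => /andP[h1 h2]; rewrite -leNgt ler_norml /M; apply/andP; split; lra.
have h8 : itg (sg - 2 * C * e * sg) sg J <= 2 * C * e * sg.
  have h9 : sg - 2 * C * e * sg <= sg by lra.
  have := itg_le (baire1_itgb (sg - 2 * C * e * sg) sg bJ) (itgb_cst (sg - 2 * C * e * sg) sg 1).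
  rewrite itg_cst// => h; apply: le_trans (h _) _; last by lra.
  by move=> x _; rewrite /J; case: ifP.
have bJi := baire1_itgb (- M) M bJ.
have bHi := baire1_itgb (- M) M (bHe e).
apply: le_trans (itg_le (baire1_itgb (- M) M bL) (baire1_itgb (- M) M (baire1D (bHe e) (baire1Z eta bJ))) _) _.
  by move=> x _; exact: point.
rewrite itgD//; last exact: (baire1_itgb _ _ (baire1Z eta bJ)).
rewrite itgZ// -h6 lerD2l h7 -[leRHS]mulrA ler_pM2l//; apply: le_trans h8 _.
have : C * e * sg <= C * e * 6 by rewrite ler_pM2l// mulr_gt0.
by lra.
Qed.

Let box1 (z : Cn R n) : R := if 0 < sd - Nf z then 1 else 0.

Let box1_adm : adm box1.
Proof.
split; first by apply: baire1_pos; exact: (continuousRB (@continuousRcst R _ sd) continuous_Nf).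
have [L L0 HL] := ellipsoid_box; exists L => z i Lz; rewrite /box1; case: ifPn => //.
by rewrite subr_gt0 => h; have := HL z i (ltW h); rewrite leNgt Lz.
Qed.

(** Integrating the pointwise comparison [B_mono] over [z] gives the almost monotonicity required by
    [almost_mono_cvg]. *)
Lemma tube_limit_nonneg : exists l : R, e^-1 * V (fun z => chi e z * f z) @[e --> 0^'+] --> l.
Proof.
have ac e := adm_mul (chi_adm e) cf.
have ax := @adm0 R n.
apply: almost_mono_cvg => [e e0|eta eta0].
  apply: mulr_ge0; first by rewrite invr_ge0 ltW.
  rewrite -(V0 R n); apply: V_le => // z; by rewrite mulr_ge0// chi_ge0.
have V1 : 0 <= V box1.
  by rewrite -(V0 R n); apply: V_le => // z; rewrite /box1; case: ifP.
pose D := V box1 + 1.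
have D0 : 0 < D by rewrite /D; lra.
have [C C0 HC] := B_mono.
(* Normalised so that, after division by [c0 * e], the error is [eta * V box1 / D], at most
   [eta]. *)
have h0 : 0 < c0 * eta / (C * D) by rewrite divr_gt0 ?mulr_gt0.
have [e0 e00 H0] := HC _ h0; exists e0 => // e lam e_0 ee0 l0 l1.
have bA e' := (B_adm e').1.
have bV e' := (B_adm e').2.
have := V_le (admZ lam^-1 (bA (lam * e))) (admD (bA e) (admZ (c0 * eta / (C * D) * C * e) box1_adm))
  (fun z => H0 e lam z e_0 ee0 l0 l1).
rewrite VZ// VD//; last exact: admZ.
rewrite VZ// !bV => h.
have cn0 : c0 != 0 by exact: lt0r_neq0.
have e_0' : e != 0 by exact: lt0r_neq0.
have l0' : lam != 0 by exact: lt0r_neq0.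
have C0' : C != 0 by exact: lt0r_neq0.
have D0' : D != 0 by exact: lt0r_neq0.
have ce : 0 < (c0 * e)^-1 by rewrite invr_gt0 mulr_gt0.
have := ler_wpM2l (ltW ce) h.
have alg (x y v c E l k dd : R) : c != 0 -> E != 0 -> l != 0 -> k != 0 -> dd != 0 ->
    ((c * E)^-1 * (l^-1 * (c * x)) = (l * E)^-1 * x) *
    ((c * E)^-1 * (c * y + c * eta / (k * dd) * k * E * v) = E^-1 * y + eta * v / dd).
  by move=> *; split; field; rewrite ?mulf_neq0//; do ?(apply/andP; split).
rewrite !(alg _ (V (fun z => chi e z * f z)) (V box1) c0 e lam C D)// => h1.
apply: le_trans h1 _; rewrite lerD2l ler_pdivrMr// ler_pM2l// /D; lra.
Qed.

End LimitNonneg.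

(** The case f = 1 of [tube_limit_nonneg]: tubes have volume O(e), so the averages of a bounded
    function stay bounded as the width tends to 0. *)
Lemma chi_bound : exists2 K : R, 0 <= K & \forall e \near 0^'+, e^-1 * V (chi e) <= K.
Proof.
have [l Hl] := tube_limit_nonneg (@continuousRcst R _ (1 : R)) (fun=> ler01).
exists (`|l| + 1); first by rewrite addr_ge0.
near=> e.
have : `|l - e^-1 * V (fun z => chi e z * 1)| < 1.
  by near: e; move/cvgrPdist_lt : Hl; apply.
rewrite (_ : (fun z => chi e z * 1) = chi e); last by apply/funext => z; rewrite mulr1.
rewrite ltr_norml => /andP[h1 h2]; have := ler_norm l; lra.
Unshelve. all: by end_near. Qed.

Lemma tube_limit (f : Cn R n -> R) : continuous f ->
  exists l : R, e^-1 * V (fun z => chi e z * f z) @[e --> 0^'+] --> l.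
Proof.
move=> cf.
have cm : continuous (fun z => 0 - f z) by exact: (continuousRB (@continuousRcst R _ 0) cf).
have c1 := continuous_maxr (@continuousRcst R _ (0 : R)) cf.
have c2 := continuous_maxr (@continuousRcst R _ (0 : R)) cm.
have p1 z : 0 <= Num.max 0 (f z) by rewrite le_max lexx.
have p2 z : 0 <= Num.max 0 (0 - f z) by rewrite le_max lexx.
have [l1 H1] := tube_limit_nonneg c1 p1.
have [l2 H2] := tube_limit_nonneg c2 p2.
exists (l1 + l2 * (-1)).
rewrite (_ : (fun e => _) = (fun e => e^-1 * V (fun z => chi e z * Num.max 0 (f z)) +
    e^-1 * V (fun z => chi e z * Num.max 0 (0 - f z)) * (-1))).
  exact: (cvgD H1 (cvgMr_tmp (b := -1) H2)).
apply/funext => e.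
have a1 := adm_mul (chi_adm e) c1; have a2 := adm_mul (chi_adm e) c2.
rewrite -mulrA -mulrDr; congr (_ * _); rewrite mulrC -VZ// -VD//; last exact: admZ.
congr V; apply/funext => z; rewrite sub0r.
case: (leP 0 (f z)) => h.
  by rewrite max_l ?oppr_le0//; ring.
by rewrite max_r ?oppr_ge0 1?ltW//; ring.
Qed.

Definition Lam e (F : Cn R n -> Cx R) : Cx R :=
  creal e^-1 * vol_int (fun z => creal (chi e z) * F z).

Lemma bdry_integralE (g : Cn R n -> Cx R) L :
  bdry_integral_is (ellipsoid A zeta d) g L <-> Lam e g @[e --> 0^'+] --> L.
Proof.
rewrite /bdry_integral_is /Lam.
suff -> : (fun e : R => creal e^-1 * vol_int (fun z => if `[< T e z >] then g z else 0)) =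
  fun e => creal e^-1 * vol_int (fun z => creal (chi e z) * g z) by [].
apply/funext => e; congr (_ * vol_int _); apply/funext => z.
by rewrite /chi; case: asboolP => _; rewrite /creal ?rmorph1 ?rmorph0 ?mul1r ?mul0r.
Qed.

(** * Linearity, bounds, rotation invariance and convergence of the tube averages *)

Section Lam.
Variables (F G : Cn R n -> Cx R) (e : R).
Hypotheses (cF : continuous F) (cG : continuous G).

Lemma LamD : Lam e (fun z => F z + G z) = Lam e F + Lam e G.
Proof.
rewrite /Lam -mulrDr -vol_intD; [|exact: (cadm_mul (chi_adm e) cF)|exact: (cadm_mul (chi_adm e) cG)].
by congr (_ * vol_int _); apply/funext => z; rewrite mulrDr.
Qed.

Lemma LamZ c : Lam e (fun z => c * F z) = c * Lam e F.
Proof.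
rewrite /Lam mulrCA -(vol_intZ c (cadm_mul (chi_adm e) cF)).
by congr (_ * vol_int _); apply/funext => z; rewrite mulrCA.
Qed.

Lemma LamB : Lam e (fun z => F z - G z) = Lam e F - Lam e G.
Proof.
rewrite /Lam -mulrBr -vol_intB; [|exact: (cadm_mul (chi_adm e) cF)|exact: (cadm_mul (chi_adm e) cG)].
by congr (_ * vol_int _); apply/funext => z; rewrite mulrBr.
Qed.

Lemma Lam_bound M : 0 < e -> (forall z, Nf z < sd -> normc (F z) <= M) ->
  normc (Lam e F) <= 2 * M * (e^-1 * V (chi e)).
Proof.
move=> e0 HM; rewrite /Lam normcM normc_creal gtr0_norm ?invr_gt0//.
have := vol_int_bound (cadm_mul (chi_adm e) cF) (admZ M (chi_adm e)).
rewrite VZ; last exact: chi_adm.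
have -> : 2 * M * (e^-1 * V (chi e)) = e^-1 * (2 * (M * V (chi e))) by ring.
rewrite ler_pM2l ?invr_gt0//; apply => z.
rewrite normcM normc_creal /chi; case: asboolP => [/tubeE[h _]|_].
  by rewrite normr1 mul1r mulr1 HM.
by rewrite normr0 mul0r mulr0.
Qed.

Lemma Lam_dil c : normc c = 1 -> Lam e (F \o dil zeta c) = Lam e F.
Proof.
move=> c1; rewrite /Lam; congr (_ * _).
have cn0 : c != 0 by apply/eqP => cn0; move: c1; rewrite cn0 normc0 => /eqP; rewrite eq_sym oner_eq0.
have := vol_int_dil zeta cn0 (cadm_mul (chi_adm e) cF); rewrite c1 expr1n expr1n invr1 /creal rmorph1 mul1r => <-.
by congr vol_int; apply/funext => z /=; rewrite chi_dil.
Qed.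

Lemma Lam_cvg : exists L : Cx R, Lam e F @[e --> 0^'+] --> L.
Proof.
have [a Ha] := tube_limit (continuous_Re_comp cF).
have [b Hb] := tube_limit (continuous_Im_comp cF).
exists (Complex a b).
rewrite (_ : (fun x => _) = fun x => Complex (x^-1 * V (fun z => chi x z * complex.Re (F z)))
  (x^-1 * V (fun z => chi x z * complex.Im (F z))) : Cx R); first exact: cvg_Complex.
apply/funext => x.
rewrite /Lam vol_intE; apply/eqP; rewrite eq_complex /=; apply/andP.
have E1 : (fun z => complex.Re (creal (chi x z) * F z)) = fun z => chi x z * complex.Re (F z).
  by apply/funext => z /=; case: (F z) => u v /=; ring.
have E2 : (fun z => complex.Im (creal (chi x z) * F z)) = fun z => chi x z * complex.Im (F z).
  by apply/funext => z /=; case: (F z) => u v /=; ring.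
by rewrite E1 E2; split; apply/eqP; ring.
Qed.

End Lam.

Lemma Lam_eq e (F G : Cn R n -> Cx R) : (forall z, Nf z < sd -> F z = G z) -> Lam e F = Lam e G.
Proof.
move=> H; rewrite /Lam; congr (_ * vol_int _); apply/funext => z.
by rewrite /chi; case: asboolP => [/tubeE[/H-> _]|_]//; rewrite /creal rmorph0 !mul0r.
Qed.

Lemma Lam_sum e (I : Type) (s : seq I) (P : pred I) (F : I -> Cn R n -> Cx R) :
  (forall i, continuous (F i)) ->
  Lam e (fun z => \sum_(i <- s | P i) F i z) = \sum_(i <- s | P i) Lam e (F i).
Proof.
move=> cF; rewrite /Lam -mulr_sumr.
have [_ <-] := cadm_sum s (P := P) (fun i _ => cadm_mul (chi_adm e) (cF i)).
by congr (_ * vol_int _); apply/funext => z; rewrite mulr_sumr.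
Qed.


(** * Orthogonality to holomorphic functions *)

(* Radial retraction on the closed ellipsoid, used to extend F continuously. *)
Definition clip z : Cn R n := dil zeta (creal (sd / Num.max sd (Nf z))) z.

Let clip_sc z : 0 <= sd / Num.max sd (Nf z).
Proof. by rewrite divr_ge0 ?le_max ?(ltW sd0). Qed.

Lemma Nf_clip z : Nf (clip z) <= sd.
Proof.
rewrite /clip Nf_dil normc_creal ger0_norm; last exact: clip_sc.
have m0 : 0 < Num.max sd (Nf z) by rewrite lt_max sd0.
by rewrite mulrAC ler_pdivrMr// ler_pM2l// le_max lexx orbT.
Qed.

Lemma clip_id z : Nf z <= sd -> clip z = z.
Proof.
move=> h; rewrite /clip max_l// divff ?lt0r_neq0//.
by rewrite /creal rmorph1 dil1.
Qed.

Lemma continuous_clip : continuous clip.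
Proof.
apply: continuous_dil; last exact: continuous_rowid.
apply: continuous_creal_comp; apply: continuousRM; first exact: (@continuousRcst R _ sd).
have cm := continuous_maxr (@continuousRcst R _ sd) continuous_Nf.
move=> z; apply: (@continuous_comp _ _ _ (fun z => Num.max sd (Nf z)) (fun x : R => x^-1)); first exact: cm.
by apply: inv_continuous; rewrite lt0r_neq0// lt_max sd0.
Qed.

Let near_clip (z : Cn R n) (S : set (Cn R n)) : nbhs (clip z) S -> nbhs z [set w | S (clip w)].
Proof. by move=> nS; have := @continuous_clip z; apply; exact: nS. Qed.

(** Continuity on the whole space is what the rules for [Lam] ask for. The retraction is the
    identity inside, and differentiability in each variable involves only points close enough to
    stay in the open ellipsoid. *)
Lemma holo_extend (F : Cn R n -> Cx R) : holo_cont (ellipsoid A zeta d) F ->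
  [/\ continuous (F \o clip), forall z, Nf z <= sd -> (F \o clip) z = F z &
   forall z, Nf z < sd -> forall i : 'I_n, cderiv (fun c => (F \o clip) (upd z i c)) (z 0 i)].
Proof.
move=> [cF dF]; split.
- move=> z; move/subspace_continuousP : cF => cF.
  have cz : closure (ellipsoid A zeta d) (clip z) by apply/closure_ellipsoid; exact: Nf_clip.
  move=> B /(cF _ cz) hB.
  have h2 : nbhs (clip z) [set w | closure (ellipsoid A zeta d) w -> B (F w)] by exact: hB.
  have h3 := near_clip h2.
  apply: (filterS _ h3) => w /=; apply.
  by apply/closure_ellipsoid; exact: Nf_clip.
- by move=> z h /=; rewrite clip_id.
move=> z zd i.
have [D HD] := derivable_cderiv (dF z ((ellipsoidE z).2 zd) i).
exists D => e e0; have [dl dl0 Hdl] := HD e e0.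
have E (w : Cx R) : upd z i w = z + (w - z 0 i) *: delta_mx 0 i.
  apply/rowP => k; rewrite !mxE eqxx /=; have [->|ki] := eqVneq k i; first by rewrite eqxx mulr1 addrC subrK.
  by rewrite -val_eqE in ki; rewrite (negbTE ki) mulr0 addr0.
have : nbhs (z 0 i) [set w | Nf (upd z i w) < sd].
  have cu : continuous (fun w : Cx R => Nf (upd z i w)).
    move=> w; apply: (@continuous_comp _ _ _ (fun w : Cx R => upd z i w) Nf); last exact: continuous_Nf.
    apply: continuous_upd; first exact: continuous_rowcst.
    by move=> ?; exact: cvg_id.
  apply: (open_nbhs_nbhs (A := [set w | Nf (upd z i w) < sd])); split; last by rewrite /= upd_id.
  by apply: (@open_comp _ _ (fun w : Cx R => Nf (upd z i w)) [set x | x < sd]) => [w _|]; [exact: cu|exact: open_lt].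
move=> /nbhs_normc[dl' dl'0 Hdl'].
exists (Num.min dl dl'); first by rewrite lt_min dl0.
move=> w; rewrite lt_min => /andP[w1 w2] /=.
have Ez : upd z i (z 0 i) = z by rewrite upd_id.
rewrite Ez (clip_id (ltW zd)) clip_id; last by apply: ltW; exact: Hdl'.
have := Hdl (w - z 0 i); rewrite subr0 => /(_ w1).
by rewrite E scale0r addr0.
Qed.

Section Holo.
Variable F : Cn R n -> Cx R.
Hypothesis cF : continuous F.
Hypothesis dF : forall z, Nf z < sd -> forall i : 'I_n, cderiv (fun c => F (upd z i c)) (z 0 i).

Lemma F_bounded (f : Cn R n -> Cx R) : continuous f -> exists2 B : R, 0 <= B & forall z, Nf z <= sd -> normc (f z) <= B.
Proof.
move=> cf; have [L L0 HL] := ellipsoid_box.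
have [M1 H1] := @box_bounded R n L _ (continuous_Re_comp cf).
have [M2 H2] := @box_bounded R n L _ (continuous_Im_comp cf).
exists (`|M1| + `|M2|); first by rewrite addr_ge0.
move=> z Nz; have Lz i : normc (z 0 i) <= L by exact: HL.
apply: le_trans (normc_le_ReIm _) _; apply: lerD.
  by apply: le_trans (H1 z Lz) _; exact: ler_norm.
by apply: le_trans (H2 z Lz) _; exact: ler_norm.
Qed.

Lemma poly_approx z0 M : Nf z0 < sd -> exists2 r : R, 0 < r & exists2 C, 0 <= C &
  exists L : seq ({ffun 'I_n -> nat} * Cx R), forall z, (forall i, normc (z 0 i - z0 0 i) <= r) ->
    normc (F z - \sum_(p <- L) p.2 * mono p.1 (z - z0)) <= C * \sum_i normc (z 0 i - z0 0 i) ^+ M.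
Proof.
move=> z0d; have [K K0 HK] := nfm_le_coord A_sym A_pd.
pose r := (sd - Nf z0) / (2 * K).
have r0 : 0 < r by rewrite divr_gt0 ?subr_gt0 ?mulr_gt0.
have Pd z : (forall i, normc (z 0 i - z0 0 i) <= r) -> Nf z < sd.
  move=> Pz; rewrite /Nf -(subrKA z0) addrC.
  apply: le_lt_trans (nfmD A_sym A_pd _ _) _.
  have : nfm A (z - z0) <= K * r by apply: HK; [exact: ltW|move=> i; rewrite !mxE; exact: Pz].
  have -> : K * r = (sd - Nf z0) / 2 by rewrite /r; field; exact: lt0r_neq0.
  by rewrite -[nfm A (z0 - zeta)]/(Nf z0); lra.
have [B B0 HB] := F_bounded cF.
exists r => //; have [C C0 [L HL]] := @multi_taylor R n z0 r M r0 F B cF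
  (fun z Pz => HB z (ltW (Pd z Pz))) (fun z Pz => dF (Pd z Pz)).
by exists C => //; exists L.
Qed.

Lemma mono_scale (g : {ffun 'I_n -> nat}) (c : Cx R) (v : Cn R n) :
  mono g (c *: v) = c ^+ (\sum_i g i)%N * mono g v.
Proof.
rewrite /mono -prodrXr -big_split /=; apply: eq_bigr => i _.
by rewrite mxE exprMn.
Qed.

(** Separate differentiability gives differentiability along a complex line: the Taylor polynomial
    of order 2 in all the variables restricts to a polynomial in [h], with error O(|h|^2). *)
Lemma slice_cderiv z c : Nf (dil zeta c z) < sd -> cderiv (fun c => F (dil zeta c z)) c.
Proof.
move=> cz; have [r r0 [C C0 [L HL]]] := poly_approx 2 cz.
pose w := z - zeta.
have E h : dil zeta (c + h) z - dil zeta c z = h *: w.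
  by apply/rowP => i; rewrite !mxE; ring.
have Ei h i : dil zeta (c + h) z 0 i - dil zeta c z 0 i = h * w 0 i.
  by have := congr1 (fun v : Cn R n => v 0 i) (E h); rewrite !mxE.
pose S := \sum_i normc (w 0 i).
have S0 : 0 <= S by apply: sumr_ge0 => i _; exact: nc_ge0.
have Sw i : normc (w 0 i) <= S by rewrite /S (bigD1 i)//= lerDl sumr_ge0// => j _; exact: nc_ge0.
pose nw (p : {ffun 'I_n -> nat} * Cx R) : nat * Cx R := ((\sum_i p.1 i)%N, p.2 * mono p.1 w).
have [D [K K0 HK]] := poly_small [seq nw p | p <- L].
apply: (@cderiv_small R _ c D (K + C * (\sum_i normc (w 0 i) ^+ 2)) (Num.min 1 (r / (S + 1)))).
  by rewrite lt_min ltr01 divr_gt0// ltr_wpDl.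
move=> h; rewrite le_min => /andP[h1 hr].
have HL' h' : normc h' <= r / (S + 1) -> normc (F (dil zeta (c + h') z) -
    \sum_(p <- [seq nw p | p <- L]) p.2 * h' ^+ p.1) <=
    normc h' ^+ 2 * (C * \sum_i normc (w 0 i) ^+ 2).
  move=> hr'; have Pz i : normc (dil zeta (c + h') z 0 i - dil zeta c z 0 i) <= r.
    rewrite Ei normcM; move: hr'; rewrite ler_pdivlMr ?ltr_wpDl// => hr'; apply: le_trans hr'.
    by rewrite ler_wpM2l ?nc_ge0// (le_trans (Sw i))// lerDl.
  have Es : \sum_i normc (dil zeta (c + h') z 0 i - dil zeta c z 0 i) ^+ 2 =
      normc h' ^+ 2 * \sum_i normc (w 0 i) ^+ 2.
    by rewrite mulr_sumr; apply: eq_bigr => i _; rewrite Ei normcM exprMn.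
  have := HL _ Pz; rewrite big_map mulrCA Es.
  congr (normc (_ - _) <= _); apply: eq_bigr => p _.
  by rewrite E mono_scale /= mulrCA mulrC.
have H0 : F (dil zeta c z) = \sum_(p <- [seq nw p | p <- L]) p.2 * 0 ^+ p.1.
  have := HL' 0; rewrite addr0 normc0 => H0; apply/eqP; rewrite -subr_eq0; apply/eqP/eq0_normc/eqP.
  rewrite eq_le nc_ge0 andbT; apply: le_trans (H0 _) _; first by rewrite divr_ge0 ?addr_ge0// ltW.
  by rewrite expr0n mul0r.
have h2 := HL' h hr; have h3 := HK h h1.
rewrite H0; set P1 := \sum_(p <- _) p.2 * h ^+ p.1 in h2 h3 *; set P0 := \sum_(p <- _) _ in h3 *.
have -> : F (dil zeta (c + h) z) - P0 - D * h = (F (dil zeta (c + h) z) - P1) + (P1 - P0 - D * h) by ring.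
apply: le_trans (ncD _ _) _; rewrite mulrDl addrC; apply: lerD => //.
by apply: le_trans h2 _; rewrite mulrC.
Qed.

Let Dil_cont (X : topologicalType) (c : X -> Cx R) (u : X -> Cn R n) : continuous c -> continuous u ->
  continuous (fun x => F (dil zeta (c x) (u x))).
Proof.
move=> cc cu x; apply: (@continuous_comp _ _ _ (fun x => dil zeta (c x) (u x)) F); last exact: cF.
exact: (@continuous_dil R n zeta X c u cc cu x).
Qed.

(** What differentiation under [Lam] requires: the derivative [m z] is a Cauchy integral, hence
    continuous in [z], and the Taylor remainder on a disc of radius (1 - |c|) / 2 has a constant
    independent of [z]. *)
Lemma slice_quotient (c : Cx R) : normc c < 1 -> exists m : Cn R n -> Cx R, continuous m /\
  exists2 r : R, 0 < r & exists2 K : R, 0 <= K & forall z h, Nf z < sd -> normc h <= r ->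
    normc (F (dil zeta (c + h) z) - F (dil zeta c z) - h * m z) <= K * normc h ^+ 2.
Proof.
move=> c1; pose r := (1 - normc c) / 2.
have r0 : 0 < r by rewrite divr_gt0// subr_gt0.
have [B B0 HB] := F_bounded cF.
pose f z (h : Cx R) := F (dil zeta (c + h) z).
have chc : continuous (fun h : Cx R => c + h).
  by apply: (continuousCD (@continuousCcst R _ c)) => ?; exact: cvg_id.
exists (fun z => (creal r)^-1 * mom (f z) r 1); split.
  apply: (continuousCM (@continuousCcst R _ _)); apply: (continuousCM (@continuousCcst R _ _)).
  apply: (@citg_cont_param R _ (fun p : Cn R n * R => f p.1 (creal r * ei p.2) * ei p.2 ^- 1)).
  have c2 : continuous (fun p : Cn R n * R => ei p.2).
    move=> p; apply: (@continuous_comp _ _ _ (fun p : Cn R n * R => p.2) (@ei R)); last exact: continuous_ei.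
    exact: continuous_snd.
  apply: continuousCM.
    apply: Dil_cont; last exact: continuous_fst.
    exact: (continuousCD (@continuousCcst R _ _) (continuousCM (@continuousCcst R _ _) c2)).
  by apply: (@continuousCV R _ (fun p : Cn R n * R => ei p.2 ^+ 1)) => [|p]; rewrite ?expr1 ?ei_neq0.
exists (r / 2); first by rewrite divr_gt0.
exists (4 * B / r ^+ 2).
  by apply: divr_ge0; [rewrite mulr_ge0|rewrite exprn_ge0// ltW].
move=> z h zd hr.
have Nd (w' : Cx R) : normc w' <= r -> Nf (dil zeta (c + w') z) < sd.
  move=> w'r; rewrite Nf_dil; apply: le_lt_trans zd; rewrite ler_piMl ?Nf_ge0//.
  by apply: le_trans (ncD _ _) _; move: w'r; rewrite /r; lra.
have cfz : continuous (f z) by apply: Dil_cont => //; exact: continuous_rowcst.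
have dfz (w' : Cx R) : normc w' <= r -> cderiv (f z) w'.
  move=> w'r; have [D HD] := slice_cderiv (Nd _ w'r); exists D => e e0.
  have [dl dl0 Hdl] := HD e e0; exists dl => // w2 w2d.
  have E : w2 - w' = (c + w2) - (c + w') by rewrite opprD addrACA subrr add0r.
  by rewrite E; apply: Hdl; rewrite -E.
have HBz t : normc (f z (creal r * ei t)) <= B.
  by apply/HB/ltW/Nd; rewrite normcM normc_creal normc_ei mulr1 gtr0_norm.
have rr : r / 2 < r by rewrite ltr_pdivrMr// ltr_pMr// ltr1n.
have n0 : normc (0 : Cx R) <= r / 2 by rewrite normc0 ltW// divr_gt0.
have T0 := taylor1 r0 cfz dfz (le_lt_trans n0 rr) 2 n0 HBz.
have T1 := taylor1 r0 cfz dfz (le_lt_trans hr rr) 2 hr HBz.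
have s2 (g : nat -> Cx R) : \sum_(l < 2) g l = g 0%N + g 1%N by rewrite !big_ord_recl big_ord0 addr0.
have f0 : f z 0 = mom (f z) r 0.
  have h0 : 4 * B * 0 ^+ 2 = 0 :> R by rewrite expr0n mulr0.
  rewrite (s2 (fun l => (0 / creal r) ^+ l * mom (f z) r l)) normc0 !mul0r expr0 mul1r addr0 h0 in T0.
  by apply/eqP; rewrite -subr_eq0; apply/eqP/eq0_normc/eqP; rewrite eq_le nc_ge0 andbT; exact: T0.
rewrite (s2 (fun l => (h / creal r) ^+ l * mom (f z) r l)) expr0 expr1 mul1r -f0 in T1.
move: T1; rewrite /f addr0.
have -> : 4 * B * (normc h / r) ^+ 2 = 4 * B / r ^+ 2 * normc h ^+ 2 by rewrite expr_div_n; ring.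
by rewrite opprD addrA [h * (_ * _)]mulrA.
Qed.

(** * The pairing with a contracted function and its homogeneity *)

Section Psi.
Variables (q : Cn R n -> Cx R) (m e : R).
Hypothesis cq : continuous q.
Hypothesis qw : forall t z, q (dil zeta (ei t) z) = ei (m * t) * q z.
Hypothesis e0 : 0 < e.

Let Psi c := Lam e (fun z => conjc (q z) * F (dil zeta c z)).

Let ccq : continuous (fun z => conjc (q z) : Cx R).
Proof. exact: (continuousC_comp cq (@continuous_conjc R)). Qed.

Let Kc := e^-1 * V (chi e).

Let Kc0 : 0 <= Kc.
Proof.
apply: mulr_ge0; first by rewrite invr_ge0 ltW.
rewrite -(V0 R n); apply: V_le; [exact: adm0|exact: chi_adm|move=> z; exact: chi_ge0].
Qed.

Let cFd c : continuous (fun z => F (dil zeta c z)).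
Proof. by apply: Dil_cont; [exact: (@continuousCcst R _ c)|exact: continuous_rowid]. Qed.

Let cI c : continuous (fun z => conjc (q z) * F (dil zeta c z) : Cx R).
Proof. exact: (continuousCM ccq (@cFd c)). Qed.

Lemma Psi_cderiv c : normc c < 1 -> cderiv Psi c.
Proof.
move=> c1; have [mf [cm [r r0 [K K0 HK]]]] := slice_quotient c1.
have [Bq Bq0 HBq] := F_bounded cq.
have cqm : continuous (fun z => conjc (q z) * mf z : Cx R) := continuousCM ccq cm.
apply: (@cderiv_small R Psi c (Lam e (fun z => conjc (q z) * mf z)) (2 * (Bq * K) * Kc) r) => // h hr.
have cZ : continuous (fun z => h * (conjc (q z) * mf z) : Cx R) := continuousCM (@continuousCcst R _ h) cqm.
rewrite /Psi -(LamB e (@cI (c + h)) (@cI c)) mulrC -(LamZ e cqm h) -(LamB e (continuousCB (@cI (c + h)) (@cI c)) cZ).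
have cT := continuousCB (continuousCB (@cI (c + h)) (@cI c)) cZ.
apply: le_trans (Lam_bound cT (M := Bq * (K * normc h ^+ 2)) e0 _) _; last first.
  by rewrite -/Kc le_eqVlt; apply/orP; left; apply/eqP; ring.
move=> z zd; rewrite -mulrBr mulrCA -mulrBr normcM ncJ.
by apply: ler_pM; rewrite ?nc_ge0// ?HK// HBq// ltW.
Qed.

(** Rotation invariance of [Lam] transfers the rotation from the argument of [F] to [q], whose
    weight is known; the conjugate of e^(i m t) is its inverse. *)
Lemma Psi_rot t c : Psi (ei t * c) = ei (m * t) * Psi c.
Proof.
have h := Lam_dil e (@cI c) (normc_ei t).
have cJ : continuous (fun z => conjc (q z) * F (dil zeta (ei t * c) z) : Cx R) := @cI (ei t * c).
have E : (fun z => conjc (q z) * F (dil zeta c z)) \o dil zeta (ei t) =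
    (fun z => conjc (ei (m * t)) * (conjc (q z) * F (dil zeta (ei t * c) z))).
  by apply/funext => z /=; rewrite qw dilM rmorphM mulrA [c * _]mulrC.
rewrite E (LamZ e cJ) in h; rewrite /Psi -h mulrA.
by rewrite (_ : ei (m * t) * conjc (ei (m * t)) = 1) ?mul1r// ei_conj.
Qed.

(** Joint continuity of the integrand over a compact box. It serves at the boundary point 1, which
    [Psi_cderiv] does not reach. *)
Lemma Psi_cont (c0 : Cx R) (eta : R) : 0 < eta -> exists2 dl : R, 0 < dl & forall c, normc (c - c0) < dl ->
  normc (Psi c - Psi c0) <= eta.
Proof.
move=> eta0.
have [L L0 HL] := ellipsoid_box.
pose K := [set z : Cn R n | forall i, `|complex.Re (z 0 i)| <= L /\ `|complex.Im (z 0 i)| <= L].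
have cK : compact K := @box_compact R n L.
pose g (p : Cx R * Cn R n) : Cx R := conjc (q p.2) * F (dil zeta p.1 p.2).
have cg : continuous g.
  apply: continuousCM; last by apply: Dil_cont; [exact: continuous_fst|exact: continuous_snd].
  move=> p; apply: (@continuous_comp _ _ _ (fun p : Cx R * Cn R n => p.2) (fun z => conjc (q z) : Cx R)); last exact: ccq.
  exact: continuous_snd.
pose e1 := eta / (4 * (Kc + 1)).
have Kc1 : 0 < Kc + 1 by rewrite ltr_wpDl.
have e10 : 0 < e1 by rewrite divr_gt0 ?mulr_gt0.
have h1 := near_compact_continuous c0 (continuous_Re_comp cg) cK e10.
have h2 := near_compact_continuous c0 (continuous_Im_comp cg) cK e10.
have [dl dl0 Hdl] := nbhs_normc (filterI h1 h2).
exists dl => // c /Hdl[h3 h4].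
rewrite /Psi -(LamB e (@cI c) (@cI c0)).
apply: le_trans (Lam_bound (continuousCB (@cI c) (@cI c0)) (M := 2 * e1) e0 _) _.
  move=> z zd; have Kz : K z.
    by move=> i; split; apply: le_trans (HL z i (ltW zd)); [exact: Re_le_normc|exact: Im_le_normc].
  have := h3 z Kz; have := h4 z Kz; rewrite /g /= => h5 h6.
  rewrite -normcN opprB; apply: le_trans (normc_le_ReIm _) _.
  have ReB (a b : Cx R) : complex.Re (a - b) = complex.Re a - complex.Re b by case: a; case: b.
  have ImB (a b : Cx R) : complex.Im (a - b) = complex.Im a - complex.Im b by case: a; case: b.
  by rewrite ReB ImB mulrDl mul1r; apply: lerD; exact: ltW.
have -> : 2 * (2 * e1) * Kc = eta * (Kc / (Kc + 1)) by rewrite /e1; field; exact: lt0r_neq0.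
by rewrite -/Kc; apply: ler_piMr; [exact: ltW|rewrite ler_pdivrMr// mul1r lerDl].
Qed.

(** Euler's equation m Psi = t Psi', obtained by differentiating [Psi_rot] in the angle at 0: [c]
    moves along the circle of radius [t] by an angle [th], and [ei] is expanded to first order. *)
Lemma Psi_deriv t (D : Cx R) : 0 < t -> (forall e : R, 0 < e -> exists2 dl : R, 0 < dl &
    forall c, normc (c - creal t) < dl -> normc (Psi c - Psi (creal t) - D * (c - creal t)) <= e * normc (c - creal t)) ->
  creal m * Psi (creal t) = creal t * D.
Proof.
move=> t0 HD; set P := Psi (creal t).
pose N1 := normc (ci R * (creal m * P - creal t * D)).
have key (e1 : R) : 0 < e1 -> N1 <= e1 * (2 * t) + e1.
  move=> e10; have [dl dl0 Hdl] := HD e1 e10.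
  pose W := 4 * m ^+ 2 * normc P + 4 * t * normc D.
  have W0 : 0 <= W := addr_ge0 (mulr_ge0 (mulr_ge0 (ler0n R 4) (sqr_ge0 m)) (nc_ge0 P))
    (mulr_ge0 (mulr_ge0 (ler0n R 4) (ltW t0)) (nc_ge0 D)).
  (* Small enough for the displacement, at most [2 * th * t], to stay below [dl], and for the
     second-order terms, [W] times the square of [th], to stay below [th * e1]. *)
  pose th := Num.min (dl / (4 * t)) (e1 / (W + 1)).
  have W1 : 0 < W + 1 by rewrite ltr_wpDl.
  have th0 : 0 < th by rewrite lt_min !divr_gt0// mulr_gt0.
  have th1 : th <= dl / (4 * t) by rewrite /th ge_min lexx.
  have th2 : th <= e1 / (W + 1) by rewrite /th ge_min lexx orbT.
  have nh : normc (ei th * creal t - creal t) <= 2 * th * t.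
    rewrite -[X in _ - X]mul1r -mulrBl normcM normc_creal (gtr0_norm t0) -ei0 ler_pM2r//.
    by have := ei_lip th 0; rewrite subr0 gtr0_norm.
  have nd : normc (ei th * creal t - creal t) < dl.
    apply: le_lt_trans nh _; move: th1; rewrite ler_pdivlMr ?mulr_gt0// => th1.
    by apply: lt_le_trans th1; rewrite (_ : th * (4 * t) = 2 * th * t + 2 * th * t) ?ltrDl ?mulr_gt0//; ring.
  have h := Hdl _ nd; rewrite Psi_rot -/P in h.
  have hm := ei_taylor_abs (m * th); have h1 := ei_taylor_abs th.
  pose x1 := ei (m * th) - 1 - ci R * creal (m * th); pose x2 := ei th - 1 - ci R * creal th.
  have E : creal th * (ci R * (creal m * P - creal t * D)) =
    (ei (m * th) * P - P - D * (ei th * creal t - creal t)) - x1 * P + x2 * (creal t * D).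
    by rewrite /x1 /x2 crealM; ring.
  have : th * N1 <= th * (e1 * (2 * t) + e1).
    rewrite /N1 -{1}(gtr0_norm th0) -normc_creal -normcM E.
    apply: le_trans (ncD _ _) _; apply: le_trans (lerD (ncD _ _) (lexx _)) _.
    have n1 : normc (x2 * (creal t * D)) = normc x2 * (t * normc D).
      by rewrite normcM [normc (creal t * D)]normcM normc_creal (gtr0_norm t0).
    have n2 : normc (- (x1 * P)) = normc x1 * normc P by rewrite ncN normcM.
    rewrite n1 n2.
    have a1 := le_trans h (ler_wpM2l (ltW e10) nh).
    have a2 : normc x1 * normc P <= 4 * (m * th) ^+ 2 * normc P by rewrite ler_wpM2r ?nc_ge0.
    have a3 : normc x2 * (t * normc D) <= 4 * th ^+ 2 * (t * normc D).
      by rewrite ler_wpM2r// mulr_ge0 ?nc_ge0// ltW.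
    apply: le_trans (lerD (lerD a1 a2) a3) _.
    have a4 : th * (th * W) <= th * e1.
      rewrite ler_pM2l//; move: th2; rewrite ler_pdivlMr// => th2; apply: le_trans th2.
      by rewrite ler_pM2l// lerDl.
    have -> : e1 * (2 * th * t) + 4 * (m * th) ^+ 2 * normc P + 4 * th ^+ 2 * (t * normc D) =
      th * (e1 * (2 * t)) + th * (th * W) by rewrite /W; ring.
    by rewrite [leRHS]mulrDr lerD2l.
  by rewrite ler_pM2l.
have N0 : N1 = 0.
  apply/eqP; rewrite eq_le nc_ge0 andbT; apply/ler_addgt0Pr => x x0; rewrite add0r.
  have t1 : 0 < 2 * t + 1 by rewrite ltr_wpDl// mulr_ge0// ltW.
  have := key (x / (2 * t + 1)) (divr_gt0 x0 t1).
  by rewrite -[X in _ + X]mulr1 -mulrDr divfK ?lt0r_neq0.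
have /eqP := eq0_normc N0; rewrite mulf_eq0 (negbTE (ci_neq0 R)) /= subr_eq0 => /eqP.
by [].
Qed.

Let cPsi_is (t : R) (g : Cx R -> R) (D : Cx R) : (forall a b, g (a - b) = g a - g b) ->
  (forall a x, g (a * creal x) = g a * x) -> (forall a, `|g a| <= normc a) ->
  (forall e : R, 0 < e -> exists2 dl : R, 0 < dl &
    forall c, normc (c - creal t) < dl -> normc (Psi c - Psi (creal t) - D * (c - creal t)) <= e * normc (c - creal t)) ->
  is_derive t (1 : R) (fun x => g (Psi (creal x))) (g D).
Proof.
move=> gB gZ gn HD; apply: is_derive_small => e1 e10.
have [dl dl0 Hdl] := HD e1 e10; exists dl => // h hdl.
have E : creal (t + h) - creal t = creal h by rewrite crealD addrC addKr.
have := Hdl (creal (t + h)); rewrite E normc_creal => /(_ hdl).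
by apply: le_trans; rewrite -!gB -gZ -gB; exact: gn.
Qed.

(** By Euler's equation the derivative of exp(- m s) Psi(exp s) vanishes. [g] stands for the real or
    the imaginary part, so that the argument concerns real functions of a real variable. *)
Let Psi_const (g : Cx R -> R) : (forall a b, g (a - b) = g a - g b) ->
  (forall a x, g (a * creal x) = g a * x) -> (forall a, `|g a| <= normc a) ->
  forall a b, a <= b -> b < 0 ->
  expR (- m * a) * g (Psi (creal (expR a))) = expR (- m * b) * g (Psi (creal (expR b))).
Proof.
move=> gB gZ gn a b ab b0.
apply: (@is_derive0_cst R (fun s => expR (- m * s) * g (Psi (creal (expR s))))) => // s /andP[_ sb].
have s1 : normc (creal (expR s)) < 1.
  by rewrite normc_creal gtr0_norm ?expR_gt0// expR_lt1; exact: le_lt_trans b0.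
have [D HD] := Psi_cderiv s1.
have hD := Psi_deriv (expR_gt0 s) HD.
have d1 := cPsi_is gB gZ gn HD.
have d2 := is_derive_expR s.
have d3 : is_derive s (1 : R) (fun s => g (Psi (creal (expR s)))) _ := is_derive1_comp d1 d2.
have d4 : is_derive s (1 : R) (fun s => expR (- m * s)) (- m * expR (- m * s)).
  by apply: is_derive_eq; rewrite /GRing.scale /=; ring.
have := is_deriveM d4 d3; set E := expR (- m * s); set P := g (Psi _).
have gD : expR s * g D = m * P.
  by rewrite mulrC -gZ mulrC -hD mulrC gZ mulrC.
have E0 : E *: (g D * expR s) + P *: (- m * E) = 0.
  by rewrite /GRing.scale /= [g D * _]mulrC gD; ring.
by rewrite E0.
Qed.

Let ReB (a b : Cx R) : complex.Re (a - b) = complex.Re a - complex.Re b.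
Proof. by case: a; case: b. Qed.

Let ImB (a b : Cx R) : complex.Im (a - b) = complex.Im a - complex.Im b.
Proof. by case: a; case: b. Qed.

Let ReZ (a : Cx R) x : complex.Re (a * creal x) = complex.Re a * x.
Proof. by case: a => u v /=; rewrite mulr0 subr0. Qed.

Let ImZ (a : Cx R) x : complex.Im (a * creal x) = complex.Im a * x.
Proof. by case: a => u v /=; rewrite mulr0 add0r. Qed.

Let Psi_expb a b : a <= b -> b < 0 ->
  Psi (creal (expR a)) = creal (expR (m * (a - b))) * Psi (creal (expR b)).
Proof.
move=> ab b0.
have h1 := Psi_const ReB ReZ (@Re_le_normc R) ab b0.
have h2 := Psi_const ImB ImZ (@Im_le_normc R) ab b0.
have sc x y : expR (- m * a) * x = expR (- m * b) * y -> x = expR (m * (a - b)) * y.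
  move=> h; apply: (mulfI (lt0r_neq0 (expR_gt0 (- m * a)))); rewrite h mulrA -expRD; congr (expR _ * _); ring.
apply/eqP; rewrite eq_complex; apply/andP; split; apply/eqP.
  by rewrite (sc _ _ h1) [in RHS]mulrC ReZ mulrC.
by rewrite (sc _ _ h2) [in RHS]mulrC ImZ mulrC.
Qed.

(** Homogeneity on ]0, 1] in the variable exp s, which accommodates a real and possibly negative
    exponent [m]; continuity at 1 settles the endpoint s = 0. *)
Lemma Psi_exp s : s <= 0 -> Psi (creal (expR s)) = creal (expR (m * s)) * Psi 1.
Proof.
move=> s0.
have H1 (eta : R) : 0 < eta -> exists2 b0 : R, b0 < 0 & forall b, b0 < b -> b < 0 -> normc (Psi (creal (expR b)) - Psi 1) <= eta.
  move=> eta0; have [dl dl0 Hdl] := Psi_cont 1 eta0.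
  exists (- dl); first by rewrite oppr_lt0.
  move=> b b1 b0; apply: Hdl; rewrite (_ : 1 = creal 1); last by rewrite /creal rmorph1.
  rewrite -crealB normc_creal distrC.
  have := @expRN_lip R 0 (- b) (lexx _); rewrite oppr0 opprK expR0 add0r oppr_ge0 => /(_ (ltW b0)) h.
  apply: le_lt_trans h _; rewrite ltr0_norm//; lra.
move: s0; rewrite le_eqVlt => /orP[/eqP->|s0].
  by rewrite mulr0 expR0 /creal rmorph1 mul1r.
pose Y := creal (expR (- (m * s))) * Psi (creal (expR s)).
suff -> : Psi 1 = Y by rewrite /Y mulrA -crealM -expRD subrr expR0 /creal rmorph1 mul1r.
have ce : continuous (fun b : R => expR (m * b)).
  move=> b; apply: (@continuous_comp _ _ _ (fun b : R => m * b) (@expR R)); last exact: continuous_expR.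
  by apply: (continuousRM (@continuousRcst R _ m)) => ?; exact: cvg_id.
suff key (eta : R) : 0 < eta -> normc (Psi 1 - Y) <= eta.
  have : normc (Psi 1 - Y) = 0.
    apply/eqP; rewrite eq_le nc_ge0 andbT; apply/ler_addgt0Pr => x x0; rewrite add0r; exact: key.
  by move/eq0_normc/eqP; rewrite subr_eq0 => /eqP.
move=> eta0; have [b0 b00 Hb0] := H1 (eta / 2) (divr_gt0 eta0 (ltr0n R 2)).
have Y1 : 0 < 2 * (normc Y + 1) by rewrite mulr_gt0// ltr_wpDl ?nc_ge0.
have [dl dlp Hdl] := (continuousRP _).1 ce 0 _ (divr_gt0 eta0 Y1).
have dl0 : 0 < dl := dlp.
(* Halving a negative number moves it towards 0, which gives a negative [b] above [b0], [- dl] and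
   [s] at once. *)
pose b := Num.max (Num.max b0 (- dl)) s / 2.
have bm : Num.max (Num.max b0 (- dl)) s < 0 by rewrite !gt_max b00 oppr_lt0 dl0.
have [b_0 mb] : b < 0 /\ Num.max (Num.max b0 (- dl)) s < b by rewrite /b; split; lra.
move: mb; rewrite !gt_max => /andP[/andP[b1 b2] b3].
have h1 := Hb0 b b1 b_0.
have h2 : `|expR (m * 0) - expR (m * b)| < eta / (2 * (normc Y + 1)).
  by apply: Hdl; rewrite /= sub0r normrN ltr0_norm//; lra.
clearbody b.
have E : Psi (creal (expR b)) = creal (expR (m * b)) * Y.
  rewrite /Y (Psi_expb (ltW b3) b_0); move: (Psi (creal (expR b))) => X; rewrite !mulrA -!crealM -!expRD.
  by rewrite (_ : m * b + - (m * s) + m * (s - b) = 0) ?expR0 /creal ?rmorph1 ?mul1r//; ring.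
rewrite E in h1.
have -> : Psi 1 - Y = - (creal (expR (m * b)) * Y - Psi 1) - creal (expR (m * 0) - expR (m * b)) * Y.
  by rewrite crealB mulr0 expR0 (_ : creal 1 = 1); [ring|rewrite /creal rmorph1].
apply: le_trans (ncD _ _) _; rewrite !ncN normcM normc_creal.
have h3 : `|expR (m * 0) - expR (m * b)| * normc Y <= eta / 2.
  apply: le_trans (ler_wpM2r (nc_ge0 _) (ltW h2)) _.
  move: (normc Y) Y1 (nc_ge0 Y) => N1 Y1 N10.
  have -> : eta / (2 * (N1 + 1)) * N1 = eta / 2 * (N1 / (N1 + 1)) by field; apply: lt0r_neq0; lra.
  apply: ler_piMr; first by rewrite ltW// divr_gt0.
  by rewrite ler_pdivrMr ?mul1r; lra.
lra.
Qed.

End Psi.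

Lemma continuous_monos (L : seq ({ffun 'I_n -> nat} * Cx R)) :
  continuous (fun z => \sum_(p <- L) p.2 * mono p.1 (z - zeta) : Cx R).
Proof.
apply: (@continuousC_sum R _ _ L (fun p z => p.2 * mono p.1 (z - zeta))) => p.
apply: (continuousCM (@continuousCcst R _ _)).
exact: (@continuous_mono R n _ _ p.1 (continuous_rowB (@continuous_rowid R n) (@continuous_rowcst R _ n zeta))).
Qed.

Lemma Lam_monos_cvg (q : Cn R n -> Cx R) (L : seq ({ffun 'I_n -> nat} * Cx R)) : continuous q ->
  (forall g, Lam e (fun z => conjc (q z) * mono g (z - zeta)) @[e --> 0^'+] --> (0 : Cx R)) ->
  Lam e (fun z => conjc (q z) * \sum_(p <- L) p.2 * mono p.1 (z - zeta)) @[e --> 0^'+] --> (0 : Cx R).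
Proof.
move=> cq Ho.
have ccq : continuous (fun z => conjc (q z) : Cx R) by exact: (continuousC_comp cq (@continuous_conjc R)).
have cm g : continuous (fun z => conjc (q z) * mono g (z - zeta) : Cx R).
  apply: (continuousCM ccq).
  exact: (@continuous_mono R n _ _ g (continuous_rowB (@continuous_rowid R n) (@continuous_rowcst R _ n zeta))).
rewrite (_ : (fun e => _) = fun e => \sum_(p <- L) p.2 * Lam e (fun z => conjc (q z) * mono p.1 (z - zeta))).
  exact: (@cvg0_list R R _ _ _ L (fun g e => Lam e (fun z => conjc (q z) * mono g (z - zeta))) Ho).
apply/funext => e.
rewrite -(eq_bigr _ (fun p _ => LamZ e (cm p.1) p.2)) -Lam_sum; last first.
  by move=> p; exact: (continuousCM (@continuousCcst R _ _) (cm p.1)).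
congr (Lam e _); apply/funext => z; rewrite mulr_sumr; apply: eq_bigr => p _; exact: mulrCA.
Qed.

Lemma orth_limit (q : Cn R n -> Cx R) (m : R) : continuous q ->
  (forall t z, q (dil zeta (ei t) z) = ei (m * t) * q z) ->
  (forall g, Lam e (fun z => conjc (q z) * mono g (z - zeta)) @[e --> 0^'+] --> (0 : Cx R)) ->
  Lam e (fun z => conjc (q z) * F z) @[e --> 0^'+] --> (0 : Cx R).
Proof.
move=> cq qw Ho; apply/cvgcP => eta eta0.
(* Order at least m + 1, so that t^(- m) t^M <= t for t <= 1. *)
have [M Mm] : exists M : nat, m + 1 <= M%:R.
  exists (Num.bound `|m + 1|); apply: le_trans (ler_norm _) _; apply: ltW.
  exact: (archi_boundP (normr_ge0 (m + 1))).
have [Bq Bq0 HBq] := F_bounded cq.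
have zd : Nf zeta < sd by rewrite /Nf subrr nfm0.
have [r r0 [C C0 [L HL]]] := poly_approx M zd.
have [Kc Kc0 HKc] := chi_bound.
have [K1 K10 HK1] := nfm_coord A_sym A_pd.
pose S := (n%:R * (K1 * sd) ^+ M : R).
have S0 : 0 <= S by rewrite mulr_ge0// exprn_ge0// mulr_ge0// ltW.
pose W := 2 * (Bq * (C * S)) * Kc.
have W0 : 0 <= W := mulr_ge0 (mulr_ge0 (ler0n R 2) (mulr_ge0 Bq0 (mulr_ge0 C0 S0))) Kc0.
have ccq : continuous (fun z => conjc (q z) : Cx R) by exact: (continuousC_comp cq (@continuous_conjc R)).
(* at the dilation factor t = exp s the Taylor remainder contributes at most W t *)
pose t := Num.min (Num.min 1 (r / (K1 * sd))) (eta / (2 * (W + 1))).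
have W1 : 0 < W + 1 by rewrite ltr_wpDl.
have Ksd : 0 < K1 * sd by rewrite mulr_gt0.
have t0 : 0 < t by rewrite !lt_min ltr01 !divr_gt0// mulr_gt0.
have t1 : t <= 1 by rewrite /t !ge_min lexx.
have tr : t <= r / (K1 * sd) by rewrite /t !ge_min lexx orbT.
have te : t <= eta / (2 * (W + 1)) by rewrite /t ge_min lexx orbT.
clearbody t.
pose nw (p : {ffun 'I_n -> nat} * Cx R) : {ffun 'I_n -> nat} * Cx R :=
  (p.1, p.2 * creal t ^+ (\sum_i p.1 i)%N).
pose Ls := [seq nw p | p <- L].
pose Q z : Cx R := \sum_(p <- Ls) p.2 * mono p.1 (z - zeta).
have cQ : continuous Q by exact: continuous_monos.
have cqQ : continuous (fun z => conjc (q z) * Q z : Cx R) := continuousCM ccq cQ.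
have HQ z : Nf z < sd -> normc (F (dil zeta (creal t) z) - Q z) <= C * S * t ^+ M.
  move=> Nz; have nv i : normc ((z - zeta) 0 i) <= K1 * sd.
    apply: le_trans (HK1 _ _) _; rewrite ler_pM2l//; exact: ltW.
  have ni i : normc (dil zeta (creal t) z 0 i - zeta 0 i) = t * normc ((z - zeta) 0 i).
    rewrite (_ : _ - _ = creal t * (z - zeta) 0 i); last by rewrite !mxE; ring.
    by rewrite normcM normc_creal gtr0_norm.
  have Pz i : normc (dil zeta (creal t) z 0 i - zeta 0 i) <= r.
    rewrite ni; apply: le_trans (_ : t * (K1 * sd) <= _); first by rewrite ler_pM2l.
    by rewrite -ler_pdivlMr.
  have := HL _ Pz.
  have -> : \sum_(p <- L) p.2 * mono p.1 (dil zeta (creal t) z - zeta) = Q z.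
    by rewrite /Q big_map; apply: eq_bigr => p _; rewrite dilB mono_scale mulrA.
  move=> h; apply: le_trans h _; rewrite -mulrA ler_wpM2l//.
  have -> : S * t ^+ M = \sum_(i < n) (t * (K1 * sd)) ^+ M.
    by rewrite sumr_const card_ord -mulr_natl exprMn /S; ring.
  apply: ler_sum => i _; rewrite ni; apply: lerXn2r; rewrite ?nnegrE ?mulr_ge0 ?nc_ge0 ?(ltW t0) ?(ltW K10) ?(ltW sd0)//.
  by rewrite ler_pM2l.
(* [Q] depends on [t] but not on the tube width, so with [t] fixed its pairing with [q] tends to 0
   by the hypothesis on monomials. *)
have lim := @Lam_monos_cvg q Ls cq Ho.
pose s := ln t.
have st : expR s = t by rewrite /s lnK.
have s0 : s <= 0 by rewrite /s ln_le0.
have tM : expR (- (m * s)) * t ^+ M <= t.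
  rewrite -st -expRM_natl -expRD ler_expR.
  have := ler_wnM2r s0 Mm; lra.
(* The tolerance carries the factor t^m because undoing the contraction multiplies it by t^(- m). *)
have eta1 : 0 < expR (m * s) * (eta / 4) by rewrite mulr_gt0 ?expR_gt0 ?divr_gt0.
near=> e.
have e0 : 0 < e by near: e; exact: nbhs_right_gt.
have Kce : e^-1 * V (chi e) <= Kc by near: e.
have hl : normc (0 - Lam e (fun z => conjc (q z) * Q z)) < expR (m * s) * (eta / 4).
  by near: e; move/cvgcP : lim; apply.
rewrite sub0r ncN in hl; rewrite sub0r ncN.
have cFt : continuous (fun z => F (dil zeta (creal t) z)).
  by apply: Dil_cont; [exact: (@continuousCcst R _ _)|exact: continuous_rowid].
have cqF : continuous (fun z => conjc (q z) * F (dil zeta (creal t) z) : Cx R) := continuousCM ccq cFt.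
have hP := Psi_exp cq qw e0 s0; rewrite st in hP.
have E1 : Lam e (fun z => conjc (q z) * F z) = creal (expR (- (m * s))) * Lam e (fun z => conjc (q z) * F (dil zeta (creal t) z)).
  rewrite hP mulrA -crealM -expRD addNr expR0 /creal rmorph1 mul1r.
  by congr (Lam e _); apply/funext => z; rewrite dil1.
rewrite E1 normcM normc_creal gtr0_norm ?expR_gt0//.
have h1 : normc (Lam e (fun z => conjc (q z) * F (dil zeta (creal t) z)) - Lam e (fun z => conjc (q z) * Q z))
    <= W * t ^+ M.
  rewrite -LamB//; apply: le_trans (Lam_bound (continuousCB cqF cqQ) (M := Bq * (C * S * t ^+ M)) e0 _) _.
    move=> z Nz; rewrite -mulrBr normcM ncJ; by apply: ler_pM; rewrite ?nc_ge0 ?HQ//; apply: HBq; exact: ltW.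
  have -> : W * t ^+ M = 2 * (Bq * (C * S * t ^+ M)) * Kc by rewrite /W; ring.
  by apply: ler_wpM2l => //; exact: (mulr_ge0 (ler0n R 2) (mulr_ge0 Bq0 (mulr_ge0 (mulr_ge0 C0 S0) (exprn_ge0 M (ltW t0))))).
have h2 : normc (Lam e (fun z => conjc (q z) * F (dil zeta (creal t) z))) <= W * t ^+ M + expR (m * s) * (eta / 4).
  rewrite -[X in normc X](subrK (Lam e (fun z => conjc (q z) * Q z))).
  apply: le_trans (ncD _ _) _; apply: lerD => //; exact: ltW.
apply: le_lt_trans (_ : _ <= expR (- (m * s)) * (W * t ^+ M + expR (m * s) * (eta / 4))) _.
  by rewrite ler_pM2l ?expR_gt0.
have -> : expR (- (m * s)) * (W * t ^+ M + expR (m * s) * (eta / 4)) =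
  W * (expR (- (m * s)) * t ^+ M) + expR (- (m * s)) * expR (m * s) * (eta / 4) by ring.
rewrite -expRD addNr expR0 mul1r.
have h3 : W * (expR (- (m * s)) * t ^+ M) <= W * t by rewrite ler_wpM2l.
have h4 : W * t <= eta / 2.
  apply: le_trans (_ : (W + 1) * t <= _); first by rewrite ler_pM2r// lerDl.
  move: te; rewrite !ler_pdivlMr ?mulr_gt0//; lra.
lra.
Unshelve. all: by end_near. Qed.

End Holo.

(** * The projection of polynomials *)

Lemma Lam_conj e (G : Cn R n -> Cx R) : continuous G ->
  Lam e (fun z => conjc (G z)) = conjc (Lam e G).
Proof.
move=> cG; have [_ aI] := cadm_mul (chi_adm e) cG.
rewrite /Lam rmorphM !vol_intE; congr (_ * _).
  by apply/eqP; rewrite eq_complex /= oppr0 !eqxx.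
apply/eqP; rewrite eq_complex; apply/andP; split; apply/eqP.
  rewrite [LHS]/= [RHS]/=; congr V; apply/funext => z.
  by case: (G z) => x y /=; ring.
rewrite [LHS]/= [RHS]/= -[RHS]mulN1r -VZ//; congr V; apply/funext => z.
by case: (G z) => x y /=; ring.
Qed.

Let conjMl (a b : Cx R) : conjc (conjc a * b) = a * conjc b.
Proof. by rewrite rmorphM /= conjcK. Qed.

Let conjMr (a b : Cx R) : conjc (a * conjc b) = conjc a * b.
Proof. by rewrite rmorphM /= conjcK. Qed.

Let cmono g : continuous (fun z : Cn R n => mono g (z - zeta)).
Proof. exact: (@continuous_mono R n _ _ g (continuous_rowB (@continuous_rowid R n) (@continuous_rowcst R _ n zeta))). Qed.

Let ei_inv t : conjc (ei t) = ei (- t) :> Cx R.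
Proof. by apply/eqP; rewrite eq_complex /= cosN sinN !eqxx. Qed.

(* a rotation by pi / (k - m) multiplies the integrand by -1 *)
Lemma Lam_weight0 e (q : Cn R n -> Cx R) (m : R) (g : {ffun 'I_n -> nat}) : continuous q ->
  (forall t z, q (dil zeta (ei t) z) = ei (m * t) * q z) -> ((\sum_i g i)%N%:R != m) ->
  Lam e (fun z => conjc (q z) * mono g (z - zeta)) = 0.
Proof.
move=> cq qw; set k := (\sum_i g i)%N => km.
have km0 : k%:R - m != 0 by rewrite subr_eq0.
have ccq : continuous (fun z => conjc (q z) : Cx R) by exact: (continuousC_comp cq (@continuous_conjc R)).
have cI : continuous (fun z => conjc (q z) * mono g (z - zeta) : Cx R) := continuousCM ccq (@cmono g).
pose t := pi / (k%:R - m).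
have h := Lam_dil e cI (normc_ei t).
have E : (fun z => conjc (q z) * mono g (z - zeta)) \o dil zeta (ei t) =
    fun z => -1 * (conjc (q z) * mono g (z - zeta)).
  have cM (a b : Cx R) : conjc (a * b) = conjc a * conjc b := rmorphM _ a b.
  apply/funext => z; rewrite [LHS]/= qw dilB mono_scale cM ei_inv -eiX mulrACA -eiD.
  have -> : - (m * t) + k%:R * t = pi by rewrite /t; field.
  by congr (_ * _); apply/eqP; rewrite eq_complex /= cospi sinpi oppr0 !eqxx.
rewrite E (LamZ e cI) mulN1r in h.
have : Lam e (fun z => conjc (q z) * mono g (z - zeta)) *+ 2 = 0 by rewrite mulr2n -{1}h addNr.
by move/eqP; rewrite mulrn_eq0 => /eqP.
Qed.

(** Stands for the inner product on the boundary; for continuous arguments the limit exists by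
    [Lam_cvg]. *)
Definition ip (f g : Cn R n -> Cx R) : Cx R :=
  lim (Lam e (fun z => f z * conjc (g z)) @[e --> 0^'+]).

Let cconj (f : Cn R n -> Cx R) : continuous f -> continuous (fun z => conjc (f z) : Cx R).
Proof. by move=> cf; exact: (continuousC_comp cf (@continuous_conjc R)). Qed.

Lemma ip_cvg (f g : Cn R n -> Cx R) : continuous f -> continuous g ->
  Lam e (fun z => f z * conjc (g z)) @[e --> 0^'+] --> ip f g.
Proof.
move=> cf cg; have [l Hl] := Lam_cvg (continuousCM cf (cconj cg)).
exact: cvgP Hl.
Qed.

Let R0 : ProperFilter (0 : R)^'+.
Proof. exact: at_right_proper_filter. Qed.

Let RF : Filter (0 : R)^'+.
Proof. exact: _. Qed.

Let ip_lin' (f g h : Cn R n -> Cx R) c : continuous f -> continuous g -> continuous h ->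
  ip (fun z => f z + c * g z) h = ip f h + c * ip g h.
Proof.
move=> cf cg ch; have cfg := continuousCD cf (continuousCM (@continuousCcst R _ c) cg).
apply: (@cvgc_unique R R _ R0 _ _ _ (ip_cvg cfg ch)).
have := @cvgc_lin R R _ RF _ _ _ _ c (ip_cvg cf ch) (ip_cvg cg ch).
rewrite (_ : (fun e => Lam e (fun z => f z * conjc (h z)) + c * Lam e (fun z => g z * conjc (h z))) =
  fun e => Lam e (fun z => (f z + c * g z) * conjc (h z)))//.
apply/funext => e; have c1 := continuousCM cf (cconj ch); have c2 := continuousCM cg (cconj ch).
rewrite -(LamZ e c2) -(LamD e c1 (continuousCM (@continuousCcst R _ c) c2)).
by congr (Lam e _); apply/funext => z; rewrite mulrDl mulrA.
Qed.

Let ip_sym' (f g : Cn R n -> Cx R) : continuous f -> continuous g -> ip g f = conjc (ip f g).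
Proof.
move=> cf cg; apply: (@cvgc_unique R R _ R0 _ _ _ (ip_cvg cg cf)).
have := cvgc_conj RF (ip_cvg cf cg).
rewrite (_ : (fun e => conjc _) = fun e => Lam e (fun z => g z * conjc (f z)))//.
apply/funext => e; rewrite -Lam_conj; last exact: (continuousCM cf (cconj cg)).
by congr (Lam e _); apply/funext => z; rewrite conjMr mulrC.
Qed.

Let ip_pos' (f : Cn R n -> Cx R) : continuous f -> exists2 r : R, 0 <= r & ip f f = creal r.
Proof.
move=> cf.
pose f2 z := complex.Re (f z) ^+ 2 + complex.Im (f z) ^+ 2.
have cRe := continuous_Re_comp cf; have cIm := continuous_Im_comp cf.
have cf2 : continuous f2.
  rewrite (_ : f2 = fun z => complex.Re (f z) * complex.Re (f z) + complex.Im (f z) * complex.Im (f z)).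
    exact: (continuousRD (continuousRM cRe cRe) (continuousRM cIm cIm)).
  by apply/funext => z; rewrite /f2 !expr2.
have f20 z : 0 <= f2 z by rewrite addr_ge0// sqr_ge0.
have [r Hr] := tube_limit cf2.
have a e := adm_mul (chi_adm e) cf2.
exists r.
  apply: (cvgr_to_ge Hr); near=> e.
  have e0 : 0 < e by near: e; exact: nbhs_right_gt.
  apply: mulr_ge0; first by rewrite invr_ge0 ltW.
  rewrite -(V0 R n); apply: V_le => //; first exact: adm0.
  by move=> z; rewrite mulr_ge0// chi_ge0.
apply: (@cvgc_unique R R _ R0 _ _ _ (ip_cvg cf cf)); apply/cvgcP => eta eta0.
move/cvgrPdist_lt : Hr => /(_ eta eta0); apply: filterS => e he.
rewrite (_ : Lam e _ = creal (e^-1 * V (fun z => chi e z * f2 z))) -?crealB ?normc_creal//.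
rewrite crealM /Lam vol_intE; congr (_ * _); apply/eqP; rewrite eq_complex; apply/andP; split; apply/eqP.
  rewrite [LHS]/= [RHS]/=; congr V; apply/funext => z.
  by rewrite /f2; case: (f z) => x y /=; ring.
rewrite [LHS]/= [RHS]/= -[RHS](V0 R n); congr V; apply/funext => z.
by case: (f z) => x y /=; ring.
Unshelve. all: by end_near. Qed.

(** The conjugate sits on [f], so that contracting [F] makes the pairing a holomorphic function of
    the contraction factor; a final conjugation restores the Hardy pairing. *)
Definition limit_orth (f : Cn R n -> Cx R) : Prop :=
  forall F : Cn R n -> Cx R, continuous F ->
    (forall z, Nf z < sd -> forall i : 'I_n, cderiv (fun c => F (upd z i c)) (z 0 i)) ->
    Lam e (fun z => conjc (f z) * F z) @[e --> 0^'+] --> (0 : Cx R).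

Lemma limit_orth_lin (f g : Cn R n -> Cx R) c : continuous f -> continuous g -> limit_orth f -> limit_orth g ->
  limit_orth (fun z => f z + c * g z).
Proof.
move=> cf cg Hf Hg F cF dF.
have := @cvgc_lin R R _ RF _ _ _ _ (conjc c) (Hf F cF dF) (Hg F cF dF); rewrite mulr0 addr0.
have c1 := continuousCM (cconj cf) cF; have c2 := continuousCM (cconj cg) cF.
rewrite (_ : (fun e => Lam e _ + _) = fun e => Lam e (fun z => conjc (f z + c * g z) * F z))//.
apply/funext => e; rewrite -(LamZ e c2) -(LamD e c1 (continuousCM (@continuousCcst R _ _) c2)).
by congr (Lam e _); apply/funext => z; rewrite rmorphD rmorphM mulrDl mulrA.
Qed.

Local Notation sh := (@shF R n zeta).
Local Notation csh := (@cshF R n zeta).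

Let csh1 i : continuous (sh i).
Proof. exact: (continuousCB (@continuous_coord R n i) (@continuousCcst R _ _)). Qed.

Let csh2 i : continuous (csh i).
Proof. exact: (cconj (@csh1 i)). Qed.

Let psp_cont N f : psp sh csh N f -> continuous f.
Proof. exact: psp_continuous. Qed.

Let psp_idcont N f : psp (@idF R n) (@idF R n) N f -> continuous f.
Proof. by apply: psp_continuous => i; exact: continuous_idF. Qed.

(** The monomial and its projection share the weight [m], so their difference satisfies the
    equivariance hypothesis of [orth_limit]. *)
Lemma psp_projection_mon N (a b : {ffun 'I_n -> nat}) : (\sum_i a i + \sum_i b i <= N)%N ->
  exists2 h, psp (@idF R n) (@idF R n) N h &
    limit_orth (fun z => \prod_i (sh i z ^+ a i * csh i z ^+ b i) + -1 * h z).
Proof.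
move=> abN; pose p (z : Cn R n) : Cx R := \prod_i (sh i z ^+ a i * csh i z ^+ b i).
have cp : continuous p := psp_cont (psp_mon sh csh abN).
set da := (\sum_i a i)%N in abN; set db := (\sum_i b i)%N in abN.
pose m : R := da%:R - db%:R.
have pw t z : p (dil zeta (ei t) z) = ei (m * t) * p z.
  have -> : ei (m * t) = ei t ^+ da * conjc (ei t) ^+ db :> Cx R.
    by rewrite ei_inv -!eiX -eiD; congr ei; rewrite /m; ring.
  rewrite /p /da /db -!prodrXr -!big_split /=; apply: eq_bigr => i _.
  rewrite /shF /cshF.
  have -> : dil zeta (ei t) z 0 i - zeta 0 i = ei t * (z 0 i - zeta 0 i) by rewrite !mxE; ring.
  by rewrite rmorphM !exprMn; ring.
pose ex (g : {ffun 'I_n -> 'I_N.+1}) : {ffun 'I_n -> nat} := [ffun i => g i : nat].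
pose mk (g : {ffun 'I_n -> 'I_N.+1}) (z : Cn R n) : Cx R := mono (ex g) (z - zeta).
(* The holomorphic monomials of degree da - db, described without natural subtraction: when
   [da < db] the list is empty and the projection is 0. *)
pose L := map mk [seq g : {ffun 'I_n -> 'I_N.+1} <- enum {: {ffun 'I_n -> 'I_N.+1}} | ((\sum_i g i)%N + db == da)%N].
have HL f : List.In f L -> exists2 g : {ffun 'I_n -> nat}, f = (fun z => mono g (z - zeta)) &
    ((\sum_i g i)%N + db = da)%N.
  move/List.in_map_iff => [g [<-]]; elim: (enum _) => //= x s IH; case: ifP => //= /eqP xd [<-|/IH//].
  exists (ex x) => //; rewrite -xd; congr (_ + _)%N; apply: eq_bigr => i _; exact: ffunE.
have LH (g : {ffun 'I_n -> nat}) : ((\sum_i g i)%N + db = da)%N -> List.In (fun z => mono g (z - zeta)) L.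
  move=> gd; have gN i : (g i < N.+1)%N.
    rewrite ltnS; apply: leq_trans abN; rewrite -gd -addnA; apply: leq_trans (leq_addr _ _).
    by rewrite (bigD1 i)//= leq_addr.
  pose g' : {ffun 'I_n -> 'I_N.+1} := [ffun i => Ordinal (gN i)].
  apply/List.in_map_iff; exists g'; split.
    by apply/funext => z; congr (mono _ _); apply/ffunP => i; rewrite !ffunE.
  have : g' \in enum {: {ffun 'I_n -> 'I_N.+1}} by rewrite mem_enum.
  have gd' : ((\sum_i g' i)%N + db == da)%N.
    by apply/eqP; rewrite -gd; congr (_ + _)%N; apply: eq_bigr => i _; rewrite ffunE.
  elim: (enum _) => //= x s IH; rewrite inE => /orP[/eqP<-|/IH h]; first by rewrite gd'; left.
  by case: ifP => // _; right.
have WL : allW (fun f : Cn R n -> Cx R => continuous f) L.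
  by apply: allW_In => f /HL[g -> _]; exact: cmono.
have W0 : continuous (fun _ : Cn R n => 0 : Cx R) := @continuousCcst R _ 0.
have Wlin (f g : Cn R n -> Cx R) c : continuous f -> continuous g -> continuous (fun z => f z + c * g z).
  by move=> cf cg; exact: (continuousCD cf (continuousCM (@continuousCcst R _ c) cg)).
have [h Hh Ph] := projection W0 Wlin ip_lin' ip_sym' ip_pos' WL cp.
(* Every monomial of [L] has degree at most [da], hence at most [N]; this is where the degree of the
   projection is bounded. *)
have hp : psp (@idF R n) (@idF R n) N h.
  apply: (comb_ind (P := psp (@idF R n) (@idF R n) N) _ _ _ Hh); [exact: psp0|exact: psp_lin|].
  move=> f /HL[g -> gd]; apply: psp_mono_shift; apply: leq_trans abN; rewrite -gd -addnA; exact: leq_addr.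
have hw t z : h (dil zeta (ei t) z) = ei (m * t) * h z.
  apply: (comb_ind (P := fun f => f (dil zeta (ei t) z) = ei (m * t) * f z) _ _ _ Hh).
  - by rewrite mulr0.
  - by move=> f g c -> ->; ring.
  move=> f /HL[g -> gd]; rewrite dilB mono_scale -eiX; congr (ei _ * _).
  by rewrite /m -gd natrD; ring.
have ch := psp_idcont hp; exists h => // F cF dF.
have cq := Wlin p h (-1) cp ch.
have qw t z : p (dil zeta (ei t) z) + -1 * h (dil zeta (ei t) z) = ei (m * t) * (p z + -1 * h z).
  by rewrite pw hw; ring.
apply: (orth_limit cF dF cq qw) => g.
have [gd|gd] := eqVneq ((\sum_i g i)%N + db)%N da.
  have h0 := perp_In Ph (LH g gd).
  have := cvgc_conj RF (ip_cvg cq (@cmono g)); rewrite h0 rmorph0.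
  rewrite (_ : (fun e => conjc _) = fun e => Lam e (fun z => conjc (p z + -1 * h z) * mono g (z - zeta)))//.
  apply/funext => e; rewrite -Lam_conj; last exact: (continuousCM cq (cconj (@cmono g))).
  by congr (Lam e _); apply/funext => z; rewrite conjMr.
have km : (\sum_i g i)%N%:R != m.
  by apply: contra gd => /eqP gm; rewrite -(eqr_nat R) natrD gm /m subrK.
apply/cvgcP => e e0; apply: nearW => x; rewrite (Lam_weight0 x cq qw km) subrr normc0//.
Qed.

Lemma psp_projection N f : psp sh csh N f ->
  exists2 h, psp (@idF R n) (@idF R n) N h & limit_orth (fun z => f z + -1 * h z).
Proof.
elim=> {N f} [N a b ab|N f g c Hf [hf Pf Of] Hg [hg Pg Og]]; first exact: psp_projection_mon.
exists (fun z => hf z + c * hg z); first exact: psp_lin.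
have cf := psp_cont Hf; have cg := psp_cont Hg; have cf' := psp_idcont Pf; have cg' := psp_idcont Pg.
have Wlin (f1 g1 : Cn R n -> Cx R) c0 : continuous f1 -> continuous g1 -> continuous (fun z => f1 z + c0 * g1 z).
  by move=> c1 c2; exact: (continuousCD c1 (continuousCM (@continuousCcst R _ _) c2)).
have := limit_orth_lin c (Wlin _ _ (-1) cf cf') (Wlin _ _ (-1) cg cg') Of Og.
by congr limit_orth; apply/funext => z; ring.
Qed.

Lemma psp_holo N h : psp (@idF R n) (@idF R n) N h -> holo_cont (ellipsoid A zeta d) h.
Proof.
move=> Hh; split; first by apply: continuous_subspaceT; exact: psp_idcont Hh.
by move=> z _ j; exact: psp_derivable Hh z j.
Qed.

Lemma limit_orth_hardy (f h : Cn R n -> Cx R) : continuous f -> continuous h -> limit_orth (fun z => f z + -1 * h z) ->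
  orth_hardy (ellipsoid A zeta d) (fun=> 1) (f - h).
Proof.
move=> cf ch Ho F /holo_extend[cE E dE]; apply/bdry_integralE.
have cq : continuous (fun z => f z + -1 * h z).
  exact: (continuousCD cf (continuousCM (@continuousCcst R _ _) ch)).
have := cvgc_conj RF (Ho _ cE dE); rewrite rmorph0.
rewrite (_ : (fun e => conjc _) = fun e => Lam e (fun z => (f - h) z * conjc (F z) * creal 1))//.
apply/funext => e; rewrite -Lam_conj; last exact: (continuousCM (cconj cq) cE).
apply: Lam_eq => z zd; rewrite (E z (ltW zd)) conjMl mulN1r.
by rewrite /creal rmorph1 mulr1.
Qed.

Lemma szego_ellipsoid N : szego_image_eq (ellipsoid A zeta d) (fun=> 1) (@polyPN R n N) (@polyHPN R n N).
Proof.
split=> [p Pp|h Ph].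
  have Hp := psp_reim_shift zeta (polyPN_psp Pp).
  have [h Ph Oh] := psp_projection Hp.
  exists h; first exact: psp_polyHPN.
  split; first exact: psp_holo Ph.
  exact: (limit_orth_hardy (psp_cont Hp) (psp_idcont Ph) Oh).
(* A holomorphic polynomial belongs to [polyPN] and is its own projection, the difference being
   0. *)
have Hh := polyHPN_psp Ph; have ch := psp_idcont Hh.
exists h; first exact/psp_polyPN/psp_id_reim.
split; first exact: psp_holo Hh.
apply: limit_orth_hardy => // F cF dF.
apply/cvgcP => e e0; apply: nearW => x.
have -> : Lam x (fun z => conjc (h z + -1 * h z) * F z) = Lam x (fun z => 0 * F z).
  by congr (Lam x _); apply/funext => z; rewrite mulN1r subrr rmorph0.
by rewrite LamZ// mul0r subrr normc0.
Qed.

End Ellipsoid.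

Lemma smooth_cst (R : realType) (n : nat) (a : R) : smooth (fun _ : Cn R n => a).
Proof.
move=> ds; suff [b ->] : exists b, pder ds (fun _ : Cn R n => a) = fun=> b.
  by split; [exact: continuousRcst|move=> z v; exact: derivable_cst].
elim: ds => [|v ds [b IH]]; first by exists a.
exists 0; rewrite /pder /= -/(pder ds _) IH; apply/funext => z.
by rewrite derive1_cst.
Qed.

Theorem theorem4 (R : realType) (n : nat) (hn : (1 <= n)%N)
  (d : R) (hd : 0 < d)
  (A : 'M[R]_n) (A_sym : A^T = A)
  (A_pd : forall v : 'rV[R]_n, v != 0 -> 0 < (v *m A *m v^T) 0 0)
  (zeta : 'rV[(R[i])^o]_n) :
  exists omega : 'rV[(R[i])^o]_n -> R,
    smooth omega /\
    (forall z, bdry (ellipsoid A zeta d) z -> 0 < omega z) /\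
    (forall N : nat,
       szego_image_eq (ellipsoid A zeta d) omega (@polyPN R n N) (@polyHPN R n N)).
Proof.
exists (fun=> 1); split; first exact: smooth_cst.
by split=> [z _|N]; [exact: ltr01|exact: szego_ellipsoid].
Qed.
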